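(* Let $S\subset\mathbb{R}^n$ be a semialgebraic set with interior $S^\circ$, and let $I\subset\mathbb{R}[x]=\mathbb{R}[x_1,\dots,x_n]$ be an ideal with prime decomposition $I=I_1\cap\cdots\cap I_k$. Suppose $S^\circ\cap\mathcal{V}(I)\neq\emptyset$. Then the following are equivalent: (i) $\mathcal{I}(S^\circ\cap\mathcal{V}(I))=I$; (ii) for every $t$ with $1\le t\le k$ there exists $x^t\in\mathcal{V}(I_t)\cap S^\circ$ such that $\operatorname{rank}_{x^t}I_t=n-\dim I_t$; (iii) for every $t$ with $1\le t\le k$, $\dim^{\mathrm{top}}(\mathcal{V}(I_t)\cap S^\circ)=\dim I_t$.
   Context: A semialgebraic set in $\mathbb{R}^n$ is a finite union of sets of the form $\bigcap_j\{x: g_j(x)*_j0\}$ with $g_j\in\mathbb{R}[x]$ and $*_j\in\{>,\ge,=\}$. For an ideal $J\subset\mathbb{R}[x]$, $\mathcal{V}(J)=\{x\in\mathbb{R}^n:p(x)=0\ \forall p\in J\}$; for $A\subset\mathbb{R}^n$, $\mathcal{I}(A)=\{p\in\mathbb{R}[x]:p|_A=0\}$. ''Prime decomposition'' means an irredundant expression of $I$ as an intersection of prime ideals $I_1,\dots,I_k$. $\dim I_t$ is the Krull dimension of $\mathbb{R}[x]/I_t$ (transcendence degree of its fraction field). For $I_t=\langle f_1,\dots,f_m\rangle$ and $x\in\mathcal{V}(I_t)$, $\operatorname{rank}_xI_t$ is the rank of the Jacobian matrix $\frac{\partial(f_1,\dots,f_m)}{\partial(x_1,\dots,x_n)}(x)$.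 $\dim^{\mathrm{top}}$ is the topological dimension, i.e. the maximal dimension of a manifold contained in the set, with $\dim^{\mathrm{top}}\emptyset=-1$. *)

(* Defs.v *)
From HB Require Import structures.
From mathcomp Require Import all_boot all_order all_algebra.
From mathcomp Require all_classical all_reals all_analysis.
From mathcomp Require mpoly.
From Stdlib Require Lists.List.
Set Implicit Arguments. Unset Strict Implicit. Unset Printing Implicit Defensive.

(* Polynomials in n variables with real coefficients: R[x_1,...,x_n] = {mpoly R[n]}.
   The algebraic part is developed inside a module importing mpoly (whose
   notations clash with MathComp-Analysis); the topological part afterwards. *)
Module PolyPart.
Import reals mpoly.
Import GRing.Theory.
Local Open Scope ring_scope.

Section Alg.
Variables (R : realType) (n : nat).

Definition pt (x : 'rV[R]_n) : 'I_n -> R := fun i => x ord0 i.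

Definition peval (x : 'rV[R]_n) (p : mpoly n R) : R := meval (pt x) p.

Inductive sa_rel := SaGt | SaGe | SaEq.

Definition sa_atom_holds (a : mpoly n R * sa_rel) (x : 'rV[R]_n) : Prop :=
  match a.2 with
  | SaGt => 0 < peval x a.1
  | SaGe => 0 <= peval x a.1
  | SaEq => peval x a.1 = 0
  end.

Definition semialgebraic (S : 'rV[R]_n -> Prop) : Prop :=
  exists L : list (list (mpoly n R * sa_rel)),
    forall x, S x <-> Stdlib.Lists.List.Exists
                        (fun c => Stdlib.Lists.List.Forall (fun a => sa_atom_holds a x) c) L.

Definition is_ideal (J : mpoly n R -> Prop) : Prop :=
  J 0 /\ (forall a b, J a -> J b -> J (a + b)) /\ (forall r a, J a -> J (r * a)).

Definition prime_ideal (J : mpoly n R -> Prop) : Prop :=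
  is_ideal J /\ ~ J 1 /\ (forall a b, J (a * b) -> J a \/ J b).

Definition ideal_gen (fs : seq (mpoly n R)) : mpoly n R -> Prop :=
  fun p => exists cs : seq (mpoly n R),
      size cs = size fs /\ p = \sum_(i < size fs) cs`_i * fs`_i.

Definition zeroset (J : mpoly n R -> Prop) : 'rV[R]_n -> Prop :=
  fun x => forall p, J p -> peval x p = 0.

Definition vanishing_ideal (A : 'rV[R]_n -> Prop) : mpoly n R -> Prop :=
  fun p => forall x, A x -> peval x p = 0.

(* Krull dimension of R[x]/J: supremum of lengths d of chains of prime ideals
   P_0 < P_1 < ... < P_d of R[x]/J, i.e. of prime ideals of R[x] containing J. *)
Definition prime_chain (J : mpoly n R -> Prop) (d : nat)
    (P : nat -> mpoly n R -> Prop) : Prop :=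
  (forall i, (i <= d)%N -> prime_ideal (P i) /\ (forall p, J p -> P i p)) /\
  (forall i, (i < d)%N -> (forall p, P i p -> P i.+1 p) /\ P i <> P i.+1).

Definition is_krull_dim (J : mpoly n R -> Prop) (d : nat) : Prop :=
  (exists P, prime_chain J d P) /\ (forall m P, prime_chain J m P -> (m <= d)%N).

Definition jacobian_rank (fs : seq (mpoly n R)) (x : 'rV[R]_n) : nat :=
  \rank (\matrix_(i < size fs, j < n) peval x (mderiv j fs`_i)).

End Alg.
End PolyPart.
Export PolyPart.

Notation poly_n n R := (mpoly.mpoly n R).

Import all_classical all_reals all_analysis.
Import Order.TTheory GRing.Theory Num.Theory.
Import numFieldNormedType.Exports.
Local Open Scope classical_set_scope.
Local Open Scope ring_scope.

Definition is_manifold {R : realType} {n : nat} (M : set 'rV[R]_n) (d : nat) : Prop :=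
  M !=set0 /\
  forall p, M p -> exists U : set 'rV[R]_n, open U /\ U p /\
    exists (V : set 'rV[R]_d) (f : 'rV[R]_n -> 'rV[R]_d) (g : 'rV[R]_d -> 'rV[R]_n),
      open V /\ {within M `&` U, continuous f} /\ {within V, continuous g} /\
      (forall x, (M `&` U) x -> V (f x) /\ g (f x) = x) /\
      (forall y, V y -> (M `&` U) (g y) /\ f (g y) = y).

Definition is_topdim {R : realType} {n : nat} (A : set 'rV[R]_n) (d : int) : Prop :=
  (A = set0 /\ d = -1) \/
  ((exists (M : set 'rV[R]_n) (m : nat), M `<=` A /\ is_manifold M m /\ d = m%:Z) /\
   (forall (M : set 'rV[R]_n) (m : nat), M `<=` A -> is_manifold M m -> (m%:Z <= d)%R)).

(* Main.v *)
Require Import Defs.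
From HB Require Import structures.
From mathcomp Require Import all_boot all_order all_algebra.
From mathcomp Require perm boolp classical_sets reals mpoly.
From mathcomp Require Import ring lra zify.
Import Order.TTheory GRing.Theory Num.Theory.
Set Implicit Arguments. Unset Strict Implicit. Unset Printing Implicit Defensive.

(** A prime ideal [P] of Krull dimension [e] has three features. Any [e + 1] polynomials are
    algebraically dependent modulo [P], by counting monomials. Up to factors outside [P] it is
    generated by [n - e] elements, so all larger minors of its Jacobian matrix lie in [P]. In
    characteristic zero some minor of size [n - e] does not lie in [P].

    (i) => (ii): by irredundance the polynomials vanishing on [V(I_t)] inside the interior of
    [S] are in [I_t]; hence the minor that is not in [I_t] is nonzero at some such point.

    (ii) => (iii): near a point of full rank, [n - e] generators cut out a graph over [e]
    coordinates. Modulo [P] the gradients of the other generators are combinations of the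
    gradients of these, so the other generators solve a linear differential system along the
    graph and vanish on it. No manifold of larger dimension [m] fits in [V(P)]: polynomial
    approximations of a chart map it onto a dense subset of a cube in [R^m] (a form of the
    Poincare-Miranda theorem, proved by a parity argument on a grid), and a dense subset of a
    cube satisfies no polynomial relation, contradicting algebraic dependence for [m > e].

    (iii) => (i): if [p] vanishes on an [e]-manifold in [V(P)] and [p] is not in [P], then the
    relation between [p] and [e] polynomials with dense image gives, at [p = 0], a relation
    between the latter. *)

(** * Prime ideals, algebraic dependence and minors of the Jacobian *)

(** Fraction fields are avoided: a statement over the fraction field of R[x]/P becomes one up to a
    multiplier outside [P], and its transcendence degree is the size of a maximal set [T] of
    variables in which [P] contains no nonzero polynomial. Two facts tie this size to chains of
    primes. A strictly larger prime has a smaller such set. Conversely, fixing one variable of [T]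
    at a real value where the common denominator survives leads to a larger prime for which the rest
    of [T] is still independent. On the topological side charts are merely continuous, while
    algebraic dependence speaks of polynomials only. Replacing the inverse of a chart by polynomials
    loses exact surjectivity, but density is enough because a polynomial relation passes to the
    closure. Invariance of domain is thereby replaced by a statement on self-maps of a cube close to
    the identity. At nonsingular points finite estimates take the place of calculus: a Newton
    contraction gives the graph, and polygons with [N] steps and an error of order [1 / N] give the
    vanishing of the other generators. *)

Module AlgPart.
Import perm boolp reals mpoly.
Local Open Scope ring_scope.

Section Ideals.
Variables (R : realType) (n : nat).
Local Notation A := {mpoly R[n]}.
Implicit Types (J P : A -> Prop) (p q f g : A) (U V T : {set 'I_n}).

(** * Arithmetic in ideals and prime ideals *)

Lemma idealD J a b : is_ideal J -> J a -> J b -> J (a + b).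
Proof. by move=> [_ [h _]]; apply: h. Qed.

Lemma idealMl J r a : is_ideal J -> J a -> J (r * a).
Proof. by move=> [_ [_ h]]; apply: h. Qed.

Lemma idealMr J r a : is_ideal J -> J a -> J (a * r).
Proof. by move=> hJ ha; rewrite mulrC; apply: idealMl. Qed.

Lemma idealN J a : is_ideal J -> J a -> J (- a).
Proof. by move=> hJ ha; rewrite -mulN1r; apply: idealMl. Qed.

Lemma idealB J a b : is_ideal J -> J a -> J b -> J (a - b).
Proof. by move=> hJ ha hb; apply: idealD => //; apply: idealN. Qed.

Lemma ideal_sum J (K : Type) (r : seq K) (Q : pred K) (F : K -> A) :
  is_ideal J -> (forall i, Q i -> J (F i)) -> J (\sum_(i <- r | Q i) F i).
Proof.
move=> hJ h; apply: big_ind => //; first by case: hJ.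
by move=> x y; apply: idealD.
Qed.

Lemma prime_is_ideal P : prime_ideal P -> is_ideal P. Proof. by case. Qed.

Lemma primeM P a b : prime_ideal P -> ~ P a -> ~ P b -> ~ P (a * b).
Proof. by move=> [_ [_ h]] ha hb /h[]. Qed.

Lemma prime_prod P (K : Type) (r : seq K) (Q : pred K) (F : K -> A) :
  prime_ideal P -> (forall i, Q i -> ~ P (F i)) -> ~ P (\prod_(i <- r | Q i) F i).
Proof.
move=> hP h; apply: (big_ind (fun x => ~ P x)) => //; first by case: hP => _ [].
by move=> x y; apply: primeM.
Qed.

Lemma primeX P a k : prime_ideal P -> ~ P a -> ~ P (a ^+ k).
Proof.
move=> hP ha; elim: k => [|k IH]; first by rewrite expr0; case: hP => _ [].
by rewrite exprS; apply: primeM.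
Qed.

Lemma idealZ J (c : R) a : is_ideal J -> J a -> J (c *: a).
Proof. by move=> hJ ha; rewrite -mul_mpolyC; apply: idealMl. Qed.

Lemma idealZV J (c : R) a : is_ideal J -> c != 0 -> J (c *: a) -> J a.
Proof.
by move=> hJ c0 /(idealZ c^-1 hJ); rewrite scalerA mulVf // scale1r.
Qed.

Lemma idealMn J a k : is_ideal J -> (0 < k)%N -> J (a *+ k) -> J a.
Proof.
move=> hJ k0; rewrite -scaler_nat; apply: idealZV => //.
by rewrite pnatr_eq0 -lt0n.
Qed.

Lemma ideal_gen_ideal (gs : seq A) : is_ideal (ideal_gen gs).
Proof.
split; [|split].
- exists (nseq (size gs) 0); rewrite size_nseq; split => //.
  by rewrite big1 // => i _; rewrite nth_nseq ltn_ord mul0r.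
- move=> a b [ca [sa ->]] [cb [sb ->]].
  exists (mkseq (fun i => ca`_i + cb`_i) (size gs)); rewrite size_mkseq; split => //.
  rewrite -big_split /=; apply: eq_bigr => i _.
  by rewrite nth_mkseq // mulrDl.
- move=> r a [ca [sa ->]].
  exists (mkseq (fun i => r * ca`_i) (size gs)); rewrite size_mkseq; split => //.
  rewrite big_distrr /=; apply: eq_bigr => i _.
  by rewrite nth_mkseq // mulrA.
Qed.

Lemma ideal_gen_nth (gs : seq A) i : (i < size gs)%N -> ideal_gen gs gs`_i.
Proof.
move=> hi; exists (mkseq (fun k => (k == i)%:R) (size gs)); rewrite size_mkseq.
split=> //; rewrite (bigD1 (Ordinal hi)) //= nth_mkseq // eqxx mul1r.
rewrite big1 ?addr0 // => k; rewrite -val_eqE /= => hk.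
by rewrite nth_mkseq // (negbTE hk) mul0r.
Qed.

Lemma ideal_gen_mem (gs : seq A) g : g \in gs -> ideal_gen gs g.
Proof. by move=> hg; rewrite -(nth_index 0 hg); apply: ideal_gen_nth; rewrite index_mem. Qed.

Lemma ideal_gen_min (gs : seq A) J : is_ideal J ->
  (forall g, g \in gs -> J g) -> forall p, ideal_gen gs p -> J p.
Proof.
move=> hJ h p [cs [_ ->]]; apply: ideal_sum => // i _; apply: idealMl => //.
by apply: h; apply: mem_nth.
Qed.

(** * Polynomials in a given set of variables, with bounded exponents *)

Definition vars_in (U : {set 'I_n}) p :=
  forall m, m \in msupp p -> forall i, i \notin U -> m i = 0%N.

(** Exponents are bounded one variable at a time: the bounds add under products, and the exponents
    on [U] within the bound form a grid of [(D + 1) ^ #|U|] points, the number that [alg_dependent]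
    counts. *)
Definition box (U : {set 'I_n}) (D : nat) p :=
  vars_in U p /\ forall m, m \in msupp p -> forall i, (m i <= D)%N.

Lemma msuppM_ind (Q : 'X_{1..n} -> Prop) p q :
  (forall m1 m2, m1 \in msupp p -> m2 \in msupp q -> Q (m1 + m2)%MM) ->
  forall m, m \in msupp (p * q) -> Q m.
Proof.
move=> h m /msuppM_le /allpairsP [[m1 m2] /= [h1 h2 ->]]; exact: h.
Qed.

Lemma msuppD_ind (Q : 'X_{1..n} -> Prop) p q :
  (forall m, m \in msupp p -> Q m) -> (forall m, m \in msupp q -> Q m) ->
  forall m, m \in msupp (p + q) -> Q m.
Proof.
by move=> h1 h2 m /msuppD_le; rewrite mem_cat => /orP [/h1|/h2].
Qed.

Lemma msuppN_mem p m : (m \in msupp (- p)) = (m \in msupp p).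
Proof. by rewrite (perm_mem (msuppN p)). Qed.

Lemma vars_inD U p q : vars_in U p -> vars_in U q -> vars_in U (p + q).
Proof. by move=> hp hq; apply: msuppD_ind. Qed.

Lemma vars_inN U p : vars_in U p -> vars_in U (- p).
Proof. by move=> hp m; rewrite msuppN_mem; apply: hp. Qed.

Lemma vars_inB U p q : vars_in U p -> vars_in U q -> vars_in U (p - q).
Proof. by move=> hp hq; apply: vars_inD => //; apply: vars_inN. Qed.

Lemma vars_inM U p q : vars_in U p -> vars_in U q -> vars_in U (p * q).
Proof.
move=> hp hq; apply: msuppM_ind => m1 m2 h1 h2 i hi.
by rewrite mnmDE (hp _ h1) // (hq _ h2).
Qed.

Lemma vars_inC U (c : R) : vars_in U c%:MP.
Proof.
move=> m; rewrite msuppC; case: ifP => // _; rewrite inE => /eqP -> i _.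
by rewrite mnm0E.
Qed.

Lemma vars_in0 U : vars_in U 0.
Proof. by rewrite -(mpolyC0 n R); apply: vars_inC. Qed.

Lemma vars_in1 U : vars_in U 1.
Proof. by rewrite -(mpolyC1 n R); apply: vars_inC. Qed.

Lemma vars_inXm U (m : 'X_{1..n}) : (forall i, i \notin U -> m i = 0%N) -> vars_in U 'X_[m].
Proof. by move=> h m'; rewrite msuppX inE => /eqP ->. Qed.

Lemma vars_inX U i : i \in U -> vars_in U 'X_i.
Proof.
move=> iU; apply: vars_inXm => j; rewrite mnm1E.
by case: eqP => // <-; rewrite iU.
Qed.

Lemma vars_inZ U (c : R) p : vars_in U p -> vars_in U (c *: p).
Proof. by move=> hp; rewrite -mul_mpolyC; apply: vars_inM => //; apply: vars_inC. Qed.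

Lemma vars_in_sum U (K : Type) (r : seq K) (Q : pred K) (F : K -> A) :
  (forall i, Q i -> vars_in U (F i)) -> vars_in U (\sum_(i <- r | Q i) F i).
Proof. by move=> h; apply: big_ind => //; [apply: vars_in0|move=> x y; apply: vars_inD]. Qed.

Lemma vars_in_prod U (K : Type) (r : seq K) (Q : pred K) (F : K -> A) :
  (forall i, Q i -> vars_in U (F i)) -> vars_in U (\prod_(i <- r | Q i) F i).
Proof. by move=> h; apply: big_ind => //; [apply: vars_in1|move=> x y; apply: vars_inM]. Qed.

Lemma vars_in_exp U p k : vars_in U p -> vars_in U (p ^+ k).
Proof.
by move=> hp; elim: k => [|k IH]; rewrite ?expr0 ?exprS; [apply: vars_in1|apply: vars_inM].
Qed.

Lemma vars_inS U V p : U \subset V -> vars_in U p -> vars_in V p.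
Proof. by move=> /subsetP s hp m hm i hi; apply: hp => //; apply: contra hi; apply: s. Qed.

Lemma vars_inT p : vars_in [set: 'I_n] p.
Proof. by move=> m _ i; rewrite inE. Qed.

Lemma vars_in_box U p : vars_in U p -> exists D, box U D p.
Proof.
move=> hp; exists (msize p); split=> // m /msize_mdeg_lt hm i.
by apply: leq_trans (ltnW hm); rewrite mdegE (bigD1 i) //= leq_addr.
Qed.

Lemma boxS U D D' p : (D <= D')%N -> box U D p -> box U D' p.
Proof. by move=> l [h1 h2]; split=> // m hm i; apply: leq_trans l; apply: h2. Qed.

Lemma boxD U D p q : box U D p -> box U D q -> box U D (p + q).
Proof.
by move=> [h1 h2] [h3 h4]; split; [apply: vars_inD|apply: msuppD_ind].
Qed.

Lemma boxM U D D' p q : box U D p -> box U D' q -> box U (D + D') (p * q).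
Proof.
move=> [h1 h2] [h3 h4]; split; first exact: vars_inM.
by apply: msuppM_ind => m1 m2 k1 k2 i; rewrite mnmDE leq_add ?h2 ?h4.
Qed.

Lemma boxC U D (c : R) : box U D c%:MP.
Proof.
split; first exact: vars_inC.
by move=> m; rewrite msuppC; case: ifP => // _; rewrite inE => /eqP -> i; rewrite mnm0E.
Qed.

Lemma box_sum U D (K : Type) (r : seq K) (Q : pred K) (F : K -> A) :
  (forall i, Q i -> box U D (F i)) -> box U D (\sum_(i <- r | Q i) F i).
Proof.
move=> h; apply: big_ind => //; first by rewrite -(mpolyC0 n R); apply: boxC.
by move=> x y; apply: boxD.
Qed.

Lemma mderiv_vars_in U p j : vars_in U p -> j \notin U -> p^`M(j) = 0.
Proof.
move=> hp hj; apply/mpolyP => m; rewrite mcoeff_deriv mcoeff0.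
suff -> : p@_(m + U_(j)) = 0 by rewrite mul0rn.
apply: memN_msupp_eq0; apply/negP => /hp /(_ j hj).
by rewrite mnmDE mnm1E eqxx addn1.
Qed.

(** * Independent sets of variables and minimal relations over them *)

Definition indep P (T : {set 'I_n}) := forall p, vars_in T p -> P p -> p = 0.

(** For a prime [P], the classes of these variables form a transcendence basis of the fraction field
    of R[x]/P, chosen among the coordinates. *)
Definition max_indep P (T : {set 'I_n}) :=
  indep P T /\ forall j, j \notin T -> ~ indep P (j |: T).

Lemma indepS P T T' : T \subset T' -> indep P T' -> indep P T.
Proof. by move=> s h p hp; apply: h; apply: vars_inS hp. Qed.

Lemma indep_sub P Q T : (forall p, P p -> Q p) -> indep Q T -> indep P T.
Proof. by move=> s h p hp /s; apply: h. Qed.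

Lemma indep_max P T0 : indep P T0 -> exists2 T : {set 'I_n}, T0 \subset T & max_indep P T.
Proof.
move=> h0; have h0' : `[< indep P T0 >] by apply/asboolP.
have [T /maxsetP [/asboolP hT hmax] sT] :=
  @maxset_exists _ (fun T : {set 'I_n} => `[< indep P T >]) T0 h0'.
exists T => //; split => // j hj hi.
have := hmax (j |: T) (introT (asboolP _) hi) (subsetU1 _ _).
by move=> e; move: hj; rewrite -e setU11.
Qed.

Lemma indep_set0 P : prime_ideal P -> indep P set0.
Proof.
move=> hP p hp Pp.
have e : p = (p@_0%MM)%:MP.
  apply/mpolyP => m; rewrite mcoeffC.
  have [->|nm] := eqVneq m 0%MM; first by rewrite mulr1.
  rewrite mulr0; apply: memN_msupp_eq0; apply: contra nm => hm.
  by apply/eqP/mnmP => i; rewrite mnm0E (hp _ hm) // inE.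
rewrite e; case: (eqVneq (p@_0%MM) 0) => [->|nz]; first by rewrite mpolyC0.
case: hP => hI [n1 _]; case: n1.
apply: (@idealZV P (p@_0%MM)) => //.
by rewrite -mul_mpolyC mulr1 -e.
Qed.

(** Coefficients are kept in the full ring [A], so that [p.['X_j]] is again in [A] and a univariate
    polynomial over the variables [U] becomes a polynomial in [j |: U]. *)
Definition coefs_in (U : {set 'I_n}) (p : {poly A}) := forall i, vars_in U p`_i.

Lemma coefs_inB U (p q : {poly A}) : coefs_in U p -> coefs_in U q -> coefs_in U (p - q).
Proof. by move=> hp hq i; rewrite coefB; apply: vars_inB. Qed.

Lemma coefs_inM U (p q : {poly A}) : coefs_in U p -> coefs_in U q -> coefs_in U (p * q).
Proof.
by move=> hp hq i; rewrite coefM; apply: vars_in_sum => k _; apply: vars_inM.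
Qed.

Lemma coefs_inC U c : vars_in U c -> coefs_in U c%:P.
Proof. by move=> hc i; rewrite coefC; case: ifP => // _; apply: vars_in0. Qed.

Lemma coefs_inXn U k : coefs_in U 'X^k.
Proof. by move=> i; rewrite coefXn; case: eqP => _; [apply: vars_in1|apply: vars_in0]. Qed.

Lemma vars_in_horner U j f : j \notin U -> vars_in (j |: U) f ->
  exists2 p : {poly A}, coefs_in U p & p.['X_j] = f.
Proof.
move=> hj hf.
pose m' (m : 'X_{1..n}) : 'X_{1..n} := [multinom (if i == j then 0 else m i)%N | i < n].
exists (\sum_(m <- msupp f) (f@_m *: 'X_[m' m])%:P * 'X^(m j)).
  move=> i; rewrite coef_sum big_seq; apply: vars_in_sum => m hm.
  rewrite coefCM; apply: vars_inM; last exact: coefs_inXn.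
  apply: vars_inZ; apply: vars_inXm => k hk; rewrite mnmE.
  by case: eqP => // /eqP kj; apply: (hf _ hm); rewrite !inE (negbTE kj).
rewrite horner_sum [RHS]mpolyE; apply: eq_bigr => m _.
rewrite hornerCM hornerXn -scalerAl; congr (_ *: _).
rewrite mpolyXn -mpolyXD; congr 'X_[_]; apply/mnmP => i.
rewrite mnmDE mulmnE mnmE mnm1E eq_sym.
by case: eqP => [->|_]; rewrite ?mul1n ?mul0n ?addn0 ?add0n.
Qed.


(** The minimal polynomial of the class of ['X_j] over the fraction field of the variables [U]
    modulo [P], with denominators cleared: the leading coefficient is outside [P] instead of being
    one, and a shorter relation must be trivial modulo [P]. *)
Definition min_relation P U j (G : {poly A}) :=
  [/\ coefs_in U G, P G.['X_j], ~ P (lead_coef G) &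
      forall p : {poly A}, coefs_in U p -> P p.['X_j] -> (size p < size G)%N -> forall i, P p`_i].

Lemma min_relation_exists P U j : prime_ideal P ->
  (exists2 p : {poly A}, coefs_in U p /\ P p.['X_j] & exists i, ~ P p`_i) ->
  exists G, min_relation P U j G.
Proof.
move=> hP [p0 [c0 P0] n0]; have hI := prime_is_ideal hP.
pose good (p : {poly A}) := (coefs_in U p /\ P p.['X_j]) /\ exists i, ~ P p`_i.
have ex : exists k, `[< exists2 p, good p & size p = k >].
  by exists (size p0); apply/asboolP; exists p0.
case: (ex_minnP ex) => k /asboolP [G [[cG PG] nG] sG] kmin.
have {}kmin (p : {poly A}) : good p -> (size G <= size p)%N.
  by move=> gp; rewrite sG; apply: kmin; apply/asboolP; exists p.
exists G; split=> // [PlG|p cp Pp lt i].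
- have G0 : G != 0 by apply/eqP => G0; case: nG => i; rewrite G0 coef0; case: hI.
  (* A leading term with coefficient in [P] could be dropped: [G'] is still a relation, is shorter,
     and keeps a coefficient outside [P]. *)
  pose G' := G - lead_coef G *: 'X^((size G).-1).
  have lt : (size G' < size G)%N.
    rewrite -(prednK (_ : 0 < size G)%N) ?size_poly_gt0 // ltnS.
    apply/leq_sizeP => i hi; rewrite coefB coefZ coefXn.
    case: eqP => [->|/eqP ne]; first by rewrite mulr1 /lead_coef subrr.
    rewrite mulr0 subr0; apply: nth_default.
    by move: hi ne; move: (size_poly_gt0 G); rewrite G0; case: (size G) => // s _; rewrite /= => a b; rewrite ltn_neqAle eq_sym b.
  have : good G'.
    split; [split|].
    + apply: coefs_inB => // i; rewrite coefZ; apply: vars_inM; last exact: coefs_inXn.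
      exact: cG.
    + rewrite hornerD hornerN hornerZ; apply: idealB => //.
      by apply: idealMr.
    + case: nG => i ni; exists i => Pi; apply: ni.
      move: Pi; rewrite coefB coefZ coefXn.
      case: eqP => [->|_]; last by rewrite mulr0 subr0.
      by rewrite mulr1 /lead_coef => _.
  by move/kmin; rewrite leqNgt lt.
- apply: contrapT => ni; move: lt; rewrite ltnNge kmin //.
  by split => //; exists i.
Qed.

Lemma min_relation_size P U j G : prime_ideal P -> min_relation P U j G -> (1 < size G)%N.
Proof.
move=> hP [cG PG lG _]; rewrite ltnNge; apply/negP => /size1_polyC e.
by apply: lG; rewrite e lead_coefC; move: PG; rewrite {1}e hornerC.
Qed.

(** Pseudo-division: every step multiplies by [lead_coef G] instead of dividing by it. The remainder
    is a relation shorter than [G], so minimality puts its coefficients in [P]. *)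
Lemma min_relation_div P U j G (p : {poly A}) : prime_ideal P -> min_relation P U j G ->
  coefs_in U p -> P p.['X_j] ->
  exists (c : A) (q r : {poly A}), [/\ ~ P c, c%:P * p = q * G + r,
    vars_in U c, coefs_in U r & forall i, P r`_i].
Proof.
move=> hP hG; have hI := prime_is_ideal hP; have [cG PG lG minG] := hG.
have [k] := ubnP (size p); elim: k p => // k IH p; rewrite ltnS => sp cp Pp.
have [lt|le] := ltnP (size p) (size G).
  exists 1, 0, p; rewrite mul0r add0r mul1r; split => //; first by case: hP => _ [].
    exact: vars_in1.
  exact: minG.
pose p' := (lead_coef G)%:P * p - (lead_coef p)%:P * 'X^(size p - size G) * G.
have sG := min_relation_size hP hG.
have sp0 : (0 < size p)%N by apply: leq_trans le; apply: ltnW.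
have G0 : G != 0 by rewrite -size_poly_gt0 ltnW.
have p0 : p != 0 by rewrite -size_poly_gt0.
have lt : (size p' < k)%N.
  apply: leq_trans sp; rewrite -(prednK sp0) ltnS; apply/leq_sizeP => i hi.
  rewrite coefB coefCM -mulrA coefCM coefXnM.
  have -> : (i < size p - size G)%N = false by apply/negbTE; rewrite -leqNgt; lia.
  move: hi; rewrite leq_eqVlt => /orP[/eqP <-|hi].
    have -> : ((size p).-1 - (size p - size G))%N = (size G).-1 by lia.
    by rewrite /lead_coef mulrC subrr.
  rewrite (nth_default _ (_ : size p <= i)%N); last by lia.
  by rewrite (nth_default _ (_ : size G <= _)%N) ?mulr0 ?subr0 //; lia.
have cp' : coefs_in U p'.
  apply: coefs_inB; first by apply: coefs_inM => //; apply: coefs_inC; apply: cG.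
  apply: coefs_inM => //; apply: coefs_inM; last exact: coefs_inXn.
  by apply: coefs_inC; apply: cp.
have Pp' : P p'.['X_j].
  rewrite hornerD hornerN; apply: idealB => //; rewrite hornerM; exact: idealMl.
have [c [q [r [nc e vc cr Pr]]]] := IH p' lt cp' Pp'.
exists (c * lead_coef G), (c%:P * (lead_coef p)%:P * 'X^(size p - size G) + q), r.
split=> //; [exact: primeM| |by apply: vars_inM => //; apply: cG].
have : c%:P * p' = c%:P * p' by [].
rewrite {2}e /p' polyCM => e'.
rewrite mulrDl -addrA -e' mulrBr; ring.
Qed.

Lemma mderivXi (i j : 'I_n) : ('X_j : A)^`M(i) = (j == i)%:R.
Proof.
rewrite mderivX mnm1E; case: eqP => [->|_]; last by rewrite scale0r.
rewrite scale1r -[RHS](mpolyX0 n R); congr mpolyX.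
by apply/mnmP => k; rewrite mnmBE mnm0E subnn.
Qed.

Lemma mderiv_horner U j (p : {poly A}) : coefs_in U p -> j \notin U ->
  (p.['X_j])^`M(j) = (p^`()).['X_j].
Proof.
move=> cp hj; elim/poly_ind: p cp => [|p c IH] cp; first by rewrite deriv0 !horner0 mderiv0.
have cq : coefs_in U p by move=> i; have := cp i.+1; rewrite coefD coefMX coefC /= addr0.
have cc : vars_in U c by have := cp 0%N; rewrite coefD coefMX coefC /= add0r.
rewrite derivMXaddC hornerMXaddC mderivD (mderiv_vars_in cc hj) addr0 mderivM IH //.
by rewrite mderivXi eqxx mulr1 hornerD hornerMX addrC.
Qed.

(** Separability in characteristic zero: if the derivative were a relation, it would be shorter than
    [G], so its top coefficient, a positive multiple of [lead_coef G], would lie in [P]. *)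
Lemma min_relation_deriv P U j G : prime_ideal P -> j \notin U ->
  min_relation P U j G -> ~ P (G.['X_j])^`M(j).
Proof.
move=> hP hj hG; have [cG PG lG minG] := hG; have sG := min_relation_size hP hG.
rewrite (mderiv_horner cG) // => PG'.
have G0 : G != 0 by rewrite -size_poly_gt0 ltnW.
have cG' : coefs_in U G^`().
  by move=> i; rewrite coef_deriv -scaler_nat; apply: vars_inZ.
have := minG _ cG' PG' (lt_size_deriv G0) (size G).-2.
rewrite coef_deriv.
have -> : (size G).-2.+1 = (size G).-1 by move: sG; case: (size G) => [|[]].
move/(idealMn (prime_is_ideal hP)) => h; apply: lG; apply: h.
by move: sG; case: (size G) => [|[]].
Qed.

Lemma max_indep_relation P T U j : prime_ideal P -> max_indep P T -> T \subset U -> j \notin U ->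
  exists2 p : {poly A}, coefs_in U p /\ P p.['X_j] & exists i, ~ P p`_i.
Proof.
move=> hP [iT mT] sTU jU.
have jT : j \notin T by apply: contra jU; apply: (subsetP sTU).
have /existsNP [f /not_implyP [vf /not_implyP [Pf f0]]] := mT j jT.
have [p cp ef] := vars_in_horner jT vf.
exists p; first by split; [move=> i; apply: vars_inS sTU (cp i)|rewrite ef].
apply/existsNP => hp; apply: f0; rewrite -ef.
suff -> : p = 0 by rewrite horner0.
by apply/polyP => i; rewrite coef0; apply: iT.
Qed.

Lemma max_indep_min_relation P T U j : prime_ideal P -> max_indep P T -> T \subset U ->
  j \notin U -> exists G, min_relation P U j G.
Proof. by move=> hP hT s hj; apply: min_relation_exists => //; exact: (max_indep_relation hP hT). Qed.

(* Up to factors outside [P], the ideal [P] is generated by [n - #|T|] elements: add the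
   variables outside [T] one at a time and pseudo-divide by a minimal relation. *)
Lemma triangular_generators P T U : prime_ideal P -> max_indep P T -> T \subset U ->
  exists Gs : seq A, [/\ size Gs = #|U :\: T|, forall g, g \in Gs -> P g &
    forall f, vars_in U f -> P f -> exists2 a, ~ P a & ideal_gen Gs (a * f)].
Proof.
move=> hP hT; have hI := prime_is_ideal hP.
have [k] := ubnP #|U :\: T|; elim: k U => // k IH U; rewrite ltnS => sU sTU.
have [e|[j]] := set_0Vmem (U :\: T).
  exists [::]; rewrite e cards0; split => // f vf Pf; exists 1; first by case: hP => _ [].
  have -> : f = 0 by apply: (proj1 hT) => //; apply: vars_inS vf; rewrite -setD_eq0 e.
  by rewrite mulr0; case: (@ideal_gen_ideal [::]).
rewrite inE => /andP [jT jU].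
pose U' := U :\ j.
have sTU' : T \subset U' by rewrite subsetD1 sTU.
have jU' : j \notin U' by rewrite !inE eqxx.
have cU : #|U :\: T| = #|U' :\: T|.+1.
  rewrite (cardsD1 j) !inE jT jU /= add1n; congr (_.+1); congr (#|pred_of_set _|).
  by apply/setP => i; rewrite !inE; case: (i == j); rewrite ?andbF.
have UE : j |: U' = U by rewrite setD1K.
have [|Gs [sGs PGs hGs]] := IH U' _ sTU'; first by rewrite -ltnS -cU.
have [G hG] := max_indep_min_relation hP hT sTU' jU'.
exists (G.['X_j] :: Gs); split => [|g|f vf Pf]; first by rewrite /= sGs cU.
  by rewrite inE => /orP [/eqP ->|/PGs]; first by case: hG.
rewrite -UE in vf; have [p cp ef] := vars_in_horner jU' vf.
have Pp : P p.['X_j] by rewrite ef.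
have [c [q [r [nc e vc cr Pr]]]] := min_relation_div hP hG cp Pp.
have /choice [a ha] : forall i, exists a, ~ P a /\ ideal_gen Gs (a * r`_i).
  by move=> i; have [a na ga] := hGs _ (cr i) (Pr i); exists a.
(* The induction gives each coefficient of the remainder its own multiplier; the product serves all
   of them. *)
pose b := \prod_(i < size r) a i.
have hg := ideal_gen_ideal (G.['X_j] :: Gs).
exists (b * c); first by apply: primeM => //; apply: prime_prod => // i _; case: (ha i).
rewrite -mulrA -ef -[c](hornerC c 'X_j) -hornerM e hornerD hornerM mulrDr.
apply: idealD => //; first by do 2 apply: idealMl => //; apply: ideal_gen_mem; rewrite mem_head.
rewrite (horner_coef r) mulr_sumr; apply: ideal_sum => // i _.
rewrite /b (bigD1 i) //= mulrA; apply: idealMr => //; rewrite mulrAC; apply: idealMr => //.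
have [_] := ha i; apply: ideal_gen_min => // g hgs.
by apply: ideal_gen_mem; rewrite inE hgs orbT.
Qed.

(** The Cauchy-Binet formula before grouping: [phi] ranges over all maps, and the non-injective ones
    contribute repeated rows. *)
Lemma det_mulmx_rect (B : comNzRingType) k m (C : 'M[B]_(k, m)) (N : 'M[B]_(m, k)) :
  \det (C *m N) =
  \sum_(phi : {ffun 'I_k -> 'I_m}) (\prod_i C i (phi i)) * \det (rowsub phi N).
Proof.
transitivity (\sum_(s : {perm 'I_k}) \sum_(phi : {ffun 'I_k -> 'I_m})
    (-1) ^+ s * \prod_i (C i (phi i) * N (phi i) (s i))).
  apply: eq_bigr => s _; rewrite -big_distrr /= -(bigA_distr_bigA (fun i j => C i j * N j (s i))) /=.
  by congr (_ * _); apply: eq_bigr => i _; rewrite mxE.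
rewrite exchange_big /=; apply: eq_bigr => phi _; rewrite big_distrr /=.
apply: eq_bigr => s _; rewrite big_split /= mulrCA; congr (_ * (_ * _)).
by apply: eq_bigr => i _; rewrite mxE.
Qed.

Lemma det_mulmx_rect0 (B : comNzRingType) k m (C : 'M[B]_(k, m)) (N : 'M[B]_(m, k)) :
  (m < k)%N -> \det (C *m N) = 0.
Proof.
move=> mk; rewrite det_mulmx_rect big1 // => phi _.
have /injectivePn [i [j ij e]] : ~~ injectiveb phi.
  apply/negP => /injectiveP /leq_card; rewrite !card_ord leqNgt mk //.
rewrite (determinant_alternate ij) ?mulr0 // => l.
by rewrite !mxE e.
Qed.

Lemma ideal_prod_congr J (K : Type) (r : seq K) (Q : pred K) (F G : K -> A) : is_ideal J ->
  (forall i, Q i -> J (F i - G i)) -> J (\prod_(i <- r | Q i) F i - \prod_(i <- r | Q i) G i).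
Proof.
move=> hJ h; apply: (big_ind2 (fun x y => J (x - y))) => //; first by rewrite subrr; case: hJ.
move=> x1 x2 y1 y2 hx hy.
have -> : x1 * y1 - x2 * y2 = x1 * (y1 - y2) + (x1 - x2) * y2 by ring.
by apply: idealD => //; [apply: idealMl|apply: idealMr].
Qed.

Lemma ideal_det_congr J k (X Y : 'M[A]_k) : is_ideal J ->
  (forall i j, J (X i j - Y i j)) -> J (\det X - \det Y).
Proof.
move=> hJ h; rewrite /determinant -sumrB; apply: ideal_sum => // s _.
by rewrite -mulrBr; apply: idealMl => //; apply: ideal_prod_congr.
Qed.

Lemma ideal_genP (gs : seq A) p : ideal_gen gs p ->
  exists c : 'I_(size gs) -> A, p = \sum_i c i * gs`_i.
Proof. by move=> [cs [_ ->]]; exists (fun i => cs`_i). Qed.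

(** Differentiating [a_i f_i = sum c_il G_l] and dropping multiples of elements of [P] shows that
    the rows [a_i grad f_i] are combinations of the [size Gs] gradients of [Gs]. With [size Gs < k]
    the determinant vanishes modulo [P], and the factors [a_i] cancel by primality. *)
Lemma prime_minors P (Gs : seq A) k (f : 'I_k -> A) (g : 'I_k -> 'I_n) : prime_ideal P ->
  (forall h, h \in Gs -> P h) ->
  (forall f, P f -> exists2 a, ~ P a & ideal_gen Gs (a * f)) ->
  (size Gs < k)%N -> (forall i, P (f i)) -> P (\det (\matrix_(i, j) (f i)^`M(g j))).
Proof.
move=> hP PGs hGs sk Pf; have hI := prime_is_ideal hP.
have /choice [a ha] : forall i, exists a, ~ P a /\ exists c : 'I_(size Gs) -> A,
    a * f i = \sum_l c l * Gs`_l.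
  by move=> i; have [a na /ideal_genP ga] := hGs _ (Pf i); exists a.
have /choice [c hc] : forall i, exists c : 'I_(size Gs) -> A, a i * f i = \sum_l c l * Gs`_l.
  by move=> i; case: (ha i).
set M := \matrix_(i, j) _.
pose C : 'M[A]_(k, size Gs) := \matrix_(i, l) c i l.
pose N : 'M[A]_(size Gs, k) := \matrix_(l, j) (Gs`_l)^`M(g j).
have : P (\det (diag_mx (\row_i a i) *m M) - \det (C *m N)).
  apply: ideal_det_congr => // i j; rewrite mul_diag_mx !mxE.
  have := congr1 (mderiv (g j)) (hc i); rewrite mderivM raddf_sum /= => e.
  have -> : a i * (f i)^`M(g j) = \sum_l (c i l * Gs`_l)^`M(g j) - (a i)^`M(g j) * f i.
    by rewrite -e addrC addKr.
  rewrite addrAC -sumrB; apply: idealB => //; last exact: idealMl.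
  apply: ideal_sum => // l _; rewrite mderivM !mxE addrK; apply: idealMl => //.
  by apply: PGs; apply: mem_nth.
rewrite (det_mulmx_rect0 C N sk) subr0 det_mulmx det_diag.
have na : ~ P (\prod_i (\row_i a i) 0 i).
  by apply: prime_prod => // i _; rewrite mxE; case: (ha i).
by case: hP => _ [_ h] /h [].
Qed.

Lemma vars_in_hornerX U j (p : {poly A}) : coefs_in U p -> vars_in (j |: U) p.['X_j].
Proof.
move=> cp; rewrite horner_coef; apply: vars_in_sum => i _; apply: vars_inM.
  by apply: vars_inS (cp i); apply: subsetU1.
by apply: vars_in_exp; apply: vars_inX; rewrite setU11.
Qed.

(** The minimal relation of a variable outside [T] over [T] involves no other variable outside [T].
    The Jacobian matrix in these variables is therefore diagonal, and separability keeps its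
    diagonal entries outside [P]. *)
Lemma prime_nonzero_minor P T : prime_ideal P -> max_indep P T ->
  exists (F : 'I_#|~: T| -> A) (g : 'I_#|~: T| -> 'I_n),
    (forall i, P (F i)) /\ ~ P (\det (\matrix_(i, j) (F i)^`M(g j))).
Proof.
move=> hP hT; pose g (i : 'I_#|~: T|) : 'I_n := enum_val i.
have gT i : g i \notin T by have := enum_valP i; rewrite inE.
have /choice [G hG] : forall i, exists G, min_relation P T (g i) G.
  by move=> i; apply: (max_indep_min_relation hP hT).
exists (fun i => (G i).['X_(g i)]), g; split=> [i|]; first by case: (hG i).
have -> : \matrix_(i, j) ((G i).['X_(g i)])^`M(g j) =
          diag_mx (\row_i ((G i).['X_(g i)])^`M(g i)).
  apply/matrixP => i j; rewrite !mxE; have [->|ij] := eqVneq i j; first by rewrite mulr1n.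
  rewrite mulr0n; have [cG _ _ _] := hG i.
  rewrite (mderiv_vars_in (vars_in_hornerX (j := g i) cG)) //.
  by rewrite !inE negb_or gT andbT (inj_eq enum_val_inj) eq_sym.
rewrite det_diag; apply: prime_prod => // i _; rewrite mxE.
exact: min_relation_deriv (hG i).
Qed.

(** This moves a nonzero minor from arbitrary elements of the ideal to the given generators: modulo
    the ideal the gradients of [F] are combinations of the gradients of [gs], and Cauchy-Binet
    expands the minor accordingly. *)
Lemma ideal_gen_nonzero_minor (gs : seq A) k (F : 'I_k -> A) (g : 'I_k -> 'I_n) :
  (forall i, ideal_gen gs (F i)) -> ~ ideal_gen gs (\det (\matrix_(i, j) (F i)^`M(g j))) ->
  exists phi : 'I_k -> 'I_(size gs),
    ~ ideal_gen gs (\det (\matrix_(i, j) (gs`_(phi i))^`M(g j))).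
Proof.
move=> PF nP; apply/existsNP => h; apply: nP; have hI := ideal_gen_ideal gs.
have /choice [c hc] : forall i, exists c : 'I_(size gs) -> A, F i = \sum_l c l * gs`_l.
  by move=> i; apply: ideal_genP.
pose C : 'M[A]_(k, size gs) := \matrix_(i, l) c i l.
pose N : 'M[A]_(size gs, k) := \matrix_(l, j) (gs`_l)^`M(g j).
rewrite -[\det _](subrK (\det (C *m N))); apply: idealD => //.
  apply: ideal_det_congr => // i j; rewrite !mxE hc raddf_sum /= -sumrB.
  apply: ideal_sum => // l _; rewrite mderivM !mxE addrK; apply: idealMl => //.
  exact: ideal_gen_nth.
rewrite det_mulmx_rect; apply: ideal_sum => // phi _; apply: idealMl => //.
have := h phi; congr (ideal_gen _ (\det _)).
by apply/matrixP => i j; rewrite !mxE.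
Qed.

(** * Evaluation at real points: bounds, Taylor estimates and non-vanishing *)

Lemma mpoly_ring_ind (Q : A -> Prop) : (forall c, Q c%:MP) -> (forall i, Q 'X_i) ->
  (forall p q, Q p -> Q q -> Q (p + q)) -> (forall p q, Q p -> Q q -> Q (p * q)) ->
  forall p, Q p.
Proof.
move=> hC hX hD hM p; rewrite [p]mpolyE; apply: big_ind => //; first by rewrite -(mpolyC0 n R).
move=> m _; rewrite -mul_mpolyC; apply: (hM) => //; rewrite mpolyXE_id.
apply: (big_ind Q); [by rewrite -(mpolyC1 n R)|exact: hM|].
move=> i _; elim: (m i) => [|k IH]; first by rewrite expr0 -(mpolyC1 n R).
by rewrite exprS; apply: hM.
Qed.

Lemma mderivXi_eval (i j : 'I_n) v : (('X_j : A)^`M(i)).@[v] = (j == i)%:R.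
Proof. by rewrite mderivXi; case: (j == i); rewrite ?meval1 ?meval0. Qed.

Lemma meval_bounded p (rho : R) :
  exists2 C : R, 0 <= C & forall v : 'I_n -> R, (forall i, `|v i| <= rho) -> `|p.@[v]| <= C.
Proof.
elim/mpoly_ring_ind: p => [c|i|p q [C C0 hC] [D D0 hD]|p q [C C0 hC] [D D0 hD]].
- by exists `|c| => // v _; rewrite mevalC.
- by exists `|rho| => // v hv; rewrite mevalXU; apply: le_trans (ler_norm _).
- exists (C + D); first exact: addr_ge0.
  by move=> v hv; rewrite mevalD (le_trans (ler_normD _ _)) // lerD ?hC ?hD.
- exists (C * D); first exact: mulr_ge0.
  by move=> v hv; rewrite mevalM normrM ler_pM ?hC ?hD.
Qed.

Lemma meval_deriv_bounded p (rho : R) : exists2 B : R, 0 <= B &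
  forall v : 'I_n -> R, (forall i, `|v i| <= rho) -> forall i, `|(p^`M(i)).@[v]| <= B.
Proof.
have /choice [B hB] : forall i, exists B : R, 0 <= B /\ forall v : 'I_n -> R, (forall i, `|v i| <= rho) ->
    `|(p^`M(i)).@[v]| <= B.
  by move=> i; have [B h1 h2] := meval_bounded p^`M(i) rho; exists B.
exists (\sum_i B i); first by apply: sumr_ge0 => i _; case: (hB i).
move=> v hv i; have [_ /(_ v hv) h] := hB i; apply: le_trans h _.
by rewrite (bigD1 i) //= lerDl; apply: sumr_ge0 => k _; case: (hB k).
Qed.

Lemma norm_lincomb_le m (h d : 'I_m -> R) (e B : R) :
  (forall i, `|h i| <= e) -> (forall i, `|d i| <= B) ->
  `|\sum_i h i * d i| <= m%:R * B * e.
Proof.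
move=> hh hd; apply: le_trans (ler_norm_sum _ _ _) _.
apply: (@le_trans _ _ (\sum_(i < m) e * B)).
  by apply: ler_sum => i _; rewrite normrM ler_pM.
by rewrite sumr_const card_ord -(mulr_natl (e * B)) mulrA mulrAC.
Qed.

(** The constant is uniform on a cube. Induction over the ring operations reduces everything to the
    product rule, whose error splits into the two Taylor errors and the product of two first-order
    terms. *)
Lemma meval_taylor p (rho : R) : exists2 C : R, 0 <= C &
  forall (v h : 'I_n -> R) (e : R), (forall i, `|v i| <= rho) -> (forall i, `|h i| <= e) -> 0 <= e <= 1 ->
    `|p.@[fun i => v i + h i] - p.@[v] - \sum_i h i * (p^`M(i)).@[v]| <= C * e ^+ 2.
Proof.
elim/mpoly_ring_ind: p => [c|j|p q [C C0 hC] [D D0 hD]|p q [C C0 hC] [D D0 hD]].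
- exists 0 => // v h e _ _ _; rewrite !mevalC subrr sub0r normrN mul0r.
  by rewrite big1 ?normr0 // => i _; rewrite mderivC meval0 mulr0.
- exists 0 => // v h e _ _ _; rewrite !mevalXU mul0r.
  rewrite (bigD1 j) //= mderivXi_eval eqxx mulr1 big1.
    by rewrite addr0 (addrC (v j)) addrK subrr normr0.
  by move=> i ij; rewrite mderivXi_eval eq_sym (negbTE ij) mulr0.
- exists (C + D); first exact: addr_ge0.
  move=> v h e hv hh e1; rewrite !mevalD.
  have -> : \sum_i h i * ((p + q)^`M(i)).@[v] =
      \sum_i h i * (p^`M(i)).@[v] + \sum_i h i * (q^`M(i)).@[v].
    by rewrite -big_split /=; apply: eq_bigr => i _; rewrite mderivD mevalD mulrDr.
  have := lerD (hC v h e hv hh e1) (hD v h e hv hh e1); rewrite -mulrDl.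
  apply: le_trans; apply: le_trans (ler_normD _ _).
  by rewrite le_eqVlt; apply/orP; left; apply/eqP; congr `|_|; ring.
- have [Bp Bp0 hBp] := meval_bounded p rho.
  (* The radius is [rho + 1] because [q] is also evaluated at [v + h], with [h] bounded by
     [e <= 1]. *)
  have [Bq Bq0 hBq] := meval_bounded q (rho + 1).
  have [B2 B20 hB2] := meval_deriv_bounded p rho.
  have [B3 B30 hB3] := meval_deriv_bounded q rho.
  exists (C * Bq + Bp * D + n%:R * B2 * (D + n%:R * B3)).
    by rewrite !addr_ge0 // !mulr_ge0 // ?addr_ge0 // ?mulr_ge0.
  move=> v h e hv hh e01; rewrite !mevalM.
  have -> : \sum_i h i * ((p * q)^`M(i)).@[v] =
      (\sum_i h i * (p^`M(i)).@[v]) * q.@[v] + p.@[v] * \sum_i h i * (q^`M(i)).@[v].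
    rewrite mulr_suml mulr_sumr -big_split /=; apply: eq_bigr => i _.
    by rewrite mderivM mevalD !mevalM; ring.
  have l1 := norm_lincomb_le hh (hB2 v hv); have l2 := norm_lincomb_le hh (hB3 v hv).
  have hvh i : `|v i + h i| <= rho + 1.
    apply: le_trans (ler_normD _ _) _; rewrite lerD // (le_trans (hh i)) //.
    by case/andP: e01.
  have := hC v h e hv hh e01; have := hD v h e hv hh e01.
  have := hBp v hv; have := hBq _ hvh.
  move: l1 l2; set P1 := \sum_i _; set Q1 := \sum_i _.
  set p1 := p.@[fun i => v i + h i]; set q1 := q.@[fun i => v i + h i]; set p0 := p.@[v]; set q0 := q.@[v].
  move=> l1 l2 bq bp t2 t1; case/andP: e01 => e0 e1.
  have -> : p1 * q1 - p0 * q0 - (P1 * q0 + p0 * Q1) =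
    (p1 - p0 - P1) * q1 + p0 * (q1 - q0 - Q1) + P1 * (q1 - q0) by ring.
  have bq1 : `|q1 - q0| <= (D + n%:R * B3) * e.
    rewrite -(subrK Q1 (q1 - q0)); apply: le_trans (ler_normD _ _) _.
    rewrite mulrDl lerD //; apply: le_trans t2 _; rewrite ler_wpM2l // expr2.
    by rewrite -[leRHS]mulr1 ler_wpM2l.
  apply: le_trans (ler_normD _ _) _; rewrite [leRHS]mulrDl lerD //.
    apply: le_trans (ler_normD _ _) _; rewrite [leRHS]mulrDl lerD //.
      by rewrite normrM mulrAC ler_pM.
    by rewrite normrM -mulrA ler_pM.
  rewrite normrM expr2.
  have -> : n%:R * B2 * (D + n%:R * B3) * (e * e) = n%:R * B2 * e * ((D + n%:R * B3) * e) by ring.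
  by rewrite ler_pM.
Qed.

Lemma meval_lipschitz p (rho : R) : exists2 C : R, 0 <= C &
  forall (v h : 'I_n -> R) (e : R), (forall i, `|v i| <= rho) -> (forall i, `|h i| <= e) -> 0 <= e <= 1 ->
    `|p.@[fun i => v i + h i] - p.@[v]| <= C * e.
Proof.
have [C C0 hC] := meval_taylor p rho; have [B B0 hB] := meval_deriv_bounded p rho.
exists (C + n%:R * B); first by rewrite addr_ge0 // mulr_ge0.
move=> v h e hv hh e01; have := hC v h e hv hh e01.
have l1 := norm_lincomb_le hh (hB v hv); move: l1; set S := \sum_i _ => l1 t.
case/andP: e01 => e0 e1.
rewrite -(subrK S (_ - _)); apply: le_trans (ler_normD _ _) _.
rewrite mulrDl lerD //; apply: le_trans t _; rewrite ler_wpM2l // expr2.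
by rewrite -[leRHS]mulr1 ler_wpM2l.
Qed.

Lemma mderiv_all0 p : (forall i, p^`M(i) = 0) -> p = (p@_0%MM)%:MP.
Proof.
move=> h; apply/mpolyP => m; rewrite mcoeffC.
have [->|nm] := eqVneq m 0%MM; first by rewrite mulr1.
rewrite mulr0.
have [i mi] : exists i, m i != 0%N.
  apply/existsP; apply: contraR nm => /existsPn h0; apply/eqP/mnmP => i.
  by rewrite mnm0E; apply/eqP; have := h0 i; rewrite negbK.
have := congr1 (mcoeff (m - U_(i))%MM) (h i).
rewrite mcoeff_deriv mcoeff0 submK ?lep1mP // => /eqP.
by rewrite mulrn_eq0 /= => /eqP.
Qed.

(** By induction on the degree some partial derivative is nonzero at a point of the half-size cube.
    If [p] vanished on the whole cube, a Taylor step in that direction would make a nonzero linear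
    term quadratically small. *)
Lemma meval_neq0 p (c : 'I_n -> R) (s : R) : p != 0 -> 0 < s ->
  exists2 v : 'I_n -> R, (forall i, `|v i - c i| <= s) & p.@[v] != 0.
Proof.
have [k] : exists k, forall m, m \in msupp p -> (mdeg m < k)%N.
  by exists (msize p) => m; apply: msize_mdeg_lt.
elim: k p s => [|k IH] p s hk p0 s0.
  by exfalso; move: p0; rewrite -msupp_eq0; case: (msupp p) hk => // m l /(_ m); rewrite mem_head => /(_ isT).
have [all0|/existsNP [i /eqP ni]] := pselect (forall i, p^`M(i) = 0).
  exists c; first by move=> i; rewrite subrr normr0 ltW.
  by rewrite (mderiv_all0 all0) mevalC; move: p0; rewrite {1}(mderiv_all0 all0) mpolyC_eq0.
have s20 : 0 < s / 2 by rewrite divr_gt0.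
have [|v hv dv] := IH p^`M(i) (s / 2) _ ni s20.
  move=> m; rewrite mcoeff_msupp mcoeff_deriv mulrn_eq0 /= -mcoeff_msupp => /hk.
  by rewrite mdegD mdeg1 addn1.
apply: contrapT => hno.
have van w : (forall i, `|w i - c i| <= s) -> p.@[w] = 0.
  by move=> hw; apply/eqP; apply: contrapT => /negP nw; apply: hno; exists w.
have [C C0 hC] := meval_taylor p (\sum_i `|v i|).
have hv1 j : `|v j| <= \sum_i `|v i|.
  by rewrite (bigD1 j) //= lerDl; apply: sumr_ge0.
pose d : R := `|(p^`M(i)).@[v]|.
have d0 : 0 < d by rewrite normr_gt0.
(* [e <= s / 2] keeps the displaced point in the cube, and [e * (C + 1) <= d / 2] makes the error
   [C * e ^+ 2] smaller than the linear term [d * e]. *)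
pose e := Num.min (Num.min (s / 2) 1) (d / (2 * (C + 1))).
have C1 : 0 < 2 * (C + 1) by rewrite mulr_gt0 // ltr_wpDl.
have e0 : 0 < e by rewrite !lt_min s20 ltr01 divr_gt0.
have e1 : e <= 1 by rewrite !ge_min lexx orbT.
have es : e <= s / 2 by rewrite !ge_min lexx.
have ed : e <= d / (2 * (C + 1)) by rewrite !ge_min lexx !orbT.
pose h (j : 'I_n) : R := if j == i then e else 0.
have hh j : `|h j| <= e by rewrite /h; case: eqP; rewrite ?normr0 ?ger0_norm ?(ltW e0).
have := hC v h e hv1 hh; rewrite (ltW e0) e1 => /(_ isT).
rewrite !van ?subrr ?sub0r; first last.
- move=> j; rewrite addrAC; apply: le_trans (ler_normD _ _) _.
  by have := hv j; have := hh j; lra.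
- by move=> j; apply: le_trans (hv j) _; lra.
rewrite normrN (bigD1 i) //= big1 ?addr0; last by move=> j ji; rewrite /h (negbTE ji) mul0r.
rewrite /h eqxx normrM (gtr0_norm e0) -/d expr2 mulrA (mulrC e) ler_pM2r //.
move: ed; rewrite ler_pdivlMr // => ed l.
have : e * (C + 1) <= d / 2 by lra.
nra.
Qed.

(** * Reduction modulo [P] to finitely many monomials over the variables [T] *)

Section Reduction.
Variables (P : A -> Prop) (T : {set 'I_n}).
Hypotheses (hP : prime_ideal P) (hT : max_indep P T).
Let hI := prime_is_ideal hP.

Section Span.
Variable E : nat.
Local Notation B := {ffun 'I_n -> 'I_E.+1}.

Definition mon (al : B) : A := \prod_i 'X_i ^+ al i.

Definition mon_span (x : A) :=
  exists2 c : B -> A, (forall be, vars_in T (c be)) & P (x - \sum_be c be * mon be).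

Lemma mon_span_mon b al : vars_in T b -> mon_span (b * mon al).
Proof.
move=> vb; exists (fun be => if be == al then b else 0).
  by move=> be; case: eqP => // _; apply: vars_in0.
rewrite (bigD1 al) //= eqxx big1 ?addr0 ?subrr; first by case: hI.
by move=> be /negbTE ->; rewrite mul0r.
Qed.

Lemma mon_spanD x y : mon_span x -> mon_span y -> mon_span (x + y).
Proof.
move=> [c vc Pc] [d vd Pd]; exists (fun be => c be + d be).
  by move=> be; apply: vars_inD.
have -> : \sum_be (c be + d be) * mon be = \sum_be c be * mon be + \sum_be d be * mon be.
  by rewrite -big_split /=; apply: eq_bigr => be _; rewrite mulrDl.
by rewrite opprD addrACA; apply: idealD.
Qed.

Lemma mon_span_congr x y : P (x - y) -> mon_span y -> mon_span x.
Proof.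
move=> Pxy [c vc Pc]; exists c => //.
by rewrite -(subrK y x) -addrA; apply: idealD.
Qed.

Lemma mon_span_sum (K : Type) (r : seq K) (Q : pred K) (F : K -> A) :
  (forall i, Q i -> mon_span (F i)) -> mon_span (\sum_(i <- r | Q i) F i).
Proof.
move=> h; apply: big_ind => //; last exact: mon_spanD.
exists (fun=> 0); first by move=> be; apply: vars_in0.
by rewrite big1 ?subrr; [case: hI|move=> be _; rewrite mul0r].
Qed.

Lemma mon_upd (al : B) l (k : 'I_E.+1) :
  mon [ffun i => if i == l then k else al i] = 'X_l ^+ k * \prod_(i | i != l) 'X_i ^+ al i.
Proof.
rewrite /mon (bigD1 l) //= ffunE eqxx; congr (_ * _); apply: eq_bigr => i il.
by rewrite ffunE (negbTE il).
Qed.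

Lemma monE (al : B) l : mon al = 'X_l ^+ al l * \prod_(i | i != l) 'X_i ^+ al i.
Proof. by rewrite /mon (bigD1 l). Qed.

Lemma mon0 : mon [ffun=> ord0] = 1.
Proof. by rewrite /mon big1 // => i _; rewrite ffunE expr0. Qed.

End Span.

(** Once [a], the product of the leading coefficients of the minimal relations, is inverted, the
    quotient is a finite module over the variables [T]: an exponent that would exceed [E] is lowered
    by the minimal relation of its variable. *)
Lemma mon_span_mulX : exists E a, [/\ vars_in T a, ~ P a &
  forall l (al : {ffun 'I_n -> 'I_E.+1}), mon_span E (a * 'X_l * mon al)].
Proof.
have /choice [G hG] : forall j, exists G : {poly A}, j \notin T -> min_relation P T j G.
  move=> j; have [jT|jT] := boolP (j \in T); first by exists 0.
  by have [G hG] := max_indep_min_relation hP hT (subxx T) jT; exists G.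
pose E := \max_j (size (G j)).
pose a := \prod_(j | j \notin T) lead_coef (G j).
exists E, a; split.
- by apply: vars_in_prod => j jT; have [cG _ _ _] := hG j jT; apply: cG.
- by apply: prime_prod => // j jT; have [] := hG j jT.
move=> l al.
have va : vars_in T a by apply: vars_in_prod => j jT; have [cG _ _ _] := hG j jT; apply: cG.
have [lT|lT] := boolP (l \in T).
  by apply: mon_span_mon; apply: vars_inM => //; apply: vars_inX.
have [lt|ge] := ltnP (al l).+1 E.+1.
  have := @mon_span_mon E a [ffun i => if i == l then Ordinal lt else al i] va.
  by rewrite mon_upd /= exprS (monE al l) !mulrA.
have [cG PG lG _] := hG l lT.
have sG : (size (G l) <= E)%N by apply: leq_bigmax.
have sG1 := min_relation_size hP (hG l lT).
have eE : (al l : nat) = E by apply/eqP; rewrite eqn_leq -ltnS ltn_ord -ltnS.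
pose d := (size (G l)).-1.
pose a' := \prod_(j | (j \notin T) && (j != l)) lead_coef (G j).
have ea : a = lead_coef (G l) * a' by rewrite /a (bigD1 l).
have va' : vars_in T a'.
  by apply: vars_in_prod => j /andP [jT _]; have [cGj _ _ _] := hG j jT; apply: cGj.
pose M := \prod_(i | i != l) ('X_i : A) ^+ al i.
(* The relation of ['X_l] times [a' * 'X_l ^+ (E.+1 - d) * M] has leading term [a * 'X_l * mon al];
   in its other terms the exponent of ['X_l] is at most [E]. *)
have rel : P (a * 'X_l * mon al + \sum_(i < d) a' * (G l)`_i * ('X_l ^+ (E.+1 - d + i) * M)).
  have -> : a * 'X_l * mon al + \sum_(i < d) a' * (G l)`_i * ('X_l ^+ (E.+1 - d + i) * M) =
    a' * 'X_l ^+ (E.+1 - d) * M * (G l).['X_l].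
    rewrite horner_coef.
    have -> : size (G l) = d.+1 by rewrite /d prednK // ltnW.
    rewrite big_ord_recr /= mulrDr addrC mulr_sumr; congr (_ + _).
      by apply: eq_bigr => i _; rewrite exprD; ring.
    rewrite ea (monE al l) -/M eE /lead_coef -/d.
    have -> : 'X_l ^+ E = 'X_l ^+ (E - d) * 'X_l ^+ d :> A.
      by rewrite -exprD subnK // /d; lia.
    have -> : (E.+1 - d)%N = (E - d).+1 by rewrite subSn // /d; lia.
    by rewrite exprS; ring.
  exact: idealMl.
apply: (mon_span_congr (y := - \sum_(i < d) a' * (G l)`_i * ('X_l ^+ (E.+1 - d + i) * M))).
  by rewrite opprK.
rewrite -sumrN; apply: mon_span_sum => i _.
have lt : (E.+1 - d + i < E.+1)%N.
  by have := ltn_ord i; rewrite /d; lia.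
have := @mon_span_mon E (- (a' * (G l)`_i)) [ffun i => if i == l then Ordinal lt else al i] _.
rewrite mon_upd /= mulNr; apply.
by apply: vars_inN; apply: vars_inM.
Qed.

(** [C] is a matrix of multiplication by [a ^+ N * g] on the monomials modulo [P]. That the
    exponents of its entries grow only linearly in [N] is what lets the dimension count in
    [alg_dependent] succeed. *)
Definition rep E (a : A) dl N g := exists2 C : {ffun 'I_n -> 'I_E.+1} -> {ffun 'I_n -> 'I_E.+1} -> A,
  (forall al be, box T (N * dl) (C al be)) &
  forall al, P (a ^+ N * g * mon al - \sum_be C al be * mon be).

Lemma repM E a dl N1 N2 g1 g2 :
  rep E a dl N1 g1 -> rep E a dl N2 g2 -> rep E a dl (N1 + N2) (g1 * g2).
Proof.
move=> [C1 b1 h1] [C2 b2 h2].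
exists (fun al be => \sum_ga C2 al ga * C1 ga be).
  move=> al be; apply: box_sum => ga _; rewrite addnC mulnDl; exact: boxM.
move=> al.
have -> : \sum_be (\sum_ga C2 al ga * C1 ga be) * mon be =
    \sum_ga C2 al ga * \sum_be C1 ga be * mon be.
  under eq_bigr do rewrite mulr_suml.
  rewrite exchange_big /=; apply: eq_bigr => ga _; rewrite mulr_sumr.
  by apply: eq_bigr => be _; rewrite mulrA.
have -> : a ^+ (N1 + N2) * (g1 * g2) * mon al - \sum_ga C2 al ga * \sum_be C1 ga be * mon be =
    a ^+ N1 * g1 * (a ^+ N2 * g2 * mon al - \sum_be C2 al be * mon be) +
    \sum_ga C2 al ga * (a ^+ N1 * g1 * mon ga - \sum_be C1 ga be * mon be).
  have -> : \sum_ga C2 al ga * (a ^+ N1 * g1 * mon ga - \sum_be C1 ga be * mon be) =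
      a ^+ N1 * g1 * \sum_ga C2 al ga * mon ga - \sum_ga C2 al ga * \sum_be C1 ga be * mon be.
    by rewrite mulr_sumr -sumrB; apply: eq_bigr => ga _; ring.
  by rewrite exprD; ring.
apply: idealD => //; first exact: idealMl.
by apply: ideal_sum => // ga _; apply: idealMl.
Qed.

Lemma repD E a dl N g1 g2 : rep E a dl N g1 -> rep E a dl N g2 -> rep E a dl N (g1 + g2).
Proof.
move=> [C1 b1 h1] [C2 b2 h2]; exists (fun al be => C1 al be + C2 al be).
  by move=> al be; apply: boxD.
move=> al; have := idealD hI (h1 al) (h2 al); congr (P _).
under [in RHS]eq_bigr do rewrite mulrDl.
by rewrite big_split /=; ring.
Qed.

Lemma repC E a dl (c : R) : rep E a dl 0 c%:MP.
Proof.
exists (fun al be => if al == be then c%:MP else 0).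
  by move=> al be; case: eqP => _; [apply: boxC|rewrite -(mpolyC0 n R); apply: boxC].
move=> al; rewrite (bigD1 al) //= eqxx expr0 mul1r big1 ?addr0 ?subrr; first by case: hI.
by move=> be; rewrite eq_sym => /negbTE ->; rewrite mul0r.
Qed.

(** [E], [a] and [dl] are common to all [g]; only the power [N] of the denominator depends on [g].
    The representation of [1] serves to raise that power. *)
Lemma rep_exists : exists E a dl, [/\ vars_in T a, ~ P a, rep E a dl 1 1 &
  forall g, exists N, rep E a dl N g].
Proof.
have [E [a [va na hs]]] := mon_span_mulX.
have /choice [C hC] : forall x : 'I_n * {ffun 'I_n -> 'I_E.+1},
    exists c : {ffun 'I_n -> 'I_E.+1} -> A, (forall be, vars_in T (c be)) /\
      P (a * 'X_(x.1) * mon x.2 - \sum_be c be * mon be).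
  by move=> [l al]; have [c vc Pc] := hs l al; exists c.
have /choice [D hD] : forall x : 'I_n * {ffun 'I_n -> 'I_E.+1} * {ffun 'I_n -> 'I_E.+1},
    exists D, box T D (C x.1 x.2).
  by move=> [x be]; apply: vars_in_box; case: (hC x).
have [Da hDa] := vars_in_box va.
pose dl := (Da + \max_x D x)%N; exists E, a, dl.
have r1 : rep E a dl 1 1.
  exists (fun al be => if al == be then a else 0).
    move=> al be; case: eqP => _; last by rewrite -(mpolyC0 n R); apply: boxC.
    by apply: boxS hDa; rewrite mul1n leq_addr.
  move=> al; rewrite (bigD1 al) //= eqxx expr1 mulr1 big1 ?addr0 ?subrr; first by case: hI.
  by move=> be; rewrite eq_sym => /negbTE ->; rewrite mul0r.
have rX l : rep E a dl 1 'X_l.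
  exists (fun al => C (l, al)).
    move=> al be; apply: boxS (hD ((l, al), be)); rewrite mul1n.
    apply: leq_trans (leq_addl _ _); exact: (leq_bigmax (F := D) ((l, al), be)).
  by move=> al; rewrite expr1; case: (hC (l, al)).
have rw k N g : rep E a dl N g -> rep E a dl (k + N) g.
  elim: k => [//|k IH] r; rewrite addSn -add1n -[g]mul1r; exact: repM (IH r).
split=> //; elim/mpoly_ring_ind => [c|i|p q [N1 h1] [N2 h2]|p q [N1 h1] [N2 h2]].
- by exists 0%N; apply: repC.
- by exists 1%N.
- exists (N1 + N2)%N; apply: repD; last exact: rw.
  by rewrite addnC; apply: rw.
- by exists (N1 + N2)%N; apply: repM.
Qed.

Lemma rep_weaken E a dl k N g : rep E a dl 1 1 -> rep E a dl N g -> (N <= k)%N -> rep E a dl k g.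
Proof.
move=> r1 r le; rewrite -(subnK le).
elim: (k - N)%N => [//|i IH]; rewrite addSn -add1n -[g]mul1r; exact: repM IH.
Qed.

End Reduction.

(** * Algebraic dependence by counting monomials *)

Lemma linear_relation (I J : finType) (M : I -> J -> R) : (#|J| < #|I|)%N ->
  exists2 q : I -> R, (exists i, q i != 0) & forall j, \sum_i q i * M i j = 0.
Proof.
move=> lt; pose X : 'M[R]_(#|I|, #|J|) := \matrix_(i, j) M (enum_val i) (enum_val j).
have nz : kermx X != 0.
  rewrite -mxrank_eq0 mxrank_ker subn_eq0 -ltnNge.
  by apply: leq_ltn_trans lt; apply: rank_leq_col.
have [i ri] : exists i, row i (kermx X) != 0.
  apply/existsP; apply: contraR nz => /existsPn h; apply/eqP/row_matrixP => i.
  by rewrite row0; apply/eqP; have := h i; rewrite negbK.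
pose v := row i (kermx X).
have vX : v *m X = 0 by apply/sub_kermxP; apply: row_sub.
exists (fun x => v 0 (enum_rank x)).
  have [k vk] : exists k, v 0 k != 0.
    apply/existsP; apply: contraR ri => /existsPn h; apply/eqP/rowP => k.
    by have := h k; rewrite negbK => /eqP e; rewrite [RHS]mxE; exact: e.
  by exists (enum_val k); rewrite enum_valK.
move=> y; have := congr1 (fun Z : 'rV[R]_#|J| => Z 0 (enum_rank y)) vX; rewrite mxE [X in _ = X]mxE.
rewrite (reindex (@enum_rank I)) /=; last exact/onW_bij/enum_rank_bij.
move=> e; rewrite -[RHS]e; apply: eq_bigr => x _.
by rewrite [X _ _]mxE !enum_rankK.
Qed.

(* Counting: the polynomials [F^beta] with exponents below [D] are [D^m] many, but modulo [P]
   and up to a power of [a] they lie in a real space of dimension [O(D^#|T|)]. *)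
Lemma alg_dependent P T m (F : 'I_m -> A) : prime_ideal P -> max_indep P T -> (#|T| < m)%N ->
  exists2 Q : {mpoly R[m]}, Q != 0 & P (Q \mPo [tuple F i | i < m]).
Proof.
move=> hP hT ltm; have hI := prime_is_ideal hP.
have [E [a [dl [va na r1 hr]]]] := rep_exists hP hT.
have /choice [N hN] : forall i, exists N, rep P T E a dl N (F i) by move=> i; apply: hr.
pose N0 := \max_i N i.
have {}hN i : rep P T E a dl N0 (F i).
  by apply: rep_weaken (hN i) _ => //; apply: leq_bigmax.
pose B := {ffun 'I_n -> 'I_E.+1}.
(* As [K <= D * K1], the target space has at most [#|B| * (D * K1) ^ #|T|] coordinates. This is
   below [D ^ #|T| * D <= D ^ m], because [D] exceeds [#|B| * K1 ^ #|T|]. *)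
pose K1 := (m * N0 * dl + 1)%N.
pose D := (#|{: B}| * K1 ^ #|T|).+1.
pose NN := (m * D * N0)%N.
have repF (be : {ffun 'I_m -> 'I_D}) : rep P T E a dl NN (\prod_i F i ^+ be i).
  apply: (@rep_weaken _ _ hP _ _ _ _ (\sum_i be i * N0)%N) => //; last first.
    rewrite /NN -mulnA; apply: (@leq_trans (\sum_(i < m) D * N0)).
      by apply: leq_sum => i _; rewrite leq_mul2r ltnW ?orbT // ltn_ord.
    by rewrite sum_nat_const card_ord.
  apply: (big_rec2 (fun p k => rep P T E a dl k p)).
    by rewrite -(mpolyC1 n R); apply: repC.
  move=> i x y _ IH; apply: repM => //.
  elim: (be i : nat) => [|k IHk]; first by rewrite expr0 -(mpolyC1 n R) mul0n; apply: repC.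
  by rewrite exprS mulSn; apply: repM.
have /choice [c hc] : forall be : {ffun 'I_m -> 'I_D}, exists c : B -> A,
    (forall ga, box T (NN * dl) (c ga)) /\
    P (a ^+ NN * \prod_i F i ^+ be i - \sum_ga c ga * mon ga).
  move=> be; have [C bC PC] := repF be; exists (C [ffun=> ord0]); split => //.
  by have := PC [ffun=> ord0]; rewrite mon0 mulr1.
pose K := (NN * dl).+1.
pose mk (ka : {ffun 'I_#|T| -> 'I_K}) : 'X_{1..n} :=
  [multinom (\sum_(t | enum_val t == i) ka t)%N | i < n].
have [|q [be0 q0] hq] := @linear_relation {ffun 'I_m -> 'I_D}
    (B * {ffun 'I_#|T| -> 'I_K})%type (fun be x => (c be x.1)@_(mk x.2)).
  rewrite card_prod !card_ffun !card_ord.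
  have leK : (K <= D * K1)%N by rewrite /K /NN /K1; nia.
  apply: (@leq_ltn_trans (#|{: B}| * (D * K1) ^ #|T|)).
    apply: leq_mul; first by rewrite card_ffun !card_ord.
    by case: (#|T|) => [//|k]; rewrite leq_exp2r.
  rewrite expnMn mulnCA; apply: (@leq_trans (D ^ #|T| * D)); last first.
    by rewrite -expnSr leq_pexp2l.
  by rewrite ltn_pmul2l ?expn_gt0.
pose Q : {mpoly R[m]} := \sum_be q be *: 'X_[[multinom (be i : nat) | i < m]].
have mn_inj : injective (fun be : {ffun 'I_m -> 'I_D} => [multinom (be i : nat) | i < m]).
  move=> b1 b2 /mnmP h; apply/ffunP => i; apply: val_inj; have := h i; by rewrite !mnmE.
exists Q.
  apply/eqP => /(congr1 (mcoeff [multinom (be0 i : nat) | i < m])); rewrite mcoeff0 raddf_sum /=.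
  rewrite (bigD1 be0) //= mcoeffZ mcoeffX eqxx mulr1 big1 ?addr0; first exact/eqP.
  by move=> b1 nb; rewrite mcoeffZ mcoeffX (inj_eq mn_inj) (negbTE nb) mulr0.
have QE : Q \mPo [tuple F i | i < m] = \sum_be q be *: \prod_i F i ^+ be i.
  rewrite /Q raddf_sum /=; apply: eq_bigr => be _; rewrite comp_mpolyZ comp_mpolyX.
  by congr (_ *: _); apply: eq_bigr => i _; rewrite tnth_mktuple mnmE.
have zero ga : \sum_be q be *: c be ga = 0.
  apply/mpolyP => mm; rewrite mcoeff0 raddf_sum /=.
  have [hm|hm] := boolP [forall i, (mm i < K)%N && ((i \in T) || (mm i == 0%N))].
    pose ka : {ffun 'I_#|T| -> 'I_K} := [ffun t => inord (mm (enum_val t))].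
    have <- : mk ka = mm.
      apply/mnmP => i; rewrite mnmE; have /forallP /(_ i) /andP [lt Ti] := hm.
      have [iT|iT] := boolP (i \in T).
        rewrite (big_pred1 (enum_rank_in iT i)) ?ffunE ?enum_rankK_in // ?inordK //.
        move=> t; apply/eqP/eqP => [e|->]; first by apply: enum_val_inj; rewrite enum_rankK_in.
        by rewrite enum_rankK_in.
      move: Ti; rewrite (negbTE iT) /= => /eqP ->; rewrite big1 // => t /eqP e.
      by move: iT; rewrite -e enum_valP.
    by rewrite -[RHS](hq (ga, ka)); apply: eq_bigr => be _; rewrite mcoeffZ.
  rewrite big1 // => be _; rewrite mcoeffZ memN_msupp_eq0 ?mulr0 //.
  apply: contra hm => hm; apply/forallP => i; have [vc _] := hc be.
  have [v1 b1] := vc ga.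
  rewrite ltnS (b1 _ hm) /=; have [//|iT] := boolP (i \in T).
  by rewrite (v1 _ hm).
have : P (a ^+ NN * (Q \mPo [tuple F i | i < m])).
  have z : \sum_ga (\sum_be q be *: c be ga) * mon ga = 0.
    by rewrite big1 // => ga _; rewrite zero mul0r.
  rewrite QE -[X in P X]subr0 -[X in _ - X]z.
  have -> : \sum_ga (\sum_be q be *: c be ga) * mon ga =
      \sum_be q be *: \sum_ga c be ga * mon ga.
    under eq_bigr do rewrite mulr_suml.
    rewrite exchange_big /=; apply: eq_bigr => be _; rewrite scaler_sumr.
    by apply: eq_bigr => ga _; rewrite scalerAl.
  rewrite mulr_sumr -sumrB; apply: ideal_sum => // be _.
  by rewrite -scalerAr -scalerBr; apply: idealZ => //; case: (hc be).
by case: (hP) => _ [_ h] /h [] // /(primeX hP na).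
Qed.

(** An ideal that is maximal among those containing [J] and disjoint from a multiplicative set is
    prime. *)
Lemma prime_avoiding J (W : A -> Prop) : is_ideal J -> W 1 ->
  (forall a b, W a -> W b -> W (a * b)) -> (forall a, J a -> ~ W a) ->
  exists Q, [/\ prime_ideal Q, forall a, J a -> Q a & forall a, Q a -> ~ W a].
Proof.
move=> hJ W1 WM JW.
(* Adjoining [J] takes care of the empty chain: its union is empty and not an ideal, but [U] of it
   is [J]. *)
pose U (X : A -> Prop) p := J p \/ X p.
pose Phi (X : A -> Prop) := is_ideal (U X) /\ forall a, U X a -> ~ W a.
have [F FP Ftot|M [[iM dM] maxM]] := @classical_sets.Zorn_bigcup A Phi.
  have key a b : U (classical_sets.bigcup F id) a -> U (classical_sets.bigcup F id) b ->
      (J a /\ J b) \/ exists X, [/\ F X, U X a & U X b].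
    move=> [Ja|[X FX Xa]] [Jb|[Y FY Yb]]; [by left| | |].
    - by right; exists Y; split => //; [left|right].
    - by right; exists X; split => //; [right|left].
    - by right; have [h|h] := Ftot X Y FX FY; [exists Y|exists X]; split => //; right => //; apply: h.
  have up X a : F X -> U X a -> U (classical_sets.bigcup F id) a.
    by move=> FX [Ja|Xa]; [left|right; exists X].
  split; first split; first by left; case: hJ.
    split=> [a b ha hb|r a ha].
      have [[Ja Jb]|[X [FX Xa Xb]]] := key _ _ ha hb; first by left; apply: idealD.
      by apply: (up X) => //; apply: idealD => //; case: (FP X FX).
    have [[Ja _]|[X [FX Xa _]]] := key _ _ ha ha; first by left; apply: idealMl.
    by apply: (up X) => //; apply: idealMl => //; case: (FP X FX).
  move=> a ha; have [[Ja _]|[X [FX Xa _]]] := key _ _ ha ha; first exact: JW.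
  by case: (FP X FX) => _; apply.
exists (U M); split=> //; last by move=> a; left.
split=> //; split=> [h1|a b Mab]; first exact: dM h1 W1.
apply: contrapT => /not_orP [na nb].
(* By maximality, the ideal generated by [U M] and an element [c] outside it meets [W]. *)
have ext c : ~ U M c -> exists w r, [/\ W w & U M (w - r * c)].
  move=> nc; pose B p := exists r, U M (p - r * c).
  have iB : is_ideal (U B).
    have e p : U B p -> B p.
      by move=> [Jp|//]; exists 0; rewrite mul0r subr0; left.
    split; first by left; case: hJ.
    split=> [x y /e [r hr] /e [s hs]|r x /e [s hs]]; right.
      exists (r + s); have -> : x + y - (r + s) * c = (x - r * c) + (y - s * c) by ring.
      exact: idealD.
    by exists (r * s); rewrite -mulrA -mulrBr; apply: idealMl.
  have /maxM : classical_sets.proper M B.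
    split; first by move=> p Mp; exists 0; rewrite mul0r subr0; right.
    move=> sB; apply: nc; right; apply: sB; exists 1; rewrite mul1r subrr.
    by case: iM.
  move=> nB; apply: contrapT => no; apply: nB; split => // p hp Wp; apply: no.
  case: hp => [Jp|[r hr]]; last by exists p, r.
  by exists p, 0; split => //; rewrite mul0r subr0; left.
have [w1 [r1 [Ww1 h1]]] := ext _ na; have [w2 [r2 [Ww2 h2]]] := ext _ nb.
apply: (dM (w1 * w2)); last exact: WM.
have -> : w1 * w2 = (w1 - r1 * a) * w2 + r1 * a * (w2 - r2 * b) + r1 * r2 * (a * b) by ring.
apply: idealD => //; last exact: idealMl.
by apply: idealD => //; [apply: idealMr|apply: idealMl].
Qed.

Definition subst_at t (c : R) : n.-tuple A := [tuple (if i == t then c%:MP else 'X_i) | i < n].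

Lemma subst_at_vars_in U t c p : vars_in U p -> t \notin U -> p \mPo subst_at t c = p.
Proof.
move=> vp tU; rewrite comp_mpolyE [RHS]mpolyE; apply: eq_big_seq => m hm.
congr (_ *: _); rewrite [RHS]mpolyXE_id; apply: eq_bigr => i _; rewrite tnth_mktuple.
by case: eqP => // ->; rewrite (vp _ hm) // !expr0.
Qed.

Lemma subst_at_neq0 t p : p != 0 -> exists c, p \mPo subst_at t c != 0.
Proof.
move=> p0; have [v _ vp] := meval_neq0 (fun=> 0) p0 ltr01.
exists (v t); apply: contra vp => /eqP e.
have := congr1 (meval v) e; rewrite meval0 comp_mpoly_meval => <-; apply/eqP.
apply: meval_eq => i; rewrite tnth_mktuple.
by case: eqP => [->|_]; rewrite ?mevalC ?mevalXU.
Qed.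

(** [Q] contains [P] and [f = 'X_t - c], and avoids the nonzero polynomials in the remaining
    variables. What must be shown is that no such [w] is congruent to a multiple [f * g] modulo [P];
    a determinant, playing the role of a norm, settles this. *)
Lemma prime_chain_step P T t : prime_ideal P -> indep P T -> t \in T ->
  exists Q, [/\ prime_ideal Q, forall p, P p -> Q p, exists2 q, Q q & ~ P q & indep Q (T :\ t)].
Proof.
move=> hP iT0 tT0; have hI := prime_is_ideal hP.
have [T1 sT hT] := indep_max iT0.
have tT : t \in T1 by apply: (subsetP sT).
have iT := proj1 hT.
have [E [a [dl [va na r1 hr]]]] := rep_exists hP hT.
have a0 : a != 0 by apply/eqP => a0; apply: na; rewrite a0; case: hI.
(* [c] is a value of ['X_t] at which the common denominator [a] does not become zero. *)
have [c ac] := subst_at_neq0 t a0.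
pose f : A := 'X_t - c%:MP.
have vf : vars_in T1 f by apply: vars_inB; [apply: vars_inX|apply: vars_inC].
have sf : f \mPo subst_at t c = 0.
  rewrite /f comp_mpolyB comp_mpolyC; have := comp_mpolyX U_(t) (subst_at t c) => ->.
  rewrite (bigD1 t) //= mnm1E eqxx expr1 tnth_mktuple eqxx big1 ?mulr1 ?subrr //.
  by move=> i it; rewrite mnm1E eq_sym (negbTE it) expr0.
have f0 : f != 0.
  apply/eqP => /(congr1 (mcoeff U_(t))); rewrite mcoeffB mcoeffX eqxx mcoeffC mcoeff0.
  by rewrite mnm1_eq0 mulr0 subr0 => /eqP; rewrite oner_eq0.
pose J p := exists2 g, P (p - f * g) & True.
have hJ : is_ideal J.
  split; first by exists 0 => //; rewrite mulr0 subr0; case: hI.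
  split=> [x y [g1 h1 _] [g2 h2 _]|r x [g h _]].
    exists (g1 + g2) => //.
    have -> : x + y - f * (g1 + g2) = (x - f * g1) + (y - f * g2) by ring.
    exact: idealD.
  exists (r * g) => //.
  have -> : r * x - f * (r * g) = r * (x - f * g) by ring.
  exact: idealMl.
pose W w := vars_in (T1 :\ t) w /\ w != 0.
have sTt : T1 :\ t \subset T1 by apply: subD1set.
have JW w : J w -> ~ W w.
  move=> [g hg _] [vw w0].
  have [N [C bC hC]] := hr g.
  pose s := #|{: {ffun 'I_n -> 'I_E.+1}}|.
  (* Determinant trick: modulo [P] the matrix [X] kills the vector of monomials, one entry of which
     is [1], so [\det X] is in [P]. Its entries involve only [T1], so independence makes it zero. *)
  pose X : 'M[A]_s := (a ^+ N * w)%:M - f *: (\matrix_(i, j) C (enum_val i) (enum_val j)).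
  pose mv : 'cV[A]_s := \col_i mon (enum_val i).
  have Xm i : P ((X *m mv) i 0).
    rewrite mulmxBl mul_scalar_mx -scalemxAl !mxE.
    have -> : \sum_j (\matrix_(i, j) C (enum_val i) (enum_val j)) i j * mv j 0 =
        \sum_be C (enum_val i) be * mon be.
      rewrite (reindex (@enum_rank _)) /=; last exact/onW_bij/enum_rank_bij.
      by apply: eq_bigr => be _; rewrite !mxE enum_rankK.
    have -> : a ^+ N * w * mon (enum_val i) - f * \sum_be C (enum_val i) be * mon be =
        a ^+ N * mon (enum_val i) * (w - f * g) +
        f * (a ^+ N * g * mon (enum_val i) - \sum_be C (enum_val i) be * mon be) by ring.
    by apply: idealD => //; apply: idealMl.
  have detP : P (\det X).
    have := congr1 (fun Z : 'M_s => (Z *m mv) (enum_rank [ffun=> ord0]) 0) (mul_adj_mx X).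
    rewrite -mulmxA mul_scalar_mx [X in _ = X]mxE [X in _ = _ * X]mxE enum_rankK mon0 mulr1 => <-.
    by rewrite mxE; apply: ideal_sum => // i _; apply: idealMl.
  have vX i j : vars_in T1 (X i j).
    rewrite !mxE; apply: vars_inB.
      rewrite -mulr_natr; apply: vars_inM; last first.
        by case: eqP => _; [apply: vars_in1|apply: vars_in0].
      by apply: vars_inM; [apply: vars_in_exp|apply: vars_inS vw].
    by apply: vars_inM => //; case: (bC (enum_val i) (enum_val j)).
  have det0 : \det X = 0.
    apply: iT => //; apply: vars_in_sum => sg _; apply: vars_inM; last exact: vars_in_prod.
    by apply: vars_in_exp; rewrite -(mpolyC1 n R); apply: vars_inN; apply: vars_inC.
  (* Setting ['X_t] to [c] kills [f] and leaves a scalar matrix whose diagonal entry is nonzero. *)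
  have := congr1 (comp_mpoly (subst_at t c)) det0; rewrite raddf0 -det_map_mx.
  have -> : map_mx (comp_mpoly (subst_at t c)) X = ((a \mPo subst_at t c) ^+ N * w)%:M.
    apply/matrixP => i j; rewrite !mxE raddfB /= rmorphM /= sf mul0r subr0.
    rewrite -mulr_natr rmorphM /= rmorph_nat rmorphM rmorphXn /= (subst_at_vars_in c vw) ?mulr_natr //.
    by rewrite !inE eqxx.
  move=> /eqP; rewrite det_scalar; apply/negP.
  by rewrite expf_neq0 // mulf_neq0 // expf_neq0.
have W1 : W 1 by split; [apply: vars_in1|apply: oner_neq0].
have WM x y : W x -> W y -> W (x * y).
  by move=> [vx x0] [vy y0]; split; [apply: vars_inM|apply: mulf_neq0].
have [Q [pQ JQ QW]] := prime_avoiding hJ W1 WM JW.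
exists Q; split=> //.
- by move=> p Pp; apply: JQ; exists 0 => //; rewrite mulr0 subr0.
- exists f; first by apply: JQ; exists 1 => //; rewrite mulr1 subrr; case: hI.
  by move=> Pf; move/eqP: f0; apply; apply: iT.
- apply: (@indepS _ _ (T1 :\ t)); first exact: setSD.
  by move=> p vp Qp; apply/eqP; apply: contrapT => /negP p0; apply: (QW p).
Qed.

Lemma prime_chain_of_indep P T : prime_ideal P -> indep P T ->
  exists ch, prime_chain P #|T| ch /\ ch 0%N = P.
Proof.
have [k] : exists k, #|T| = k by exists #|T|.
move=> e; rewrite e; elim: k P T e => [|k IH] P T e hP iT.
  exists (fun=> P); split => //; split => // i _; by split.
have [t tT] : exists t, t \in T by apply/set0Pn; rewrite -card_gt0 e.
have [Q [pQ PQ [q Qq nq] iQ]] := prime_chain_step hP iT tT.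
have [|ch [[c1 c2] c0]] := IH Q (T :\ t) _ pQ iQ.
  by have := cardsD1 t T; rewrite tT e add1n => -[].
exists (fun i => if i is i'.+1 then ch i' else P); split => //; split=> [[|i]|[|i]] hi //.
- have [pi Qi] := c1 i hi; split => // p /PQ; exact: Qi.
- rewrite c0; split => // e'; apply: nq; by rewrite e'.
- exact: c2.
Qed.

Lemma meval_vars_in U p v w : vars_in U p -> (forall i, i \in U -> v i = w i) ->
  p.@[v] = p.@[w].
Proof.
move=> vp h; rewrite !mevalE; apply: eq_big_seq => m hm; congr (_ * _).
apply: eq_bigr => i _; have [/h -> //|iU] := boolP (i \in U).
by rewrite (vp _ hm) // !expr0.
Qed.

End Ideals.

(** * Krull dimension as the size of a maximal independent set *)

Section Dimension.
Variables (R : realType) (n : nat).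
Local Notation A := {mpoly R[n]}.
Implicit Types (P Q : A -> Prop) (T : {set 'I_n}).

Lemma comp_mpoly_vars_in m (U : {set 'I_m}) (S : {mpoly R[m]}) (F : 'I_m -> A) T :
  vars_in U S -> (forall i, i \in U -> vars_in T (F i)) ->
  vars_in T (S \mPo [tuple F i | i < m]).
Proof.
move=> vS hF; rewrite comp_mpolyE big_seq; apply: vars_in_sum => mm hm; apply: vars_inZ.
apply: vars_in_prod => i _; rewrite tnth_mktuple.
have [iU|iU] := boolP (i \in U); last by rewrite (vS _ hm) // expr0; apply: vars_in1.
by apply: vars_in_exp; apply: hF.
Qed.

Lemma comp_mpoly_neq0 m (U : {set 'I_m}) (S : {mpoly R[m]}) (F : 'I_m -> A) :
  vars_in U S -> S != 0 ->
  (forall y : 'I_m -> R, exists v, forall i, i \in U -> (F i).@[v] = y i) ->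
  S \mPo [tuple F i | i < m] != 0.
Proof.
move=> vS S0 hF; have [y _ Sy] := meval_neq0 (fun=> 0) S0 ltr01.
have [v hv] := hF y; apply: contra Sy => /eqP e; have := congr1 (meval v) e.
rewrite comp_mpoly_meval meval0 => e'; apply/eqP; rewrite -e'.
by apply: (meval_vars_in vS) => i iU; rewrite tnth_mktuple hv.
Qed.

Lemma eval_enum_surj T (y : 'I_#|T| -> R) :
  exists v : 'I_n -> R, forall i, v (enum_val i) = y i.
Proof.
exists (fun k => if [pick i | enum_val i == k] is Some i then y i else 0) => i.
case: pickP => [j /eqP /enum_val_inj -> //|/(_ i)]; by rewrite eqxx.
Qed.

Lemma indep_card P T T' : prime_ideal P -> max_indep P T -> indep P T' -> (#|T'| <= #|T|)%N.
Proof.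
move=> hP hT iT'; rewrite leqNgt; apply/negP => lt.
pose F (i : 'I_#|T'|) : A := 'X_(enum_val i).
have [S S0 PS] := alg_dependent F hP hT lt.
have vS := vars_inT (p := S).
have /eqP[] : S \mPo [tuple F i | i < #|T'|] != 0.
  apply: (comp_mpoly_neq0 vS S0) => y; have [v hv] := eval_enum_surj y.
  by exists v => i _; rewrite mevalXU.
apply: iT' => //; apply: (comp_mpoly_vars_in vS) => i _.
by apply: vars_inX; apply: enum_valP.
Qed.

(** In a relation of least size, put the last variable equal to zero. The result is nonzero:
    otherwise the last variable could be divided out, since [F ord_max] is outside the prime [P],
    and a smaller relation would remain. *)
Lemma relation_mod_elt P T m (F : 'I_m.+1 -> A) : prime_ideal P -> max_indep P T ->
  (#|T| <= m)%N -> ~ P (F ord_max) ->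
  exists S : {mpoly R[m.+1]}, [/\ S != 0, vars_in [set~ ord_max] S &
    exists g, P (S \mPo [tuple F i | i < m.+1] - F ord_max * g)].
Proof.
move=> hP hT le nF; have hI := prime_is_ideal hP.
pose c (S : {mpoly R[m.+1]}) := S \mPo [tuple F i | i < m.+1].
have ex : exists k, `[< exists S, [/\ S != 0, P (c S) & msize S = k] >].
  have [S S0 PS] := alg_dependent F hP hT (le : (#|T| < m.+1)%N).
  by exists (msize S); apply/asboolP; exists S.
case: (ex_minnP ex) => k /asboolP [S [S0 PS sS]] kmin.
pose S0' := \sum_(mm <- msupp S | mm ord_max == 0%N) S@_mm *: 'X_[mm].
pose S1 := \sum_(mm <- msupp S | mm ord_max != 0%N) S@_mm *: 'X_[(mm - U_(ord_max))%MM].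
have SE : S = S0' + 'X_ord_max * S1.
  rewrite [LHS]mpolyE (bigID (fun mm : 'X_{1..m.+1} => mm ord_max == 0%N)) /=; congr (_ + _).
  rewrite mulr_sumr; apply: eq_bigr => mm nz; rewrite -scalerAr -mpolyXD; congr (_ *: 'X_[_]).
  by rewrite addmC submK // lep1mP.
have cX : c 'X_ord_max = F ord_max.
  rewrite /c comp_mpolyX (bigD1 ord_max) //= mnm1E eqxx expr1 tnth_mktuple big1 ?mulr1 //.
  by move=> i io; rewrite mnm1E eq_sym (negbTE io) expr0.
exists S0'; split.
- apply/eqP => z; rewrite z add0r in SE.
  have S10 : S1 != 0 by apply/eqP => z1; move: S0; rewrite SE z1 mulr0 eqxx.
  have PS1 : P (c S1).
    move: PS; rewrite SE /c rmorphM /= -/(c _) -/(c _) cX.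
    by case: hP => _ [_ h] /h [].
  have := kmin (msize S1) (introT (asboolP _) (ex_intro _ S1 (And3 S10 PS1 erefl))).
  rewrite -sS SE msizeM // ?msizeX ?mdeg1; last by rewrite -msize_poly_eq0 msizeX.
  by rewrite add2n /= ltnn.
- apply: vars_in_sum => mm /eqP h; apply: vars_inZ; apply: vars_inXm => i.
  by rewrite !inE negbK => /eqP ->.
- exists (- c S1); rewrite mulrN opprK -cX.
  by move: PS; rewrite {1}SE /c rmorphD rmorphM.
Qed.

(** Apply [relation_mod_elt] to the variables of [T'] and to [q]. As [q] is in [Q], the resulting
    relation is a nonzero polynomial of [Q] in the variables [T'] alone. *)
Lemma dim_decreases P Q T T' q : prime_ideal P -> prime_ideal Q -> (forall p, P p -> Q p) ->
  Q q -> ~ P q -> max_indep P T -> indep Q T' -> (#|T'| < #|T|)%N.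
Proof.
move=> hP hQ PQ Qq nq hT iT'; rewrite ltnNge; apply/negP => le.
pose F (i : 'I_#|T'|.+1) : A := if unlift ord_max i is Some j then 'X_(enum_val j) else q.
have Fq : F ord_max = q by rewrite /F unlift_none.
have nF : ~ P (F ord_max) by rewrite Fq.
have [S [S0 vS [g Pg]]] := relation_mod_elt hP hT le nF.
have /eqP[] : S \mPo [tuple F i | i < #|T'|.+1] != 0.
  apply: (comp_mpoly_neq0 vS S0) => y.
  have [v hv] := eval_enum_surj (fun j : 'I_#|T'| => y (lift ord_max j)).
  exists v => i; rewrite !inE eq_sym /F => /unlift_some [j -> ->].
  by rewrite mevalXU.
apply: iT'; last first.
  rewrite -(subrK (F ord_max * g) (_ \mPo _)); apply: idealD; [by case: hQ|exact: PQ|].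
  by apply: idealMr; [case: hQ|rewrite Fq].
apply: (comp_mpoly_vars_in vS) => i; rewrite !inE eq_sym /F => /unlift_some [j _ ->].
by apply: vars_inX; apply: enum_valP.
Qed.

Lemma krull_dim_prime P T : prime_ideal P -> max_indep P T -> is_krull_dim P #|T|.
Proof.
move=> hP hT; split.
  by have [ch [h _]] := prime_chain_of_indep hP (proj1 hT); exists ch.
move=> m ch [c1 c2].
have key i : (i <= m)%N -> exists2 T', max_indep (ch i) T' & (#|T'| + i <= #|T|)%N.
  elim: i => [|i IH] hi.
    have [p0 s0] := c1 0%N hi; have [T' _ hT'] := indep_max (indep_set0 p0).
    exists T' => //; rewrite addn0; apply: (indep_card hP hT).
    exact: indep_sub (proj1 hT').
  have [Ti hTi le] := IH (ltnW hi).
  have [pi _] := c1 i (ltnW hi); have [pi1 _] := c1 i.+1 hi.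
  have [sub ne] := c2 i hi.
  have [T' _ hT'] := indep_max (indep_set0 pi1).
  have [q Qq nq] : exists2 q, ch i.+1 q & ~ ch i q.
    apply: contrapT => no; apply: ne; apply/funext => p; apply/propext; split; first exact: sub.
    by move=> Qp; apply: contrapT => np; apply: no; exists p.
  exists T' => //; have := dim_decreases pi pi1 sub Qq nq hTi (proj1 hT'); lia.
have [T' _ le] := key m (leqnn m).
by apply: leq_trans le; apply: leq_addl.
Qed.

Lemma krull_dim_unique P d d' : is_krull_dim P d -> is_krull_dim P d' -> d = d'.
Proof.
by move=> [[c h] m] [[c' h'] m']; apply/eqP; rewrite eqn_leq (m _ _ h') (m' _ _ h).
Qed.

(** The interface to the later parts: the independent set [T] disappears and only its size [e]
    remains. *)
Lemma prime_dimension (gs : seq A) : prime_ideal (ideal_gen gs) ->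
  let P := ideal_gen gs in
  exists e, [/\ (e <= n)%N /\ is_krull_dim P e,
    forall m (F : 'I_m -> A), (e < m)%N ->
      exists2 Q : {mpoly R[m]}, Q != 0 & P (Q \mPo [tuple F i | i < m]),
    forall F : 'I_e.+1 -> A, ~ P (F ord_max) ->
      exists S : {mpoly R[e.+1]}, [/\ S != 0, vars_in [set~ ord_max] S &
        exists g, P (S \mPo [tuple F i | i < e.+1] - F ord_max * g)],
    forall k (f : 'I_k -> A) (g : 'I_k -> 'I_n), (n - e < k)%N -> (forall i, P (f i)) ->
      P (\det (\matrix_(i, j) (f i)^`M(g j))) &
    exists (phi : 'I_(n - e) -> 'I_(size gs)) (g : 'I_(n - e) -> 'I_n),
      ~ P (\det (\matrix_(i, j) (gs`_(phi i))^`M(g j)))].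
Proof.
move=> hP P; have [T _ hT] := indep_max (indep_set0 hP).
have cT : #|~: T| = (n - #|T|)%N by rewrite cardsCs setCK card_ord.
exists #|T|; split.
- split; last exact: krull_dim_prime.
  by rewrite -[X in (_ <= X)%N]card_ord max_card.
- by move=> m F; apply: alg_dependent.
- by move=> F; apply: (relation_mod_elt hP hT).
- have [Gs [sGs PGs hGs]] := triangular_generators hP hT (subsetT T).
  move=> k f g lt Pf; apply: (prime_minors g hP PGs) => //.
    by move=> h; apply: hGs; apply: vars_inT.
  by rewrite sGs setTD cT.
- rewrite -cT; have [F [g [PF nF]]] := prime_nonzero_minor hP hT.
  by have [phi hphi] := ideal_gen_nonzero_minor PF nF; exists phi, g.
Qed.

End Dimension.
End AlgPart.

(** * Ranks, gradients and values of polynomials *)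

Module EvalPart.
Import perm boolp reals mpoly AlgPart.
Local Open Scope ring_scope.

Section Minors.
Variable F : fieldType.

Lemma minor_rank m n (M : 'M[F]_(m, n)) k (phi : 'I_k -> 'I_m) (g : 'I_k -> 'I_n) :
  \det (mxsub phi g M) != 0 -> (k <= \rank M)%N.
Proof.
move=> d0; have u : mxsub phi g M \in unitmx by rewrite unitmxE unitfE.
rewrite -{1}(mxrank_unit u) mxsubrc.
apply: leq_trans (mxrankS (rowsub_sub _ _)) _.
rewrite -mxrank_tr trmx_mxsub -(mxrank_tr M); exact: mxrankS (rowsub_sub _ _).
Qed.

Lemma rank_minor m n (M : 'M[F]_(m, n)) :
  exists (phi : 'I_(\rank M) -> 'I_m) (g : 'I_(\rank M) -> 'I_n), \det (mxsub phi g M) != 0.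
Proof.
have full : row_full (rowsub (maxrankfun M) M)^T.
  by rewrite /row_full mxrank_tr; apply: maxrowsub_free.
exists (maxrankfun M), (fullrankfun full).
have := fullrowsub_unit full; rewrite -unitmx_tr unitmxE unitfE.
by congr (\det _ != 0); apply/matrixP => i j; rewrite !mxE.
Qed.

End Minors.

Section Eval.
Variables (R : realType) (n : nat).
Local Notation A := {mpoly R[n]}.

Lemma meval_det k (M : 'M[A]_k) (v : 'I_n -> R) :
  (\det M).@[v] = \det (map_mx (meval v) M).
Proof. by rewrite det_map_mx. Qed.

Lemma bound_fin (I : finType) (Q : I -> R -> Prop) :
  (forall i C C', C <= C' -> Q i C -> Q i C') -> (forall i, exists2 C, 0 <= C & Q i C) ->
  exists2 C, 0 <= C & forall i, Q i C.
Proof.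
move=> mono ex; have /choice [C hC] : forall i, exists C, 0 <= C /\ Q i C.
  by move=> i; have [C h1 h2] := ex i; exists C.
exists (\sum_i C i); first by apply: sumr_ge0 => i _; case: (hC i).
move=> i; have [_ h] := hC i; apply: mono h.
by rewrite (bigD1 i) //= lerDl; apply: sumr_ge0 => k _; case: (hC k).
Qed.

(** A nonzero [S] is nonzero at some point [y] of the cube. By the Lipschitz bound it stays nonzero
    at values of [G] close enough to [y]. Closeness is asked only for the variables [U] that occur
    in [S]. *)
Lemma dense_values_no_relation k (U : {set 'I_k}) (S : {mpoly R[k]}) (Z : Type)
    (M : Z -> Prop) (G : 'I_k -> Z -> R) (c : 'I_k -> R) (s : R) :
  vars_in U S -> 0 < s ->
  (forall y, (forall i, `|y i - c i| <= s) -> forall d, 0 < d ->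
    exists2 z, M z & forall i, i \in U -> `|G i z - y i| <= d) ->
  (forall z, M z -> S.@[fun i => G i z] = 0) -> S = 0.
Proof.
move=> vS s0 dense van; apply/eqP; apply: contrapT => /negP S0.
have [y hy Sy] := meval_neq0 c S0 s0.
have [C C0 hC] := meval_lipschitz S (\sum_i `|y i|).
have hy1 j : `|y j| <= \sum_i `|y i|.
  by rewrite (bigD1 j) //= lerDl; apply: sumr_ge0.
pose a := `|S.@[y]|; have a0 : 0 < a by rewrite normr_gt0.
pose d := Num.min 1 (a / (2 * (C + 1))).
have C1 : 0 < 2 * (C + 1) by rewrite mulr_gt0 // ltr_wpDl.
have d0 : 0 < d by rewrite lt_min ltr01 divr_gt0.
have [z Mz hz] := dense y hy d d0.
pose h i := if i \in U then G i z - y i else 0.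
have hh i : `|h i| <= d by rewrite /h; case: ifP => [/hz //|_]; rewrite normr0 ltW.
have := hC y h d hy1 hh; rewrite (ltW d0) /= {1}/d ge_min lexx => /(_ isT).
have -> : S.@[fun i => y i + h i] = 0.
  rewrite -(van z Mz); apply: (meval_vars_in vS) => i iU.
  by rewrite /h iU addrC subrK.
rewrite sub0r normrN -/a => le.
have : d <= a / (2 * (C + 1)) by rewrite ge_min lexx orbT.
rewrite ler_pdivlMr // => le2.
have : C * d <= d * (C + 1) by nra.
nra.
Qed.

(** Cramer numerators for writing the gradient of [h], in the columns [g], as a combination of the
    gradients of [f]. *)
Definition cotangent_coef r (f : 'I_r -> A) (g : 'I_r -> 'I_n) (h : A) (i : 'I_r) : A :=
  \sum_j h^`M(g j) * (\adj (\matrix_(i, j) (f i)^`M(g j))) j i.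

(* The left-hand side is, up to a power of the nonzero minor, the [(r+1)]-minor obtained by
   bordering with the gradient of [h] and the column [k]. *)
Lemma cotangent_relation (P : A -> Prop) r (f : 'I_r -> A) (g : 'I_r -> 'I_n) :
  prime_ideal P -> (forall i, P (f i)) ->
  (forall (f : 'I_(r + 1) -> A) (g : 'I_(r + 1) -> 'I_n), (forall i, P (f i)) ->
     P (\det (\matrix_(i, j) (f i)^`M(g j)))) ->
  ~ P (\det (\matrix_(i, j) (f i)^`M(g j))) ->
  forall h, P h -> forall k,
    P (\det (\matrix_(i, j) (f i)^`M(g j)) * h^`M(k)
       - \sum_i cotangent_coef f g h i * (f i)^`M(k)).
Proof.
move=> hP Pf minors nd h Ph k; have hI := prime_is_ideal hP.
set B := \matrix_(i, j) _; set dl := \det B.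
pose b : 'cV[A]_r := \col_i (f i)^`M(k).
pose u : 'rV[A]_r := \row_j h^`M(g j).
pose v : 'M[A]_1 := (h^`M(k))%:M.
pose f' (i : 'I_(r + 1)) := match split i with inl i => f i | inr _ => h end.
pose g' (j : 'I_(r + 1)) := match split j with inl j => g j | inr _ => k end.
have Pf' i : P (f' i) by rewrite /f'; case: split.
have := minors f' g' Pf'.
have -> : \matrix_(i, j) (f' i)^`M(g' j) = block_mx B b u v.
  apply/matrixP => i j; rewrite !mxE /f' /g'.
  by case: (split i) => i'; rewrite mxE; case: (split j) => j'; rewrite !mxE ?ord1 ?eqxx ?mulr1n.
set M := block_mx _ _ _ _ => PM.
(* [N] makes [M *m N] block triangular, with [dl] on the diagonal of the first block and the Schur
   complement times [dl] as the last entry; that entry is the element wanted. *)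
pose N := block_mx (\adj B) (- (\adj B *m b)) (0 : 'M_(1, r)) (dl%:M : 'M_1).
have MN : M *m N = block_mx dl%:M 0 (u *m \adj B) (dl *: v - u *m \adj B *m b).
  rewrite /M /N mulmx_block !mulmx0 !addr0 mul_mx_adj !mulmxN mulmxA mul_mx_adj -/dl.
  rewrite mul_scalar_mx !mul_mx_scalar addNr mulmxA; congr block_mx.
  by rewrite addrC.
have : P (\det (M *m N)) by rewrite det_mulmx; apply: idealMr.
rewrite MN det_lblock det_scalar det_mx11.
have -> : (dl *: v - u *m \adj B *m b) 0 0 =
    dl * h^`M(k) - \sum_i cotangent_coef f g h i * (f i)^`M(k).
  transitivity (dl * v 0 0 - (u *m \adj B *m b) 0 0).
    by set Z := u *m _ *m b; set Y := v; rewrite [LHS]mxE [X in X + _]mxE [X in _ + X]mxE.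
  congr (_ - _); first by rewrite /v mxE eqxx mulr1n.
  rewrite mxE; apply: eq_bigr => i _; rewrite [b _ _]mxE; congr (_ * _).
  by rewrite mxE; apply: eq_bigr => j _; rewrite [u _ _]mxE.
by case: (hP) => _ [_ hM] /hM [] // /(primeX hP nd).
Qed.

(** A discrete Gronwall inequality. Both ends of a step satisfy [f = 0], so [grad f] along it is of
    order [eta ^+ 2]. Dividing the relation by [dl] then bounds the total size of the [h l] after
    the step by [1 + a * eta] times its old value plus [b * eta ^+ 2]. *)
Lemma euler_bound s r (h : 'I_s -> A) (f : 'I_r -> A) (dl : A) (mu : 'I_s -> 'I_r -> A)
    (c : 'I_s -> 'I_n -> 'I_s -> A) (rho d0 : R) : 0 < d0 ->
  (forall l k, dl * (h l)^`M(k) = \sum_i mu l i * (f i)^`M(k) + \sum_m c l k m * h m) ->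
  exists a b, [/\ 0 <= a, 0 <= b & forall (z : nat -> 'I_n -> R) (eta : R) N,
    0 <= eta <= 1 ->
    (forall t, (t <= N)%N -> [/\ forall i, `|z t i| <= rho, d0 <= `|dl.@[z t]| &
                              forall i, (f i).@[z t] = 0]) ->
    (forall t, (t < N)%N -> forall i, `|z t.+1 i - z t i| <= eta) ->
    (forall l, (h l).@[z 0%N] = 0) ->
    forall l, `|(h l).@[z N]| <= b * eta ^+ 2 * N%:R * (1 + a * eta) ^+ N].
Proof.
move=> d00 rel.
pose taylor (p : A) (C : R) := forall (v h : 'I_n -> R) (e : R), (forall i, `|v i| <= rho) ->
    (forall i, `|h i| <= e) -> 0 <= e <= 1 ->
    `|p.@[fun i => v i + h i] - p.@[v] - \sum_i h i * (p^`M(i)).@[v]| <= C * e ^+ 2.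
pose bnd (p : A) (C : R) := forall v : 'I_n -> R, (forall i, `|v i| <= rho) -> `|p.@[v]| <= C.
have tmono p C C' : C <= C' -> taylor p C -> taylor p C'.
  move=> le t v w e hv hw he; apply: le_trans (t v w e hv hw he) _.
  by rewrite ler_wpM2r // sqr_ge0.
have bmono p C C' : C <= C' -> bnd p C -> bnd p C'.
  by move=> le t v hv; apply: le_trans (t v hv) _.
have [Ch Ch0 hCh] := @bound_fin _ (fun l => taylor (h l)) (fun l => @tmono (h l))
  (fun l => meval_taylor (h l) rho).
have [Cf Cf0 hCf] := @bound_fin _ (fun l => taylor (f l)) (fun l => @tmono (f l))
  (fun l => meval_taylor (f l) rho).
have [Bm Bm0 hBm] := @bound_fin ('I_s * 'I_r)%type (fun x => bnd (mu x.1 x.2)) (fun x => @bmono _)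
  (fun x => meval_bounded (mu x.1 x.2) rho).
have [Bc Bc0 hBc] := @bound_fin ('I_s * 'I_n * 'I_s)%type (fun x => bnd (c x.1.1 x.1.2 x.2))
  (fun x => @bmono _) (fun x => meval_bounded (c x.1.1 x.1.2 x.2) rho).
have d0i : 0 <= d0^-1 by rewrite invr_ge0 ltW.
(* [a] collects the terms containing the [h m], and [b] the second-order errors of [f] and of [h];
   the factor [s] comes from summing over all [h l]. *)
exists (s%:R * (d0^-1 * (n%:R * Bc))), (s%:R * (d0^-1 * (r%:R * Bm * Cf) + Ch)).
set a := s%:R * _; set b := s%:R * _.
have a0 : 0 <= a by rewrite !mulr_ge0.
have b0 : 0 <= b by rewrite mulr_ge0 // addr_ge0 // !mulr_ge0.
split=> // z eta N eta01 hz hstep h0.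
have eta0 : 0 <= eta by case/andP: eta01.
pose u t : R := \sum_l `|(h l).@[z t]|.
have u0 t : 0 <= u t by apply: sumr_ge0.
have step t : (t < N)%N -> u t.+1 <= (1 + a * eta) * u t + b * eta ^+ 2.
  move=> tN; have [zt dt ft] := hz t (ltnW tN); have [_ _ ft1] := hz t.+1 tN.
  pose D i := z t.+1 i - z t i.
  have hD i : `|D i| <= eta by apply: hstep.
  have zE p : p.@[fun i => z t i + D i] = p.@[z t.+1].
    by apply: meval_eq => i; rewrite /D addrC subrK.
  have gf i : `|\sum_k D k * ((f i)^`M(k)).@[z t]| <= Cf * eta ^+ 2.
    have := hCf i (z t) D eta zt hD eta01; rewrite zE ft ft1 subrr sub0r normrN; exact.
  have gh l : `|(h l).@[z t.+1]| <=
      `|(h l).@[z t]| + (d0^-1 * (r%:R * Bm * Cf * eta ^+ 2 + n%:R * Bc * eta * u t) + Ch * eta ^+ 2).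
    have := hCh l (z t) D eta zt hD eta01; rewrite zE.
    set g := \sum_k _ => tl.
    have hg : `|g| <= d0^-1 * (r%:R * Bm * Cf * eta ^+ 2 + n%:R * Bc * eta * u t).
      rewrite ler_pdivlMl //; apply: (@le_trans _ _ `|dl.@[z t] * g|).
        by rewrite normrM ler_wpM2r.
      have -> : dl.@[z t] * g = \sum_i (mu l i).@[z t] * (\sum_k D k * ((f i)^`M(k)).@[z t])
          + \sum_k D k * (\sum_m (c l k m).@[z t] * (h m).@[z t]).
        rewrite /g mulr_sumr.
        transitivity (\sum_k (D k * (\sum_i (mu l i).@[z t] * ((f i)^`M(k)).@[z t])
            + D k * (\sum_m (c l k m).@[z t] * (h m).@[z t]))).
          apply: eq_bigr => k _; rewrite mulrCA -mulrDr -mevalM rel mevalD !raddf_sum /=.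
          by congr (_ * (_ + _)); apply: eq_bigr => i _; rewrite mevalM.
        rewrite big_split /=; congr (_ + _).
        under eq_bigr do rewrite mulr_sumr.
        rewrite exchange_big /=; apply: eq_bigr => i _; rewrite mulr_sumr.
        by apply: eq_bigr => k _; rewrite mulrCA.
      apply: le_trans (ler_normD _ _) _; apply: lerD.
        have -> : r%:R * Bm * Cf * eta ^+ 2 = r%:R * (Cf * eta ^+ 2) * Bm by ring.
        by apply: norm_lincomb_le => // i; apply: (hBm (l, i)).
      have -> : n%:R * Bc * eta * u t = n%:R * (Bc * u t) * eta by ring.
      apply: norm_lincomb_le => // k; rewrite /u mulr_sumr.
      apply: le_trans (ler_norm_sum _ _ _) _; apply: ler_sum => m _.
      by rewrite normrM ler_wpM2r // (hBc (l, k, m)).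
    have -> : (h l).@[z t.+1] = (h l).@[z t] + (g + ((h l).@[z t.+1] - (h l).@[z t] - g)) by ring.
    apply: le_trans (ler_normD _ _) _; rewrite lerD2l.
    by apply: le_trans (ler_normD _ _) _; rewrite lerD.
  apply: le_trans (ler_sum _ (fun l _ => gh l)) _.
  rewrite big_split /= -/(u t) sumr_const card_ord -mulr_natl.
  by rewrite le_eqVlt; apply/orP; left; apply/eqP; rewrite /a /b; ring.
have main t : (t <= N)%N -> u t <= b * eta ^+ 2 * t%:R * (1 + a * eta) ^+ t.
  elim: t => [|t IH] tN.
    by rewrite mulr0 mul0r /u big1 // => l _; rewrite h0 normr0.
  apply: le_trans (step t tN) _.
  have q1 : 1 <= 1 + a * eta by rewrite lerDl mulr_ge0.
  have q0 : 0 <= 1 + a * eta by apply: le_trans q1.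
  have be0 : 0 <= b * eta ^+ 2 by rewrite mulr_ge0 // sqr_ge0.
  apply: (@le_trans _ _ ((1 + a * eta) * (b * eta ^+ 2 * t%:R * (1 + a * eta) ^+ t)
      + b * eta ^+ 2 * (1 + a * eta) ^+ t.+1)).
    rewrite lerD //; first by rewrite ler_wpM2l // IH // ltnW.
    by rewrite ler_peMr // exprn_ege1.
  by rewrite le_eqVlt; apply/orP; left; apply/eqP; rewrite (exprS _ t) -(natr1 t); ring.
move=> l; apply: le_trans (main N (leqnn N)).
by rewrite /u (bigD1 l) //= lerDl; apply: sumr_ge0.
Qed.

(** In the coordinates [g], with the others fixed, the Newton map whose inverse Jacobian is frozen
    at [x] contracts distances by one half near [x]. *)
Lemma newton_contraction r (f : 'I_r -> A) (g : 'I_r -> 'I_n) (x : 'I_n -> R) :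
  injective g ->
  let B : 'M[R]_r := \matrix_(i, j) ((f i)^`M(g j)).@[x] in B \in unitmx ->
  exists2 rho : R, 0 < rho & forall (z z' : 'I_n -> R) (eps : R),
    (forall i, `|z i - x i| <= rho) -> (forall i, `|z' i - x i| <= rho) ->
    (forall i, (forall j, g j != i) -> z i = z' i) ->
    0 <= eps -> (forall j, `|z (g j) - z' (g j)| <= eps) -> eps <= 2 * rho ->
    forall j, `|(z (g j) - z' (g j)) -
      \sum_i ((f i).@[z] - (f i).@[z']) * (invmx B) j i| <= eps / 2.
Proof.
move=> ginj B uB.
pose rx : R := \sum_i `|x i| + 1.
have [C1 C10 hC1] := @bound_fin _ (fun i C => forall (v h : 'I_n -> R) (e : R),
    (forall i, `|v i| <= rx) -> (forall i, `|h i| <= e) -> 0 <= e <= 1 ->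
    `|(f i).@[fun i => v i + h i] - (f i).@[v] - \sum_k h k * ((f i)^`M(k)).@[v]| <= C * e ^+ 2)
  (fun i C C' le t v h e hv hh he => le_trans (t v h e hv hh he) (ler_wpM2r (sqr_ge0 e) le))
  (fun i => meval_taylor (f i) rx).
have lmono (x0 : 'I_r * 'I_r) (C C' : R) : C <= C' ->
    (forall (v h : 'I_n -> R) (e : R),
    (forall i, `|v i| <= rx) -> (forall i, `|h i| <= e) -> 0 <= e <= 1 ->
    `|((f x0.1)^`M(g x0.2)).@[fun i => v i + h i] - ((f x0.1)^`M(g x0.2)).@[v]| <= C * e) ->
    (forall (v h : 'I_n -> R) (e : R),
    (forall i, `|v i| <= rx) -> (forall i, `|h i| <= e) -> 0 <= e <= 1 ->
    `|((f x0.1)^`M(g x0.2)).@[fun i => v i + h i] - ((f x0.1)^`M(g x0.2)).@[v]| <= C' * e).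
  move=> le t v h e hv hh he; apply: le_trans (t v h e hv hh he) _.
  by rewrite ler_wpM2r //; case/andP: he.
have [C2 C20 hC2] := @bound_fin _ _ lmono (fun x0 => meval_lipschitz ((f x0.1)^`M(g x0.2)) rx).
have [K K0 hK] : exists2 K : R, 0 <= K & forall i j, `|(invmx B) j i| <= K.
  exists (\sum_i \sum_j `|(invmx B) j i|); first by do 2 (apply: sumr_ge0 => ? _).
  move=> i j; rewrite (bigD1 i) //= (bigD1 j) //= -addrA lerDl addr_ge0 //.
    exact: sumr_ge0.
  by do 2 (apply: sumr_ge0 => ? _).
(* [r * C2] accounts for the change of the derivatives away from [x], [2 * C1] for the Taylor
   remainder with [eps <= 2 * rho], and [r * K] for applying the inverse matrix. [rho] is chosen so
   that [rho * (E + 1) = 1/2]. *)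
pose E := r%:R * K * (r%:R * C2 + 2 * C1).
have E0 : 0 <= E by rewrite !mulr_ge0 // addr_ge0 // mulr_ge0.
pose rho := 2^-1 / (E + 1).
have E1 : 0 < E + 1 by rewrite ltr_wpDl.
have rho0 : 0 < rho by rewrite divr_gt0 ?invr_gt0.
have rhoE : rho * (E + 1) = 2^-1 by rewrite /rho divfK // gt_eqF.
have rho12 : rho <= 2^-1 by rewrite -rhoE ler_peMr ?(ltW rho0) // lerDr.
exists rho => // z z' eps hz hz' agree eps0 hw eps2 j.
have hzx (w : 'I_n -> R) : (forall i, `|w i - x i| <= rho) -> forall i, `|w i| <= rx.
  move=> hwx i; rewrite -(subrK (x i) (w i)); apply: le_trans (ler_normD _ _) _.
  rewrite addrC lerD //; last by apply: le_trans (hwx i) _; lra.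
  by rewrite (bigD1 i) //= lerDl; apply: sumr_ge0.
pose D i := z i - z' i.
have Dn i : (forall j, g j != i) -> D i = 0 by move=> /agree; rewrite /D => ->; rewrite subrr.
have hD i : `|D i| <= eps.
  have [[j' /eqP e]|no] := pselect (exists j, g j == i); first by rewrite -e; apply: hw.
  rewrite Dn ?normr0 // => j'; apply/negP => e; apply: no; by exists j'.
have eps01 : 0 <= eps <= 1 by rewrite eps0 /=; lra.
pose e i := (f i).@[z] - (f i).@[z'] - \sum_k D (g k) * B i k.
have he i : `|e i| <= eps * rho * (r%:R * C2 + 2 * C1).
  have -> : e i = ((f i).@[z] - (f i).@[z'] - \sum_k D k * ((f i)^`M(k)).@[z'])
     + \sum_k D (g k) * (((f i)^`M(g k)).@[z'] - B i k).
    have -> : \sum_k D k * ((f i)^`M(k)).@[z'] = \sum_k D (g k) * ((f i)^`M(g k)).@[z'].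
      rewrite (bigID (fun k => k \in g @: setT)) /= [X in _ + X]big1 ?addr0; last first.
        move=> k nk; rewrite Dn ?mul0r // => j'; apply: contra nk => /eqP <-.
        exact: imset_f.
      rewrite big_imset /=; last by move=> ? ? _ _; apply: ginj.
      by apply: eq_bigl => k; rewrite inE.
    rewrite /e; have -> : \sum_k D (g k) * (((f i)^`M(g k)).@[z'] - B i k) =
      \sum_k D (g k) * ((f i)^`M(g k)).@[z'] - \sum_k D (g k) * B i k.
      by rewrite -sumrB; apply: eq_bigr => k _; rewrite mulrBr.
    by ring.
  apply: le_trans (ler_normD _ _) _.
  have t1 := hC1 i z' D eps (hzx _ hz') hD eps01.
  have zE : (f i).@[fun i => z' i + D i] = (f i).@[z].
    by apply: meval_eq => l; rewrite /D addrC subrK.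
  rewrite zE in t1.
  have t2 : `|\sum_k D (g k) * (((f i)^`M(g k)).@[z'] - B i k)| <= r%:R * (C2 * rho) * eps.
    apply: norm_lincomb_le => // k; rewrite mxE.
    have := hC2 (i, k) x (fun i => z' i - x i) rho; rewrite /= (ltW rho0) /=.
    have -> : ((f i)^`M(g k)).@[fun i => x i + (z' i - x i)] = ((f i)^`M(g k)).@[z'].
      by apply: meval_eq => l; rewrite addrC subrK.
    apply => //; last by lra.
    by apply: hzx => l; rewrite subrr normr0 ltW.
  have : C1 * eps ^+ 2 <= C1 * (eps * (2 * rho)).
    by rewrite ler_wpM2l // expr2 ler_wpM2l.
  move: t1 t2; set X1 := `|_|; set X2 := `|_| => t1 t2 t3.
  apply: le_trans (lerD (le_trans t1 t3) t2) _.
  by rewrite le_eqVlt; apply/orP; left; apply/eqP; ring.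
have -> : z (g j) - z' (g j) - \sum_i ((f i).@[z] - (f i).@[z']) * invmx B j i = - \sum_i e i * invmx B j i.
  have -> : \sum_i e i * invmx B j i = \sum_i ((f i).@[z] - (f i).@[z']) * invmx B j i -
      \sum_i (\sum_k D (g k) * B i k) * invmx B j i.
    by rewrite -sumrB; apply: eq_bigr => i _; rewrite mulrBl.
  have -> : \sum_i (\sum_k D (g k) * B i k) * invmx B j i = D (g j).
    under eq_bigr do rewrite mulr_suml.
    rewrite exchange_big /=.
    have iB k : \sum_i invmx B j i * B i k = (j == k)%:R.
      by have := congr1 (fun M : 'M_r => M j k) (mulVmx uB); rewrite !mxE.
    rewrite (bigD1 j) //= [X in _ + X]big1 ?addr0.
      transitivity (D (g j) * \sum_i invmx B j i * B i j).
        by rewrite mulr_sumr; apply: eq_bigr => i _; ring.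
      by rewrite iB eqxx mulr1.
    move=> k kj; transitivity (D (g k) * \sum_i invmx B j i * B i k).
      by rewrite mulr_sumr; apply: eq_bigr => i _; ring.
    by rewrite iB eq_sym (negbTE kj) mulr0.
  by rewrite opprB.
rewrite normrN; apply: le_trans (norm_lincomb_le he (fun i => hK i j)) _.
have -> : r%:R * K * (eps * rho * (r%:R * C2 + 2 * C1)) = rho * E * eps by rewrite /E; ring.
rewrite mulrC ler_wpM2l // -rhoE ler_wpM2l ?(ltW rho0) // lerDl //.
Qed.


(** The values of [F] on [M] are dense in some cube with nonempty interior: a weak form of having an
    image of full dimension, which still excludes polynomial relations. *)
Definition dense_image (M : 'rV[R]_n -> Prop) m (F : 'I_m -> A) :=
  exists2 s : R, 0 < s & exists c : 'I_m -> R, forall y, (forall i, `|y i - c i| <= s) ->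
    forall d, 0 < d -> exists2 z, M z & forall i, `|peval z (F i) - y i| <= d.

Lemma dense_image_dim_le (gs : seq A) e (M : 'rV[R]_n -> Prop) m (F : 'I_m -> A) :
  prime_ideal (ideal_gen gs) -> is_krull_dim (ideal_gen gs) e ->
  (forall z, M z -> zeroset (ideal_gen gs) z) -> dense_image M F -> (m <= e)%N.
Proof.
move=> hP he MV [s s0 [c dense]]; rewrite leqNgt; apply/negP => lt.
have [e' [[_ he'] dep _ _ _]] := prime_dimension hP.
rewrite (krull_dim_unique he he') in lt.
have [Q Q0 PQ] := dep m F lt.
move/eqP: Q0; apply.
apply: (@dense_values_no_relation _ setT Q _ M (fun i z => peval z (F i)) c s) => //.
- exact: vars_inT.
- by move=> y hy d d0; have [z Mz hz] := dense y hy d d0; exists z.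
- move=> z Mz; have := MV z Mz _ PQ; rewrite /peval comp_mpoly_meval => <-.
  by apply: meval_eq => i; rewrite tnth_mktuple.
Qed.

Lemma dense_image_vanishing (gs : seq A) e (M : 'rV[R]_n -> Prop) (F : 'I_e -> A) p :
  prime_ideal (ideal_gen gs) -> is_krull_dim (ideal_gen gs) e ->
  (forall z, M z -> zeroset (ideal_gen gs) z) -> dense_image M F ->
  (forall z, M z -> peval z p = 0) -> ideal_gen gs p.
Proof.
move=> hP he MV [s s0 [c dense]] van; apply: contrapT => np.
have [e' [[_ he'] _ rel _ _]] := prime_dimension hP.
have ee := krull_dim_unique he' he; subst e'.
pose F' (i : 'I_e.+1) : A := if unlift ord_max i is Some j then F j else p.
have Fp : F' ord_max = p by rewrite /F' unlift_none.
have [|S [S0 vS [g Pg]]] := rel F'; first by rewrite Fp.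
move/eqP: S0; apply.
(* The default [0] at [ord_max] is harmless, since [S] involves only the other variables. *)
pose c' (i : 'I_e.+1) := if unlift ord_max i is Some j then c j else 0.
apply: (@dense_values_no_relation _ [set~ ord_max] S _ M (fun i z => peval z (F' i)) c' s) => //.
- move=> y hy d d0.
  have [j|z Mz hz] := dense (fun j => y (lift ord_max j)) _ d d0.
    by have := hy (lift ord_max j); rewrite /c' liftK.
  exists z => // i; rewrite !inE eq_sym => /unlift_some [j -> _].
  by rewrite /F' liftK.
- move=> z Mz; have := MV z Mz _ Pg; rewrite /peval mevalB mevalM Fp -/(peval z p) van // mul0r subr0.
  rewrite comp_mpoly_meval => <-.
  by apply: meval_eq => i; rewrite tnth_mktuple.
Qed.

Lemma jacobian_minorE (gs : seq A) (x : 'rV[R]_n) k (phi : 'I_k -> 'I_(size gs))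
    (g : 'I_k -> 'I_n) :
  \det (mxsub phi g (\matrix_(i < size gs, j < n) peval x (mderiv j gs`_i))) =
  peval x (\det (\matrix_(i, j) (gs`_(phi i))^`M(g j))).
Proof. by rewrite /peval meval_det; congr (\det _); apply/matrixP => i j; rewrite !mxE. Qed.

Lemma jacobian_rank_le (gs : seq A) e (x : 'rV[R]_n) : prime_ideal (ideal_gen gs) ->
  is_krull_dim (ideal_gen gs) e -> zeroset (ideal_gen gs) x -> (jacobian_rank gs x <= n - e)%N.
Proof.
move=> hP he Vx; rewrite leqNgt; apply/negP => lt.
have [e' [[_ he'] _ _ minors _]] := prime_dimension hP.
rewrite (krull_dim_unique he he') in lt.
have [phi [g]] := rank_minor (\matrix_(i < size gs, j < n) peval x (mderiv j gs`_i)).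
rewrite jacobian_minorE => /eqP; apply; apply: Vx; apply: minors => // i.
by apply: ideal_gen_nth.
Qed.

Lemma jacobian_rank_ge (gs : seq A) e : prime_ideal (ideal_gen gs) ->
  is_krull_dim (ideal_gen gs) e ->
  exists2 p, ~ ideal_gen gs p & forall x, peval x p != 0 -> (n - e <= jacobian_rank gs x)%N.
Proof.
move=> hP he; have [e' [[_ he'] _ _ _ [phi [g nd]]]] := prime_dimension hP.
rewrite (krull_dim_unique he he').
exists (\det (\matrix_(i, j) (gs`_(phi i))^`M(g j))) => // x.
by rewrite -jacobian_minorE; apply: minor_rank.
Qed.

(** The [h l] are the generators: they suffice to test membership in the zero set, and they satisfy
    the linear system that [euler_bound] takes as input, with [dl] a minor that is nonzero at
    [x]. *)
Lemma nonsingular_point_data (gs : seq A) e (x : 'rV[R]_n) :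
  prime_ideal (ideal_gen gs) -> is_krull_dim (ideal_gen gs) e ->
  zeroset (ideal_gen gs) x -> jacobian_rank gs x = (n - e)%N ->
  exists (f : 'I_(n - e) -> A) (g : 'I_(n - e) -> 'I_n) (dl : A) (h : 'I_(size gs) -> A),
    [/\ injective g, forall i, ideal_gen gs (f i), peval x dl != 0,
        (\matrix_(i, j) (f i)^`M(g j).@[pt x] : 'M[R]_(n - e)) \in unitmx &
        [/\ forall l, ideal_gen gs (h l),
            forall z, (forall l, peval z (h l) = 0) -> zeroset (ideal_gen gs) z &
            exists mu c, forall l k,
              dl * (h l)^`M(k) = \sum_i mu l i * (f i)^`M(k) + \sum_m c l k m * h m]].
Proof.
move=> hP he Vx rk; have hI := prime_is_ideal hP.
have [phi [g]] := rank_minor (\matrix_(i < size gs, j < n) peval x (mderiv j gs`_i)).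
rewrite -/(jacobian_rank gs x) in phi g *.
move: phi g; rewrite rk => phi g; rewrite jacobian_minorE => nz.
pose f i := gs`_(phi i); pose dl := \det (\matrix_(i, j) (f i)^`M(g j)).
have Pf i : ideal_gen gs (f i) by apply: ideal_gen_nth.
exists f, g, dl, (fun l => gs`_l).
have nd : ~ ideal_gen gs dl by move=> /Vx e0; move: nz; rewrite -/dl e0 eqxx.
split=> //.
- move=> j1 j2 e12; apply/eqP; apply: contraT => ne; move: nz.
  rewrite -det_tr (determinant_alternate ne) ?/peval ?meval0 ?eqxx // => i.
  by rewrite !mxE e12.
- rewrite unitmxE unitfE; move: nz; rewrite /peval meval_det; congr (\det _ != 0).
  by apply/matrixP => i j; rewrite !mxE.
split=> [l|z hz p [cs [_ ->]]|]; first exact: ideal_gen_nth.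
  rewrite /peval raddf_sum big1 // => l _.
  by rewrite /= mevalM -!/(peval _ _) hz mulr0.
have [e' [[_ he'] _ _ minors _]] := prime_dimension hP.
have ee := krull_dim_unique he' he; subst e'.
have minors1 (f0 : 'I_(n - e + 1) -> A) g0 : (forall i, ideal_gen gs (f0 i)) ->
    ideal_gen gs (\det (\matrix_(i, j) (f0 i)^`M(g0 j))).
  by apply: minors; rewrite addn1.
have rel := cotangent_relation hP Pf minors1 nd.
exists (fun l => cotangent_coef f g gs`_l).
have /choice [c hc] : forall x : 'I_(size gs) * 'I_n, exists c : 'I_(size gs) -> A,
    dl * (gs`_(x.1))^`M(x.2) - \sum_i cotangent_coef f g gs`_(x.1) i * (f i)^`M(x.2) =
    \sum_(m < size gs) c m * gs`_m.
  by move=> [l k]; apply: ideal_genP; apply: rel; apply: ideal_gen_nth.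
exists (fun l k => c (l, k)) => l k.
by rewrite -(hc (l, k)) /= addrC subrK.
Qed.

(** If [p] vanishes on the zeros of [P t] in [O], then [p * q] vanishes on all zeros of [I] in [O]:
    at a zero of [I] where some [r] in [P t] is nonzero, [r * q] in [I] forces [q] to vanish. So
    [p * q] is in [P t], and [q] is not. *)
Lemma prime_component_vanishing k (P : 'I_k -> A -> Prop) (I : A -> Prop) (O : 'rV[R]_n -> Prop)
    t q :
  (forall s, prime_ideal (P s)) -> (forall p, I p <-> forall s, P s p) ->
  (forall s, s != t -> P s q) -> ~ I q ->
  (forall p, (forall x, O x -> zeroset I x -> peval x p = 0) -> I p) ->
  forall p, (forall x, zeroset (P t) x -> O x -> peval x p = 0) -> P t p.
Proof.
move=> hP IP Pq nq van p hp.
have Iq r : P t r -> I (r * q).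
  move=> Pr; apply/IP => s; have [hI _] := hP s.
  have [->|ne] := eqVneq s t; last by apply: idealMl => //; apply: Pq.
  by have [hIt _] := hP t; apply: idealMr.
have /IP /(_ t) : I (p * q).
  apply: van => x Ox Ix; rewrite /peval mevalM -!/(peval _ _).
  have [Vt|/existsNP [r /not_implyP [Pr /eqP nr]]] := pselect (zeroset (P t) x).
    by rewrite hp // mul0r.
  have /eqP := Ix _ (Iq r Pr); rewrite /peval mevalM -!/(peval _ _) mulf_eq0 (negbTE nr) /=.
  by move=> /eqP ->; rewrite mulr0.
have [_ [_ hM]] := hP t; move=> /hM [] // Ptq; case: nq; apply/IP => s.
by have [->|/Pq] := eqVneq s t.
Qed.

End Eval.
End EvalPart.

(** * A combinatorial Poincare-Miranda theorem *)

Module GridPart.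
Local Open Scope ring_scope.

Section Grid.
Local Notation pt := (nat -> nat).
Local Notation K := 'F_2.

Lemma map_mem_split (T : eqType) (U : Type) (f : T -> U) (J : seq T) i : i \in J ->
  exists l1 l2, [seq f j | j <- J] = l1 ++ f i :: l2.
Proof.
by case/splitPr => J1 J2; exists [seq f j | j <- J1], [seq f j | j <- J2]; rewrite map_cat.
Qed.

Lemma addxx (x : K) : x + x = 0.
Proof. by apply/eqP; case: x => [[|[|[]]]]. Qed.

Definition inc (z : pt) (i : nat) : pt := fun k => if k == i then (z k).+1 else z k.
Definition upd (z : pt) (i t : nat) : pt := fun k => if k == i then t else z k.
Definition del (J : seq nat) (i : nat) := [seq k <- J | k != i].

Lemma incC z i j : inc (inc z i) j = inc (inc z j) i.
Proof. by apply/boolp.funext => k; rewrite /inc; case: (k == i); case: (k == j). Qed.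

Lemma updC z i j t u : i != j -> upd (upd z i t) j u = upd (upd z j u) i t.
Proof.
move=> ij; apply/boolp.funext => k; rewrite /upd.
by case: (eqVneq k i) => [->|//]; rewrite (negbTE ij).
Qed.

Lemma inc_upd z i t : inc (upd z i t) i = upd z i t.+1.
Proof. by apply/boolp.funext => k; rewrite /inc /upd; case: eqP. Qed.

Lemma delC J i j : del (del J i) j = del (del J j) i.
Proof. by rewrite /del -!filter_predI; apply: eq_filter => k; rewrite /= andbC. Qed.

Lemma del_uniq J i : uniq J -> uniq (del J i).
Proof. exact: filter_uniq. Qed.

Lemma big_del J i (F : nat -> K) : \sum_(j <- del J i) F j = \sum_(j <- J | j != i) F j.
Proof. by rewrite big_filter. Qed.

Lemma del_id J i : i \notin J -> del J i = J.
Proof. by move=> h; apply/all_filterP/allP => k kJ; apply: contraNneq h => <-. Qed.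

(** Ordered pairs cancel against their transposes in characteristic two. *)
Lemma sum_sym0 (G : nat -> nat -> K) J : uniq J -> (forall i j, G i j = G j i) ->
  \sum_(i <- J) \sum_(j <- del J i) G i j = 0.
Proof.
move=> uJ sym; elim: J uJ => [|k J IH] /=; first by rewrite big_nil.
move=> /andP [kJ uJ]; rewrite big_cons /= eqxx -/(del J k) (del_id kJ).
have -> : \sum_(i <- J) \sum_(j <- del (k :: J) i) G i j =
    \sum_(i <- J) (G i k + \sum_(j <- del J i) G i j).
  apply: eq_big_seq => i iJ; rewrite /del /=.
  have -> : k != i by apply: contraNneq kJ => ->.
  by rewrite big_cons.
rewrite big_split /= IH // addr0 -big_split /= big1 // => i _.
by rewrite sym addxx.
Qed.

(* The cup product of the coboundaries of the functions in [l], evaluated on the cube based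
   at [z] with edge directions [J]. *)
Fixpoint cup (l : seq (pt -> K)) (J : seq nat) (z : pt) : K :=
  if l is s :: l' then \sum_(i <- J) (s (inc z i) + s z) * cup l' (del J i) (inc z i) else 1.

(** A cup product of coboundaries is a cocycle: modulo 2, its values on the front and on the back
    facets of a cube have the same sum. *)
Lemma cup_closed l J z : uniq J ->
  \sum_(i <- J) cup l (del J i) (inc z i) = \sum_(i <- J) cup l (del J i) z.
Proof.
elim: l J z => [//|s l IH] J z uJ /=.
pose G i j := cup l (del (del J i) j).
have e1 : \sum_(i <- J) \sum_(j <- del J i) (s (inc (inc z i) j) + s (inc z i)) *
      G i j (inc (inc z i) j) =
    \sum_(i <- J) \sum_(j <- del J i) s (inc z i) * G i j (inc z i).
  have -> : \sum_(i <- J) \sum_(j <- del J i) (s (inc (inc z i) j) + s (inc z i)) *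
      G i j (inc (inc z i) j) =
      \sum_(i <- J) \sum_(j <- del J i) s (inc (inc z i) j) * G i j (inc (inc z i) j) +
      \sum_(i <- J) \sum_(j <- del J i) s (inc z i) * G i j (inc (inc z i) j).
    rewrite -big_split /=; apply: eq_bigr => i _; rewrite -big_split /=.
    by apply: eq_bigr => j _; rewrite mulrDl.
  rewrite sum_sym0 //; last by move=> i j; rewrite incC /G delC.
  rewrite add0r; apply: eq_bigr => i _; rewrite -!mulr_sumr; congr (_ * _).
  by apply: IH; apply: del_uniq.
rewrite e1.
have -> : \sum_(i <- J) \sum_(j <- del J i) (s (inc z j) + s z) * cup l (del (del J i) j) (inc z j) =
    \sum_(i <- J) \sum_(j <- del J i) s (inc z j) * G i j (inc z j) +
    \sum_(i <- J) \sum_(j <- del J i) s z * G i j (inc z j).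
  rewrite -big_split /=; apply: eq_bigr => i _; rewrite -big_split /=.
  by apply: eq_bigr => j _; rewrite mulrDl.
have -> : \sum_(i <- J) \sum_(j <- del J i) s z * G i j (inc z j) = 0.
  have z0 : \sum_(i <- J) \sum_(j <- del J i) G i j z = 0.
    by apply: sum_sym0 => // i j; rewrite /G delC.
  rewrite -[RHS](mulr0 (s z)) -[X in s z * X]z0 mulr_sumr; apply: eq_bigr => i _; rewrite -mulr_sumr; congr (_ * _).
  by apply: IH; apply: del_uniq.
rewrite addr0.
transitivity (\sum_(i <- J) \sum_(j <- J | j != i) s (inc z i) * G i j (inc z i)).
  by apply: eq_bigr => i _; rewrite big_del.
transitivity (\sum_(i <- J) \sum_(j <- J | j != i) s (inc z j) * G i j (inc z j)); last first.
  by apply: eq_bigr => i _; rewrite big_del.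
rewrite (exchange_big_dep xpredT) //=; apply: eq_bigr => j _.
apply: eq_big => [i|i _]; first by rewrite eq_sym.
by rewrite /G delC.
Qed.

(** Coordinate [i] is constant on the cube, so [s] is too, and its coboundary is a zero factor. *)
Lemma cup_vanish l1 l2 J z i (s : pt -> K) c : i \notin J ->
  (forall v : pt, v i = z i -> s v = c) -> cup (l1 ++ s :: l2) J z = 0.
Proof.
elim: l1 J z => [|s1 l1 IH] J z iJ hs /=; rewrite big_seq big1 // => k kJ.
  have ki : (i == k) = false by apply: contraNF iJ => /eqP ->.
  by rewrite (hs (inc z k)) ?(hs z) ?addxx ?mul0r // /inc ki.
have ki : (i == k) = false by apply: contraNF iJ => /eqP ->.
rewrite IH ?mulr0 //; first by rewrite mem_filter negb_and iJ orbT.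
by move=> v; rewrite /inc ki; apply: hs.
Qed.

Lemma cup_cell l1 l2 J z (s : pt -> K) : cup (l1 ++ s :: l2) J z != 0 ->
  exists a b, [/\ s a != s b, forall k, (z k <= a k <= z k + (k \in J))%N &
    forall k, (z k <= b k <= z k + (k \in J))%N].
Proof.
have ex (F : nat -> K) r : \sum_(i <- r) F i != 0 -> exists2 i, i \in r & F i != 0.
  move=> h; apply/hasP; apply: contraR h => /hasPn h; rewrite big_seq big1 // => i /h.
  by rewrite negbK => /eqP.
elim: l1 J z => [|s1 l1 IH] J z /= /ex [i iJ]; rewrite mulf_eq0 negb_or => /andP [h1 h2].
  exists (inc z i), z; split => [|k|k]; last by rewrite leqnn leq_addr.
    by apply: contraNneq h1 => ->; rewrite addxx.
  by rewrite /inc; case: eqP => [->|_]; rewrite ?iJ ?addn1 ?leqnSn ?leqnn ?leq_addr.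
have [a [b [h ha hb]]] := IH _ _ h2; exists a, b; split => // k.
  have := ha k; rewrite /inc mem_filter; case: eqP => [->|_] /=; last by [].
  by rewrite iJ addn0 addn1 => /andP [h3 h4]; rewrite (ltnW h3).
have := hb k; rewrite /inc mem_filter; case: eqP => [->|_] /=; last by [].
by rewrite iJ addn0 addn1 => /andP [h3 h4]; rewrite (ltnW h3).
Qed.

(** * Summation over the cells of the grid *)

Variable N : nat.

Fixpoint boxsum (J : seq nat) (f : pt -> K) (z : pt) : K :=
  if J is i :: J' then \sum_(t < N) boxsum J' f (upd z i t) else f z.

Lemma boxsum_eq J f g z : 
  (forall w, (forall k, k \in J -> (w k < N)%N) -> (forall k, k \notin J -> w k = z k) -> f w = g w) ->
  uniq J -> boxsum J f z = boxsum J g z.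
Proof.
elim: J z => [|i J IH] z h /=; first by move=> _; apply: h.
move=> /andP [iJ uJ]; apply: eq_bigr => t _; apply: IH => // w h1 h2; apply: h => k.
  rewrite inE => /orP [/eqP ->|]; last exact: h1.
  by rewrite h2 // /upd eqxx.
by rewrite inE negb_or => /andP [ki kJ]; rewrite h2 // /upd (negbTE ki).
Qed.

Lemma boxsum_sum (I : Type) (r : seq I) J (F : I -> pt -> K) z :
  boxsum J (fun w => \sum_(i <- r) F i w) z = \sum_(i <- r) boxsum J (F i) z.
Proof.
elim: J z => [//|k J IH] z /=; rewrite exchange_big /=; apply: eq_bigr => t _.
by rewrite IH.
Qed.

Lemma boxsum_upd J f z i t : i \notin J ->
  boxsum J (fun w => f (upd w i t)) z = boxsum J f (upd z i t).
Proof.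
elim: J z => [//|k J IH] z /=; rewrite inE negb_or => /andP [ik iJ].
by apply: eq_bigr => u _; rewrite IH // updC // eq_sym.
Qed.

Lemma boxsum_inner J f z i : uniq J -> i \in J ->
  boxsum J f z = boxsum (del J i) (fun w => \sum_(t < N) f (upd w i t)) z.
Proof.
elim: J z => [//|k J IH] z /= /andP [kJ uJ]; rewrite inE /del /=.
have [->|ik /= iJ] := eqVneq i k.
  move=> _ /=; rewrite -/(del J k) (del_id kJ).
  rewrite (boxsum_sum _ _ (fun (t : 'I_N) w => f (upd w k t))); apply: eq_bigr => t _.
  by rewrite boxsum_upd.
by apply: eq_bigr => t _; rewrite -IH.
Qed.

Lemma boxsum_telescope J (H : pt -> K) z i : uniq J -> i \in J ->
  boxsum J (fun w => H (inc w i) + H w) z =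
  boxsum (del J i) (fun w => H (upd w i N) + H (upd w i 0%N)) z.
Proof.
move=> uJ iJ; rewrite (boxsum_inner _ _ uJ iJ); congr boxsum; apply/boolp.funext => w.
under eq_bigr do rewrite inc_upd.
elim: N => [|k IH]; first by rewrite big_ord0 addxx.
by rewrite big_ord_recr /= IH addrC -addrA (addrA (H (upd w i k))) addxx add0r.
Qed.

Variables (m : nat) (s : nat -> pt -> K).
Hypothesis s0 : forall i z, z i = 0%N -> s i z = 0.
Hypothesis sN : forall i z, z i = N -> s i z = 1.

(** Stokes modulo 2: [ds] times a cocycle is the coboundary of [s] times that cocycle, so the sum
    over all cells reduces to the boundary facets. The last [k] coordinates are kept, so that the
    induction removes the first one. *)
Lemma boxsum_cup k z : (k <= m)%N ->
  boxsum (iota (m - k) k) (cup [seq s i | i <- iota (m - k) k] (iota (m - k) k)) z = 1.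
Proof.
elim: k z => [//|k IH] z km.
have e : iota (m - k.+1) k.+1 = (m - k.+1)%N :: iota (m - k) k.
  by rewrite /= -subSn // subSS.
rewrite e; set i0 := (m - k.+1)%N; set J' := iota (m - k) k; set J := i0 :: J'.
have i0J' : i0 \notin J' by rewrite mem_iota /i0; lia.
have uJ : uniq J by rewrite /J /= i0J' iota_uniq.
set l' := [seq s i | i <- J'].
pose H i w := s i0 w * cup l' (del J i) w.
have -> : cup [seq s i | i <- J] J = fun w => \sum_(i <- J) (H i (inc w i) + H i w).
  apply/boolp.funext => w; rewrite [LHS]/= -/l'.
  transitivity (\sum_(i <- J) s i0 (inc w i) * cup l' (del J i) (inc w i) +
      s i0 w * \sum_(i <- J) cup l' (del J i) (inc w i)).
    by rewrite mulr_sumr -big_split /=; apply: eq_bigr => i _; rewrite mulrDl.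
  by rewrite cup_closed // mulr_sumr -big_split.
rewrite (boxsum_sum _ _ (fun i w => H i (inc w i) + H i w)).
have dJ : del J i0 = J' by rewrite /del /= eqxx /= -/(del J' i0) del_id.
(* Facets in a direction [i] other than [i0] contribute nothing: [s i] is constant there and is one
   of the factors of [l']. *)
rewrite big_cons [X in _ + X]big_seq big1 ?addr0; last first.
  move=> i iJ'.
  have ii0 : i != i0 by apply: contraNneq i0J' => <-.
  have iJ : i \in J by rewrite inE iJ' orbT.
  rewrite boxsum_telescope //.
  transitivity (boxsum (del J i) (fun=> 0) z); last first.
    elim: (del J i) z => [//|j L IHL] y /=; by rewrite big1.
  apply: boxsum_eq; last exact: del_uniq.
  move=> w _ _; rewrite /H.
  have [l1 [l2 el]] : exists l1 l2, l' = l1 ++ s i :: l2.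
    exact: map_mem_split.
  have nJ : i \notin del J i by rewrite mem_filter eqxx.
  rewrite el (@cup_vanish _ _ _ _ i _ 1) ?(@cup_vanish _ _ _ _ i _ 0) ?mulr0 ?addr0 //.
    by move=> v; rewrite /upd eqxx => /s0.
  by move=> v; rewrite /upd eqxx => /sN.
(* In direction [i0] the facet [0] has [s i0 = 0], and the facet [N] has [s i0 = 1] and gives the
   sum of one dimension less. *)
rewrite boxsum_telescope ?inE ?eqxx // dJ.
transitivity (boxsum J' (fun w => cup l' J' (upd w i0 N)) z).
  congr boxsum; apply/boolp.funext => w; rewrite /H dJ.
  by rewrite sN ?s0 ?mul1r ?mul0r ?addr0 // /upd eqxx.
by rewrite (boxsum_upd (cup l' J')) // IH // ltnW.
Qed.

Lemma grid_miranda_F2 : exists2 w : pt, (forall k, (k < m)%N -> (w k < N)%N) &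
  forall i, (i < m)%N -> exists a b, [/\ s i a != s i b,
    forall k, (w k <= a k <= (w k).+1)%N & forall k, (w k <= b k <= (w k).+1)%N].
Proof.
have h := boxsum_cup (fun=> 0%N) (leqnn m); rewrite subnn in h.
set J := iota 0 m in h; set l := [seq s i | i <- J] in h.
have uJ : uniq J by apply: iota_uniq.
have [w wJ cw] : exists2 w, (forall k, k \in J -> (w k < N)%N) & cup l J w != 0.
  apply: boolp.contrapT => no; move: h; rewrite (@boxsum_eq _ _ (fun=> 0)) //.
    have -> : boxsum J (fun=> 0) (fun=> 0%N) = 0.
      elim: (J) (fun=> 0%N) => [//|j L IHL] y /=; by rewrite big1.
    by move/eqP; rewrite eq_sym oner_eq0.
  move=> w hw _; apply/eqP; apply: boolp.contrapT => /negP nz; apply: no; by exists w.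
exists w => [k km|i im]; first by apply: wJ; rewrite mem_iota.
have iJ : i \in J by rewrite mem_iota.
have [l1 [l2 el]] : exists l1 l2, l = l1 ++ s i :: l2.
  exact: map_mem_split.
rewrite el in cw; have [a [b [h1 h2 h3]]] := cup_cell cw.
exists a, b; split=> // k.
  by have /andP [-> h4] := h2 k; apply: leq_trans h4 _; rewrite -addn1 leq_add2l leq_b1.
by have /andP [-> h4] := h3 k; apply: leq_trans h4 _; rewrite -addn1 leq_add2l leq_b1.
Qed.

End Grid.

Lemma grid_miranda N m (s : nat -> (nat -> nat) -> bool) :
  (forall i z, z i = 0%N -> s i z = false) -> (forall i z, z i = N -> s i z) ->
  exists2 w : nat -> nat, (forall k, (k < m)%N -> (w k < N)%N) &
  forall i, (i < m)%N -> exists a b, [/\ s i a, ~~ s i b,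
    forall k, (w k <= a k <= (w k).+1)%N & forall k, (w k <= b k <= (w k).+1)%N].
Proof.
move=> s0 sN.
have [i z /s0 -> //|i z /sN -> //|w hw h] :=
  @grid_miranda_F2 N m (fun i z => (s i z)%:R).
exists w => // i /h [a [b [ne ha hb]]].
case sa : (s i a); case sb : (s i b); move: ne; rewrite sa sb ?eqxx // => _.
  by exists a, b; rewrite sb.
by exists b, a; rewrite sa.
Qed.

End GridPart.

(** * Polynomial approximation on cubes *)

Module ApproxPart.
Import perm boolp reals mpoly AlgPart EvalPart GridPart.
Local Open Scope ring_scope.

(** * Grids in a cube and approximate surjectivity *)

Section Cube.
Variable R : realType.

Lemma geometric_small (q a e : R) : 0 <= q < 1 -> 0 <= a -> 0 < e -> exists N, a * q ^+ N <= e.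
Proof.
move=> /andP [q0 q1] a0 e0; have [->|qn] := eqVneq q 0.
  by exists 1%N; rewrite expr1 mulr0 ltW.
have qp : 0 < q by rewrite lt_def qn.
pose x := q^-1 - 1; have x0 : 0 < x by rewrite subr_gt0 invf_gt1.
pose N := Num.bound (a / (e * x)); exists N.
have hN : a / (e * x) < N%:R by apply: archi_boundP; rewrite divr_ge0 // mulr_ge0 // ltW.
have bern k : 1 + k%:R * x <= (q^-1) ^+ k.
  have -> : q^-1 = 1 + x by rewrite /x addrC subrK.
  elim: k => [|k IH]; first by rewrite mul0r addr0 expr0.
  have k0 : 0 <= (k%:R : R) by [].
  rewrite exprS -natr1; apply: (@le_trans _ _ ((1 + x) * (1 + k%:R * x))).
    have : 0 <= k%:R * x * x by rewrite !mulr_ge0 // ltW.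
    by nra.
  by rewrite ler_wpM2l //; lra.
have qN : 0 < q ^+ N by rewrite exprn_gt0.
have : a <= e * (q^-1) ^+ N.
  apply: (@le_trans _ _ (e * (N%:R * x))); last first.
    by rewrite ler_pM2l // (le_trans _ (bern N)) // lerDr.
  by rewrite mulrCA ltW // -ltr_pdivrMr // mulr_gt0.
by rewrite exprVn -ler_pdivlMr ?invr_gt0 // invrK.
Qed.

Definition cube m (c : 'I_m -> R) (s : R) (y : 'I_m -> R) := forall i, `|y i - c i| <= s.

(** [minn] clamps the index, so that every [z], even one outside the grid, gives a point of the
    cube. *)
Definition gridpt m (c : 'I_m -> R) (s : R) (N : nat) (z : nat -> nat) (i : 'I_m) : R :=
  c i - s + 2 * s / N%:R * (minn (z i) N)%:R.

Lemma gridpt_cube m (c : 'I_m -> R) (s : R) N z : 0 < s -> (0 < N)%N -> cube c s (gridpt c s N z).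
Proof.
move=> s0 N0 i; rewrite /gridpt ler_norml.
have N0' : 0 < N%:R :> R by rewrite ltr0n.
have h : 0 <= 2 * s / N%:R * (minn (z i) N)%:R <= 2 * s.
  apply/andP; split; first by rewrite !mulr_ge0 // ?invr_ge0 ltW.
  by rewrite mulrAC ler_pdivrMr // ler_wpM2l ?ler_nat ?geq_minr // mulr_ge0 // ltW.
by case/andP: h => h1 h2; apply/andP; split; lra.
Qed.

Lemma gridpt_close m (c : 'I_m -> R) (s : R) N z w i : 0 < s -> (0 < N)%N ->
  (forall k, (w k <= z k <= (w k).+1)%N) -> `|gridpt c s N z i - gridpt c s N w i| <= 2 * s / N%:R.
Proof.
move=> s0 N0 h; rewrite /gridpt.
have N0' : 0 < N%:R :> R by rewrite ltr0n.
have -> : c i - s + 2 * s / N%:R * (minn (z i) N)%:R - (c i - s + 2 * s / N%:R * (minn (w i) N)%:R) =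
   2 * s / N%:R * ((minn (z i) N)%:R - (minn (w i) N)%:R) by ring.
have d0 : 0 <= 2 * s / N%:R by rewrite !mulr_ge0 // ?invr_ge0 ltW.
rewrite normrM (ger0_norm d0) ler_piMr //.
have /andP [h1 h2] := h i.
have le1 : (minn (w i) N <= minn (z i) N)%N by lia.
have le2 : (minn (z i) N <= (minn (w i) N).+1)%N by lia.
rewrite -natrB // ger0_norm // -[leRHS]/(1%:R) ler_nat; lia.
Qed.

Lemma mesh_exists (s eta : R) : 0 < s -> 0 < eta -> exists2 N, (0 < N)%N & 2 * s / N%:R <= eta.
Proof.
move=> s0 e0; pose N := (Num.bound (2 * s / eta)).+1; exists N => //.
have N0' : 0 < N%:R :> R by rewrite ltr0n.
have h : 2 * s / eta < N%:R.
  apply: (@lt_le_trans _ _ (Num.bound (2 * s / eta))%:R).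
    by apply: archi_boundP; rewrite !mulr_ge0 ?invr_ge0 // ltW.
  by rewrite ler_nat.
by rewrite ler_pdivrMr // ltW // (mulrC eta) -ltr_pdivrMr.
Qed.

Lemma grid_net m (c : 'I_m -> R) (s eta : R) : 0 < s -> 0 < eta ->
  exists (I : finType) (y : I -> 'I_m -> R), (forall k, cube c s (y k)) /\
    forall v, cube c s v -> exists k, forall i, `|v i - y k i| <= eta.
Proof.
move=> s0 e0; have [N N0 hN] := mesh_exists s0 e0.
have N0' : 0 < N%:R :> R by rewrite ltr0n.
pose z (k : {ffun 'I_m -> 'I_N.+1}) (j : nat) : nat :=
  if insub j is Some i then nat_of_ord (k i) else 0%N.
exists {ffun 'I_m -> 'I_N.+1}, (fun k => gridpt c s N (z k)).
split=> [k|v hv]; first exact: gridpt_cube.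
pose t i := (v i - c i + s) * N%:R / (2 * s).
have s20 : 0 < 2 * s by rewrite mulr_gt0.
have t0 i : 0 <= t i.
  have := hv i; rewrite ler_norml => /andP [h1 h2].
  by rewrite /t !mulr_ge0 ?invr_ge0 ?(ltW s20) //; lra.
have tN i : t i <= N%:R.
  have := hv i; rewrite ler_norml => /andP [h1 h2].
  rewrite /t ler_pdivrMr // mulrC ler_wpM2l ?(ltW N0') //; lra.
have tr i : (Num.truncn (t i) < N.+1)%N.
  have /andP [h1 h2] := truncn_itv (t0 i).
  by rewrite ltnS -(ler_nat R) (le_trans h1).
exists [ffun i => Ordinal (tr i)] => i; rewrite /gridpt /z /= insubT //= => hi.
have -> : Sub (sT := 'I_m) (val i) hi = i by apply: val_inj.
rewrite ffunE /=; have /andP [h1 h2] := truncn_itv (t0 i).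
have -> : minn (Num.truncn (t i)) N = Num.truncn (t i).
  by apply/minn_idPl; rewrite -ltnS.
have -> : v i - (c i - s + 2 * s / N%:R * (Num.truncn (t i))%:R) =
    2 * s / N%:R * (t i - (Num.truncn (t i))%:R).
  rewrite /t; field; by rewrite !gt_eqF.
have d0 : 0 <= 2 * s / N%:R by rewrite !mulr_ge0 // ?invr_ge0 ltW.
rewrite normrM (ger0_norm d0) (le_trans _ hN) // ler_piMr //.
rewrite ger0_norm ?subr_ge0 //; move: h2; rewrite -natr1; lra.
Qed.

(** A map moving points by at most half the radius comes arbitrarily close to each point of the
    half-size cube: some cell has, for every [i], vertices where the [i]-th coordinate lies on both
    sides of [p i]. *)
Lemma approx_miranda m (c : 'I_m -> R) (s d eta : R) (U : ('I_m -> R) -> 'I_m -> R)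
    (p : 'I_m -> R) : 0 < s -> 0 < eta ->
  (forall y y', cube c s y -> cube c s y' -> (forall i, `|y i - y' i| <= eta) ->
     forall i, `|U y i - U y' i| <= d) ->
  (forall y, cube c s y -> forall i, `|U y i - y i| <= s / 2) ->
  cube c (s / 2) p -> exists2 y, cube c s y & forall i, `|U y i - p i| <= d.
Proof.
move=> s0 e0 uc near_id hp; have [N N0 hN] := mesh_exists s0 e0.
have N0' : 0 < N%:R :> R by rewrite ltr0n.
pose Y := gridpt c s N.
(* The values on the facets [z i = 0] and [z i = N] are imposed, as [grid_miranda] demands. The weak
   inequalities they stand for do hold there, because [U] moves points by at most [s / 2] and [p] is
   within [s / 2] of [c]. *)
pose S i (z : nat -> nat) : bool := if z i == 0%N then false else if z i == N then true else
  if insub i is Some j then p j <= U (Y z) j else false.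
have [|i z zN|w hw cell] := @grid_miranda N m S.
- by move=> i z z0; rewrite /S z0.
- by rewrite /S zN eqxx; case: eqP N0 => // ->.
have YK z : cube c s (Y z) by apply: gridpt_cube.
exists (Y w) => // i.
have [a [b [Sa Sb ha hb]]] := cell i (ltn_ord i).
have ins : (insub (i : nat) : option 'I_m) = Some i by rewrite (valK i).
have := hp i; rewrite ler_norml => /andP [hp1 hp2].
have ga : p i <= U (Y a) i.
  move: Sa; rewrite /S ins; case: eqP => // _; case: eqP => [aN _|_ //].
  have := near_id (Y a) (YK a) i; rewrite ler_norml => /andP [h1 h2].
  have : Y a i = c i + s.
    rewrite /Y /gridpt aN minnn divfK ?gt_eqF //; ring.
  by lra.
have gb : U (Y b) i <= p i.
  move: Sb; rewrite /S ins; case: eqP => [b0 _|_].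
    have := near_id (Y b) (YK b) i; rewrite ler_norml => /andP [h1 h2].
    have : Y b i = c i - s by rewrite /Y /gridpt b0 min0n mulr0 addr0.
    by lra.
  by case: eqP => // _; rewrite -ltNge => /ltW.
have ca : `|U (Y a) i - U (Y w) i| <= d.
  apply: uc => // j; apply: le_trans hN; exact: gridpt_close.
have cb : `|U (Y b) i - U (Y w) i| <= d.
  apply: uc => // j; apply: le_trans hN; exact: gridpt_close.
move: ca cb; rewrite !ler_norml => /andP [a1 a2] /andP [b1 b2].
by apply/andP; split; lra.
Qed.

End Cube.

(** * Polynomial approximation of the inverse of an injective map *)

Section PolyApprox.
Variables (R : realType) (n m : nat) (K : ('I_m -> R) -> Prop) (G : ('I_m -> R) -> 'I_n -> R).
Variables (rho Y : R).
Hypothesis G_bounded : forall y, K y -> forall i, `|G y i| <= rho.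
Hypothesis K_bounded : forall y, K y -> forall i, `|y i| <= Y.
Hypothesis G_inj : forall e : R, 0 < e -> exists2 eta : R, 0 < eta & forall y y', K y -> K y' ->
  (forall i, `|G y i - G y' i| <= eta) -> forall i, `|y i - y' i| <= e.
Hypothesis G_net : forall eta : R, 0 < eta -> exists (I : finType) (y : I -> 'I_m -> R),
  (forall k, K (y k)) /\ forall v, K v -> exists k, forall i, `|G v i - G (y k) i| <= eta.

(* The inverse of [G] is approximated by averaging the net points with the weights
   [(1 - |z - z_k|^2 / B)^N], which concentrate on the points near [z] as [N] grows; the
   denominator is then removed by truncating the geometric series of its inverse. *)
Lemma poly_left_inverse (e : R) : 0 < e ->
  exists F : 'I_m -> {mpoly R[n]}, forall y, K y -> forall i, `|(F i).@[G y] - y i| <= e.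
Proof.
move=> e0; have e30 : 0 < e / 3 by rewrite divr_gt0.
have [[y0 Ky0]|noK] := pselect (exists y, K y); last first.
  by exists (fun=> 0) => y Ky; case: noK; exists y.
have [m0|mpos] := posnP m.
  by exists (fun=> 0) => y _ i; exfalso; have := ltn_ord i; move: (nat_of_ord i) => j; rewrite m0.
have Y0 : 0 <= Y by apply: le_trans (K_bounded Ky0 (Ordinal mpos)).
have [eta eta0 hinj] := G_inj e30.
pose n1 : R := n%:R + 1.
have n10 : 0 < n1 by rewrite ltr_wpDl.
(* Chosen so that [n * del ^+ 2 <= eta ^+ 2 / 4]. *)
pose del := eta / (2 * n1).
have del0 : 0 < del by rewrite divr_gt0 // mulr_gt0.
have [I [yk [Kyk net]]] := G_net del0.
pose q (k : I) (v : 'I_n -> R) : R := \sum_i (v i - G (yk k) i) ^+ 2.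
pose qp (k : I) : {mpoly R[n]} := \sum_i ('X_i - (G (yk k) i)%:MP) ^+ 2.
have qE k v : (qp k).@[v] = q k v.
  rewrite /qp raddf_sum /=; apply: eq_bigr => i _.
  by rewrite rmorphXn /= mevalB mevalXU mevalC.
have q0 k v : 0 <= q k v by apply: sumr_ge0 => i _; apply: sqr_ge0.
(* The first term bounds [q] on the image; adding [eta ^+ 2] makes [B] positive and [be]
   nonnegative. *)
pose B : R := n%:R * (2 * rho) ^+ 2 + eta ^+ 2.
have eta20 : 0 < eta ^+ 2 by rewrite exprn_gt0.
have B0 : 0 < B by rewrite ltr_wpDl // mulr_ge0 // sqr_ge0.
have sq_le (x b : R) : `|x| <= b -> x ^+ 2 <= b ^+ 2.
  by move=> h; rewrite -real_normK ?num_real // ler_pXn2r ?nnegrE // (le_trans _ h).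
have qB k y : K y -> q k (G y) <= B.
  move=> Ky; apply: (@le_trans _ _ (\sum_(i < n) (2 * rho) ^+ 2)).
    apply: ler_sum => i _; apply: sq_le; apply: le_trans (ler_normB _ _) _.
    by have := G_bounded Ky i; have := G_bounded (Kyk k) i; lra.
  by rewrite sumr_const card_ord -(mulr_natl ((2 * rho) ^+ 2)) lerDl ltW.
(* [al] bounds the base of the weight from below at a close net point, and [be] bounds it from above
   at the far ones; as [be < al], far weights become negligible against the total. *)
pose al : R := 1 - eta ^+ 2 / 4 / B; pose be : R := 1 - eta ^+ 2 / B.
have etaB : eta ^+ 2 / B <= 1.
  by rewrite ler_pdivrMr // mul1r lerDr mulr_ge0 // sqr_ge0.
have etaB0 : 0 < eta ^+ 2 / B by rewrite divr_gt0.
have al0 : 0 < al by rewrite /al -mulrA mulrAC mulrA mulrC; lra.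
have be0 : 0 <= be by rewrite subr_ge0.
have beal : be < al.
  rewrite /be /al ltrD2l ltrN2 -mulrA (mulrC 4^-1) mulrA; lra.
have far k y : K y -> q k (G y) < eta ^+ 2 -> forall i, `|y i - yk k i| <= e / 3.
  move=> Ky hq; apply: hinj => // i.
  have : (G y i - G (yk k) i) ^+ 2 <= eta ^+ 2.
    apply: le_trans (ltW hq); rewrite /q (bigD1 i) //= lerDl.
    by apply: sumr_ge0 => j _; apply: sqr_ge0.
  by rewrite -[in X in X -> _]real_normK ?num_real // ler_pXn2r ?nnegrE // ltW.
have close y : K y -> exists k, q k (G y) <= eta ^+ 2 / 4.
  move=> Ky; have [k hk] := net y Ky; exists k.
  apply: (@le_trans _ _ (\sum_(i < n) del ^+ 2)).
    by apply: ler_sum => i _; apply: sq_le.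
  rewrite sumr_const card_ord -(mulr_natl (del ^+ 2)) /del.
  have -> : n%:R * (eta / (2 * n1)) ^+ 2 = (eta ^+ 2 / 4) * (n%:R / n1 ^+ 2).
    by field; rewrite gt_eqF.
  rewrite ler_piMr //; first by rewrite divr_ge0 // ltW.
  rewrite ler_pdivrMr ?exprn_gt0 // mul1r /n1.
  have : 0 <= (n%:R : R) by []. 
  by nra.
pose L : R := #|I|%:R.
have L0 : 0 <= L by [].
have beal1 : 0 <= be / al < 1 by rewrite divr_ge0 ?(ltW al0) // ltr_pdivrMr // mul1r.
have [N hN] : exists N, 2 * Y * L * (be / al) ^+ N <= e / 3.
  by apply: geometric_small => //; rewrite !mulr_ge0.
pose w k v : R := (1 - q k v / B) ^+ N.
pose wp k : {mpoly R[n]} := (1 - B^-1 *: qp k) ^+ N.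
have wE k v : (wp k).@[v] = w k v.
  by rewrite /wp rmorphXn /= mevalB meval1 mevalZ qE /w mulrC.
have base01 k y : K y -> 0 <= 1 - q k (G y) / B <= 1.
  move=> Ky; rewrite subr_ge0 ler_pdivrMr // mul1r qB //= lerBlDr lerDl.
  by rewrite divr_ge0 // ltW.
have w0 k y : K y -> 0 <= w k (G y).
  by move=> Ky; rewrite exprn_ge0 //; case/andP: (base01 k y Ky).
have w1 k y : K y -> w k (G y) <= 1.
  by move=> Ky; rewrite exprn_ile1 //; case/andP: (base01 k y Ky).
pose W v : R := \sum_k w k v.
have WL y : K y -> W (G y) <= L.
  move=> Ky; apply: (@le_trans _ _ (\sum_(k : I) 1)); first by apply: ler_sum => k _; apply: w1.
  by rewrite sumr_const.
have Wal y : K y -> al ^+ N <= W (G y).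
  move=> Ky; have [k hk] := close y Ky.
  apply: (@le_trans _ _ (w k (G y))); last first.
    by rewrite /W (bigD1 k) //= lerDl; apply: sumr_ge0 => j _; apply: w0.
  rewrite lerXn2r ?nnegrE ?(ltW al0) //; first by case/andP: (base01 k y Ky).
  by rewrite /al lerD2l lerN2 ler_wpM2r // invr_ge0 ltW.
have alN0 : 0 < al ^+ N by rewrite exprn_gt0.
(* [C] exceeds [W] on the image, so the ratio [1 - W / C] is nonnegative and at most
   [1 - al ^+ N / C < 1]. *)
pose C : R := L + 1.
have C0 : 0 < C by rewrite ltr_wpDl.
have alC : al ^+ N <= C.
  by apply: le_trans (Wal _ Ky0) _; apply: le_trans (WL _ Ky0) _; rewrite lerDl.
have [J hJ] : exists J, Y * (1 - al ^+ N / C) ^+ J <= e / 3.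
  apply: geometric_small => //; rewrite subr_ge0 ler_pdivrMr // mul1r alC /=.
  by rewrite ltrBlDr ltrDl divr_gt0.
pose Wp : {mpoly R[n]} := \sum_k wp k.
have WpE v : Wp.@[v] = W v by rewrite /Wp raddf_sum /=; apply: eq_bigr => k _.
pose V : {mpoly R[n]} := C^-1 *: \sum_(j < J) (1 - C^-1 *: Wp) ^+ j.
exists (fun i => (\sum_k yk k i *: wp k) * V) => y Ky i.
have W0 : 0 < W (G y) by apply: lt_le_trans (Wal y Ky).
pose A := \sum_k yk k i * w k (G y).
have AE : (\sum_k yk k i *: wp k).@[G y] = A.
  by rewrite raddf_sum /=; apply: eq_bigr => k _; rewrite mevalZ wE.
pose r := 1 - W (G y) / C.
have VE : V.@[G y] = C^-1 * \sum_(j < J) r ^+ j.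
  rewrite /V mevalZ raddf_sum /=; congr (_ * _); apply: eq_bigr => j _.
  by rewrite rmorphXn /= mevalB meval1 mevalZ WpE /r (mulrC _ C^-1).
have VW : W (G y) * V.@[G y] = 1 - r ^+ J.
  have -> : 1 - r ^+ J = (1 - r) * \sum_(j < J) r ^+ j.
    by rewrite -opprB subrX1 -mulNr opprB.
  have -> : 1 - r = W (G y) / C by rewrite /r; ring.
  by rewrite VE mulrA.
rewrite mevalM AE.
have -> : A * V.@[G y] = A / W (G y) * (1 - r ^+ J).
  by rewrite -VW mulrA divfK // gt_eqF.
have r0 : 0 <= r.
  rewrite subr_ge0 ler_pdivrMr // mul1r; apply: le_trans (WL y Ky) _; by rewrite lerDl.
have rJ : r ^+ J <= (1 - al ^+ N / C) ^+ J.
  rewrite lerXn2r ?nnegrE //; last by rewrite lerD2l lerN2 ler_wpM2r ?invr_ge0 ?(ltW C0) // Wal.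
  by rewrite subr_ge0 ler_pdivrMr // mul1r.
have hA : `|A / W (G y)| <= Y.
  rewrite normrM normfV (gtr0_norm W0) ler_pdivrMr // /W mulr_sumr.
  apply: le_trans (ler_norm_sum _ _ _) _; apply: ler_sum => k _.
  by rewrite normrM (ger0_norm (w0 k y Ky)) ler_wpM2r ?w0 // K_bounded.
have hAy : `|A / W (G y) - y i| <= e / 3 + e / 3.
  have -> : A / W (G y) - y i = (\sum_k (yk k i - y i) * w k (G y)) / W (G y).
    have -> : \sum_k (yk k i - y i) * w k (G y) = A - y i * W (G y).
      by rewrite /A /W mulr_sumr -sumrB; apply: eq_bigr => k _; rewrite mulrBl.
    by rewrite mulrBl mulfK // gt_eqF.
  rewrite normrM normfV (gtr0_norm W0) ler_pdivrMr //.
  apply: le_trans (ler_norm_sum _ _ _) _.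
  apply: (@le_trans _ _ (\sum_k (e / 3 * w k (G y) + 2 * Y * be ^+ N))).
    apply: ler_sum => k _; rewrite normrM (ger0_norm (w0 k y Ky)).
    have YbN : 0 <= 2 * Y * be ^+ N by rewrite !mulr_ge0 // exprn_ge0.
    have [hq|hq] := ltP (q k (G y)) (eta ^+ 2).
      have := far k y Ky hq i; rewrite distrC => h.
      by rewrite -[leLHS]addr0 lerD // ler_wpM2r // w0.
    rewrite -[leLHS]add0r lerD //; first by rewrite mulr_ge0 ?w0 // ltW.
    apply: ler_pM => //; first exact: w0.
      apply: le_trans (ler_normB _ _) _.
      by have := K_bounded Ky i; have := K_bounded (Kyk k) i; lra.
    rewrite lerXn2r ?nnegrE //; first by case/andP: (base01 k y Ky).
    by rewrite lerD2l lerN2 ler_wpM2r // invr_ge0 ltW.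
  have -> : \sum_k (e / 3 * w k (G y) + 2 * Y * be ^+ N) =
      e / 3 * W (G y) + L * (2 * Y * be ^+ N).
    by rewrite big_split /= -mulr_sumr sumr_const -(mulr_natl (2 * Y * be ^+ N)).
  rewrite [leRHS]mulrDl lerD2l.
  apply: (@le_trans _ _ (e / 3 * al ^+ N)); last by rewrite ler_wpM2l ?Wal // ltW.
  rewrite -ler_pdivrMr //.
  have -> : L * (2 * Y * be ^+ N) / al ^+ N = 2 * Y * L * (be / al) ^+ N.
    by rewrite exprMn exprVn; ring.
  exact: hN.
have -> : A / W (G y) * (1 - r ^+ J) - y i = (A / W (G y) - y i) - A / W (G y) * r ^+ J by ring.
apply: le_trans (ler_normB _ _) _.
have : `|A / W (G y) * r ^+ J| <= e / 3.
  apply: le_trans hJ; rewrite normrM (ger0_norm (exprn_ge0 J r0)).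
  by apply: ler_pM => //; rewrite exprn_ge0.
by lra.
Qed.

End PolyApprox.
End ApproxPart.

From mathcomp Require Import all_classical all_reals all_analysis.
Import Order.TTheory GRing.Theory Num.Theory.
Import numFieldNormedType.Exports.
Import AlgPart EvalPart GridPart ApproxPart.
Local Open Scope classical_set_scope.
Local Open Scope ring_scope.

(** * Polynomial images of topological manifolds *)

Section Coordinates.
Variable R : realType.

Lemma nbhs_rVP m (x : 'rV[R]_m) (A : set 'rV[R]_m) :
  nbhs x A <-> exists2 e : R, 0 < e & forall y : 'rV[R]_m,
    (forall i, `|y ord0 i - x ord0 i| < e) -> A y.
Proof.
split.
  move=> /nbhs_ballP [e e0 eA]; exists e => // y hy; apply: eA; split => // i j.
  by rewrite (ord1 i) /ball /= distrC.
move=> [e e0 eA]; apply/nbhs_ballP; exists e => //= y [_ hy]; apply: eA => i.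
by have := hy ord0 i; rewrite /ball /= distrC.
Qed.

Lemma open_cube m (V : set 'rV[R]_m) x : open V -> V x ->
  exists2 s : R, 0 < s & forall y : 'rV[R]_m, (forall i, `|y ord0 i - x ord0 i| <= s) -> V y.
Proof.
move=> oV Vx; have /nbhs_rVP [e e0 eV] : nbhs x V by apply: open_nbhs_nbhs.
exists (e / 2); first by rewrite divr_gt0.
by move=> y hy; apply: eV => i; apply: le_lt_trans (hy i) _; rewrite ltr_pdivrMr // ltr_pMr // ltr1n.
Qed.

Lemma within_continuous_rVP m k (D : set 'rV[R]_m) (f : 'rV[R]_m -> 'rV[R]_k) :
  {within D, continuous f} <-> forall x, D x -> forall e : R, 0 < e ->
    exists2 d : R, 0 < d & forall y, D y -> (forall i, `|y ord0 i - x ord0 i| < d) ->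
      forall i, `|f y ord0 i - f x ord0 i| < e.
Proof.
rewrite subspace_continuousP; split=> h x Dx.
  move=> e e0; have : nbhs (f x) [set w | forall i, `|w ord0 i - f x ord0 i| < e].
    by apply/nbhs_rVP; exists e.
  move=> /(h x Dx); rewrite /fmap /= => /nbhs_rVP [d d0 hd].
  by exists d => // y Dy hy; apply: (hd y).
move=> A /nbhs_rVP [e e0 eA]; have [d d0 hd] := h x Dx e e0.
by apply/nbhs_rVP; exists d => // y hy Dy; apply: eA; apply: hd.
Qed.

Lemma cube_compact m (c : 'I_m -> R) (s : R) :
  compact [set y : 'rV[R]_m | cube c s (pt y)].
Proof.
have -> : [set y : 'rV[R]_m | cube c s (pt y)] =
    [set v : 'rV[R]_m | forall i, `[c i - s, c i + s]%classic (v ord0 i)].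
  apply/seteqP; split => y /= hy i; have := hy i; rewrite /= in_itv /= ler_distl; by [].
by apply: (@rV_compact R m (fun i => `[c i - s, c i + s]%classic)) => i; apply: segment_compact.
Qed.

(** A Lebesgue number argument: a property that holds near each point for all small [d] holds on a
    compact set for a common [d]. *)
Lemma compact_uniform m (K : set 'rV[R]_m) (Q : R -> 'rV[R]_m -> Prop) : compact K ->
  (forall x, K x -> exists2 e : R, 0 < e & forall y d, K y ->
    (forall i, `|y ord0 i - x ord0 i| < e) -> 0 < d < e -> Q d y) ->
  exists2 d : R, 0 < d & forall y, K y -> Q d y.
Proof.
move=> cK loc.
have h := iffLR (compact_near_coveringP K) cK R (0 : R)^'+ (fun d y => K y -> Q d y) _.
have [d [d0 hd]] : exists d : R, 0 < d /\ (forall y, K y -> Q d y).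
  have hK : (0 : R)^'+ [set d | K `<=` [set y | K y -> Q d y]].
    apply: h => x Kx; have [e e0 he] := loc x Kx.
    exists ([set y : 'rV[R]_m | forall i, `|y ord0 i - x ord0 i| < e], [set d | 0 < d < e]).
      split => /=; first by apply/nbhs_rVP; exists e.
      apply: filterS (filterI (nbhs_right_gt (0 : R)) (nbhs_right_lt e0)).
      by move=> d [/= -> ->].
    by move=> [y d] [/= hy hd] Ky; apply: he.
  have [d [d0 hd]] := filter_ex (filterI (nbhs_right_gt (0 : R)) hK).
  by exists d; split => // y Ky; apply: hd.
by exists d.
Qed.

Lemma within_continuous_uniform m k (K V : set 'rV[R]_m) (g : 'rV[R]_m -> 'rV[R]_k) :
  compact K -> K `<=` V -> {within V, continuous g} -> forall e : R, 0 < e ->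
  exists2 d : R, 0 < d & forall y y', K y -> K y' -> (forall i, `|y ord0 i - y' ord0 i| <= d) ->
    forall i, `|g y ord0 i - g y' ord0 i| <= e.
Proof.
move=> cK KV /within_continuous_rVP cg e e0.
have e20 : 0 < e / 2 by rewrite divr_gt0.
have [x Kx|d d0 hd] := @compact_uniform m K (fun d y => forall y', K y' ->
    (forall i, `|y ord0 i - y' ord0 i| <= d) -> forall i, `|g y ord0 i - g y' ord0 i| <= e) cK.
  have [d d0 hd] := cg x (KV _ Kx) _ e20.
  exists (d / 2); first by rewrite divr_gt0.
  move=> y d' Ky hy /andP [d'0 d'd] y' Ky' hyy' i.
  have h1 : `|g y ord0 i - g x ord0 i| < e / 2.
    by apply: hd; [apply: KV|move=> l; apply: lt_trans (hy l) _; lra].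
  have h2 : `|g y' ord0 i - g x ord0 i| < e / 2.
    apply: hd; [exact: KV|move=> l].
    rewrite -(subrK (y ord0 l) (y' ord0 l)) -addrA; apply: le_lt_trans (ler_normD _ _) _.
    by have := hyy' l; rewrite distrC; have := hy l; lra.
  rewrite -(subrK (g x ord0 i) (g y ord0 i)) -addrA; apply: le_trans (ler_normD _ _) _.
  by rewrite (distrC (g x ord0 i)); lra.
by exists d => // y y' Ky Ky'; apply: hd.
Qed.

(** Uniform injectivity of [g] on [K]. Near [x], continuity of [g] brings [g y], hence [g y'], close
    to [g x], and continuity of [f] at [g x] then brings [y] and [y'] close to [x]. *)
Lemma chart_inverse_uniform m k (K V : set 'rV[R]_m) (D : set 'rV[R]_k)
    (f : 'rV[R]_k -> 'rV[R]_m) (g : 'rV[R]_m -> 'rV[R]_k) :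
  compact K -> K `<=` V -> {within V, continuous g} -> {within D, continuous f} ->
  (forall y, V y -> D (g y) /\ f (g y) = y) -> forall e : R, 0 < e ->
  exists2 d : R, 0 < d & forall y y', K y -> K y' ->
    (forall i, `|g y ord0 i - g y' ord0 i| <= d) -> forall i, `|y ord0 i - y' ord0 i| <= e.
Proof.
move=> cK KV /within_continuous_rVP cg /within_continuous_rVP cf fg e e0.
have e20 : 0 < e / 2 by rewrite divr_gt0.
have [x Kx|d d0 hd] := @compact_uniform m K (fun d y => forall y', K y' ->
    (forall i, `|g y ord0 i - g y' ord0 i| <= d) -> forall i, `|y ord0 i - y' ord0 i| <= e) cK.
  have [Dx fx] := fg x (KV _ Kx).
  have [d d0 hd] := cf (g x) Dx _ e20.
  have d20 : 0 < d / 2 by rewrite divr_gt0.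
  have [d1 d10 hd1] := cg x (KV _ Kx) _ d20.
  have near_x y : K y -> (forall i, `|g y ord0 i - g x ord0 i| < d) ->
      forall i, `|y ord0 i - x ord0 i| < e / 2.
    move=> Ky hy i; have [Dy fy] := fg y (KV _ Ky).
    by have := hd (g y) Dy hy i; rewrite fx fy.
  exists (Num.min d1 (d / 2)); first by rewrite lt_min d10.
  move=> y d' Ky hy /andP [d'0 d'd] y' Ky' hyy' i.
  have gy l : `|g y ord0 l - g x ord0 l| < d / 2.
    apply: hd1; [exact: KV|move=> l'].
    by apply: lt_le_trans (hy l') _; rewrite ge_min lexx.
  have d'2 : d' < d / 2 by apply: lt_le_trans d'd _; rewrite ge_min lexx orbT.
  have h1 : `|y ord0 i - x ord0 i| < e / 2.
    by apply: near_x => // l; apply: lt_trans (gy l) _; lra.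
  have h2 : `|y' ord0 i - x ord0 i| < e / 2.
    apply: near_x => // l.
    rewrite -(subrK (g y ord0 l) (g y' ord0 l)) -addrA; apply: le_lt_trans (ler_normD _ _) _.
    by have := hyy' l; rewrite distrC; have := gy l; lra.
  rewrite -(subrK (x ord0 i) (y ord0 i)) -addrA; apply: le_trans (ler_normD _ _) _.
  by rewrite (distrC (x ord0 i)); lra.
by exists d => // y y' Ky Ky'; apply: hd.
Qed.

(* A chart is inverted up to a small error by polynomials; the resulting self-map of the cube
   is close to the identity, hence has dense image in a smaller cube. *)
Lemma manifold_dense_image n (M : set 'rV[R]_n) m : is_manifold M m ->
  exists F : 'I_m -> poly_n n R, dense_image M F.
Proof.
move=> [[p Mp] /(_ p Mp) [U [oU [Up [V [f [g [oV [cf [cg [fh gh]]]]]]]]]]].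
have [Vp gfp] := fh p (conj Mp Up).
have [s s0 hs] := open_cube oV Vp.
pose c := pt (f p).
pose K : set 'rV[R]_m := [set y | cube c s (pt y)].
have cK : compact K by apply: cube_compact.
have KV : K `<=` V by move=> y Ky; apply: hs.
pose row (y : 'I_m -> R) : 'rV[R]_m := \row_i y i.
have rowE y : pt (row y) = y by apply/funext => i; rewrite /pt mxE.
have Krow y : cube c s y -> K (row y) by rewrite /K /= rowE.
pose G (y : 'I_m -> R) : 'I_n -> R := pt (g (row y)).
have ucg := within_continuous_uniform cK KV cg.
have inj := chart_inverse_uniform cK KV cg cf gh.
pose rc : R := \sum_i `|c i| + s.
have Kb y : cube c s y -> forall i, `|y i| <= rc.
  move=> hy i; rewrite -(subrK (c i) (y i)) addrC; apply: le_trans (ler_normD _ _) _.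
  by rewrite lerD // (bigD1 i) //= lerDl; apply: sumr_ge0.
have G_net : forall eta : R, 0 < eta -> exists (I : finType) (y : I -> 'I_m -> R),
    (forall k, cube c s (y k)) /\
    forall v, cube c s v -> exists k, forall i, `|G v i - G (y k) i| <= eta.
  move=> eta eta0; have [d d0 hd] := ucg eta eta0.
  have [I [y [Ky net]]] := grid_net c s0 d0.
  exists I, y; split => // v Kv; have [k hk] := net v Kv; exists k => i.
  apply: hd; [exact: Krow|exact: Krow|].
  by move=> j; have := hk j; rewrite !mxE.
have [I [yk [Kyk net]]] := G_net 1 ltr01.
pose rho : R := \sum_k \sum_i `|G (yk k) i| + 1.
have Gb y : cube c s y -> forall i, `|G y i| <= rho.
  move=> Ky i; have [k hk] := net y Ky.
  rewrite -(subrK (G (yk k) i) (G y i)) addrC; apply: le_trans (ler_normD _ _) _.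
  rewrite lerD // (bigD1 k) //= (bigD1 i) //= -addrA lerDl addr_ge0 //; first exact: sumr_ge0.
  by do 2 (apply: sumr_ge0 => ? _).
have G_inj : forall e : R, 0 < e -> exists2 eta : R, 0 < eta & forall y y',
    cube c s y -> cube c s y' ->
    (forall i, `|G y i - G y' i| <= eta) -> forall i, `|y i - y' i| <= e.
  move=> e e0; have [d d0 hd] := inj e e0; exists d => // y y' Ky Ky' h i.
  have := hd (row y) (row y') (Krow _ Ky) (Krow _ Ky') h i; by rewrite !mxE.
have s20 : 0 < s / 2 by rewrite divr_gt0.
(* Accuracy [s / 2] is the closeness to the identity that [approx_miranda] asks for on a cube of
   radius [s]. *)
have [F hF] := poly_left_inverse Gb Kb G_inj G_net s20.
exists F; exists (s / 2) => //; exists c => y hy d d0.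
have [C C0 hC] : exists2 C : R, 0 <= C & forall i (v h : 'I_n -> R) (e : R),
    (forall i, `|v i| <= rho) -> (forall i, `|h i| <= e) -> 0 <= e <= 1 ->
    `|mpoly.meval (fun i => v i + h i) (F i) - mpoly.meval v (F i)| <= C * e.
  apply: (@bound_fin R 'I_m (fun i C => forall (v h : 'I_n -> R) (e : R),
    (forall i, `|v i| <= rho) -> (forall i, `|h i| <= e) -> 0 <= e <= 1 ->
    `|mpoly.meval (fun i => v i + h i) (F i) - mpoly.meval v (F i)| <= C * e)).
    move=> i C C' le h v h' e hv hh he; apply: le_trans (h v h' e hv hh he) _.
    by rewrite ler_wpM2r //; case/andP: he.
  by move=> i; apply: meval_lipschitz.
pose e := Num.min 1 (d / (C + 1)).
have C10 : 0 < C + 1 by rewrite ltr_wpDl.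
have e0 : 0 < e by rewrite lt_min ltr01 divr_gt0.
have e1 : e <= 1 by rewrite ge_min lexx.
have Ced : C * e <= d.
  have : e <= d / (C + 1) by rewrite ge_min lexx orbT.
  rewrite ler_pdivlMr //; nra.
have [eta eta0 heta] := ucg e e0.
pose Uf (y : 'I_m -> R) (i : 'I_m) := mpoly.meval (G y) (F i).
have uc : forall y y', cube c s y -> cube c s y' -> (forall i, `|y i - y' i| <= eta) ->
     forall i, `|Uf y i - Uf y' i| <= d.
  move=> v w Kv Kw hvw i; apply: le_trans Ced.
  have := hC i (G w) (fun i => G v i - G w i) e (Gb w Kw).
  have -> : mpoly.meval (fun i => G w i + (G v i - G w i)) (F i) = Uf v i.
    by apply: mpoly.meval_eq => l; rewrite addrC subrK.
  apply; last by rewrite e1 ltW.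
  by apply: heta; [exact: Krow|exact: Krow|move=> l; rewrite !mxE].
have [v Kv hv] := approx_miranda s0 eta0 uc hF hy.
exists (g (row v)); last by move=> i; apply: hv.
by case: (gh (row v) (KV _ (Krow _ Kv))) => -[].
Qed.

End Coordinates.

(** * The implicit function theorem *)

Section Implicit.
Variable R : realType.

Lemma rV_norm_le m (w : 'rV[R]_m) (e : R) : 0 <= e ->
  (forall j, `|w ord0 j| <= e) -> `|w| <= e.
Proof.
move=> e0 h; have -> : `|w| = mx_norm w by [].
rewrite mx_normrE; apply: bigmax_le => // -[i j] _ /=.
by rewrite (ord1 i).
Qed.

Lemma rV_coord_le m (w : 'rV[R]_m) j : `|w ord0 j| <= `|w|.
Proof.
have -> : `|w| = mx_norm w by [].
rewrite mx_normrE.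
exact: (le_bigmax _ (fun ij : 'I_1 * 'I_m => `|w ij.1 ij.2|) (ord0, j)).
Qed.

(** Compactness replaces iteration: at a minimum of [|Phi w - w|] the value is zero, since applying
    [Phi] once more would halve it. The bound on the first step keeps the cube invariant. *)
Lemma cube_contraction_fixpoint r (Phi : 'rV[R]_r -> 'rV[R]_r) (w0 : 'rV[R]_r) (rho : R) :
  0 < rho ->
  (forall w w', cube (pt w0) rho (pt w) -> cube (pt w0) rho (pt w') ->
     `|Phi w - Phi w'| <= `|w - w'| / 2) ->
  `|Phi w0 - w0| <= rho / 2 ->
  exists2 w, cube (pt w0) rho (pt w) & Phi w = w.
Proof.
move=> rho0 ctr start; pose U : set 'rV[R]_r := [set w | cube (pt w0) rho (pt w)].
have Uw0 : U w0 by move=> i; rewrite subrr normr0 ltW.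
have hU : set_fun U U Phi.
  move=> w Uw i.
  have -> : pt (Phi w) i - pt w0 i = (Phi w - w0) ord0 i by rewrite /pt !mxE.
  apply: le_trans (rV_coord_le _ _) _.
  rewrite -(subrK (Phi w0) (Phi w)) -addrA; apply: le_trans (ler_normD _ _) _.
  have : `|w - w0| <= rho.
    apply: rV_norm_le; first exact: ltW.
    by move=> j; have := Uw j; rewrite /pt !mxE.
  by have := ctr w w0 Uw Uw0; move: start; lra.
have cU : compact U by apply: cube_compact.
pose N w : R := `|Phi w - w|.
have cN : {within U, continuous N}.
  apply/subspace_continuousP => w Uw A /nbhs_ballP [e e0 eA].
  have e20 : 0 < e / 2 by rewrite divr_gt0.
  apply/nbhs_rVP; exists (e / 2) => // w' hw' Uw'; apply: eA; rewrite /ball /= /N.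
  apply: le_lt_trans (ler_dist_dist _ _) _.
  have -> : Phi w - w - (Phi w' - w') = (Phi w - Phi w') - (w - w').
    by apply/rowP => j; rewrite !mxE; ring.
  apply: le_lt_trans (ler_normB _ _) _; have := ctr w w' Uw Uw'.
  have : `|w - w'| <= e / 2.
    apply: rV_norm_le; first exact: ltW.
    by move=> j; rewrite !mxE distrC ltW.
  by have : 0 <= `|w - w'| by []; lra.
have [w /set_mem Uw wmin] := EVT_min_rV (ex_intro _ w0 Uw0) cU cN.
exists w => //; apply/eqP; rewrite -subr_eq0 -normr_le0 leNgt; apply/negP => pos.
have := wmin (Phi w) (mem_set (hU w Uw)); have := ctr (Phi w) w (hU w Uw) Uw.
by rewrite /N; lra.
Qed.

Variables (n r : nat) (f : 'I_r -> poly_n n R) (g : 'I_r -> 'I_n) (x : 'I_n -> R).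
Hypothesis g_inj : injective g.
Let B : 'M[R]_r := \matrix_(i, j) mpoly.meval x (mpoly.mderiv (g j) (f i)).
Hypothesis uB : B \in unitmx.
Hypothesis fx : forall i, mpoly.meval x (f i) = 0.

(** The second clause says that solutions depend on the free coordinates in a Lipschitz way; with
    [e = 0] it gives uniqueness. *)
Lemma implicit_solution (rho0 : R) : 0 < rho0 ->
  exists rho sg L : R, [/\ [/\ 0 < rho, rho <= rho0, 0 < sg, sg <= 1 & 1 <= L],
    forall v, cube x sg v -> exists z, [/\ cube x rho z,
      forall i, (forall j, g j != i) -> z i = v i & forall i, mpoly.meval z (f i) = 0] &
    forall z z', cube x rho z -> cube x rho z' ->
      (forall i, mpoly.meval z (f i) = 0) -> (forall i, mpoly.meval z' (f i) = 0) ->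
      forall e : R, 0 <= e <= 1 -> (forall i, (forall j, g j != i) -> `|z i - z' i| <= e) ->
      forall i, `|z i - z' i| <= L * e].
Proof.
move=> rho00; have [rN rN0 newton] := newton_contraction g_inj uB.
pose rho := Num.min rho0 (Num.min rN (2^-1)).
have rhop : 0 < rho by rewrite !lt_min rho00 rN0 invr_gt0 ltr0n.
have rhoN : rho <= rN by rewrite !ge_min lexx !orbT.
have rhor : rho <= rho0 by rewrite !ge_min lexx.
have rho12 : rho <= 2^-1 by rewrite !ge_min lexx !orbT.
pose rx : R := \sum_i `|x i| + 1.
have hrx z : cube x rho z -> forall i, `|z i| <= rx.
  move=> hz i; rewrite -(subrK (x i) (z i)) addrC; apply: le_trans (ler_normD _ _) _.
  rewrite lerD //; first by rewrite (bigD1 i) //= lerDl; apply: sumr_ge0.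
  by have := hz i; lra.
have [C C0 hC] : exists2 C : R, 0 <= C & forall i (v h : 'I_n -> R) (e : R),
    (forall i, `|v i| <= rx) -> (forall i, `|h i| <= e) -> 0 <= e <= 1 ->
    `|mpoly.meval (fun i => v i + h i) (f i) - mpoly.meval v (f i)| <= C * e.
  apply: (@bound_fin R 'I_r (fun i C => forall (v h : 'I_n -> R) (e : R),
    (forall i, `|v i| <= rx) -> (forall i, `|h i| <= e) -> 0 <= e <= 1 ->
    `|mpoly.meval (fun i => v i + h i) (f i) - mpoly.meval v (f i)| <= C * e)).
    move=> i C C' le h v h' e hv hh he; apply: le_trans (h v h' e hv hh he) _.
    by rewrite ler_wpM2r //; case/andP: he.
  by move=> i; apply: meval_lipschitz.
have {}hC i z z' (e : R) : cube x rho z -> (forall k, `|z' k - z k| <= e) -> 0 <= e <= 1 ->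
    `|mpoly.meval z' (f i) - mpoly.meval z (f i)| <= C * e.
  move=> hz hzz he; have := hC i z (fun k => z' k - z k) e (hrx z hz) hzz he.
  have -> // : mpoly.meval (fun k => z k + (z' k - z k)) (f i) = mpoly.meval z' (f i).
  by apply: mpoly.meval_eq => l; rewrite addrC subrK.
have [K K0 hK] : exists2 K : R, 0 <= K & forall j i, `|(invmx B) j i| <= K.
  exists (\sum_i \sum_j `|(invmx B) j i|); first by do 2 (apply: sumr_ge0 => ? _).
  move=> j i; rewrite (bigD1 i) //= (bigD1 j) //= -addrA lerDl addr_ge0 //.
    exact: sumr_ge0.
  by do 2 (apply: sumr_ge0 => ? _).
have lin (z z' : 'I_n -> R) (e : R) j :
    (forall i, `|mpoly.meval z (f i) - mpoly.meval z' (f i)| <= C * e) ->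
    `|\sum_i (mpoly.meval z (f i) - mpoly.meval z' (f i)) * (invmx B) j i| <= r%:R * K * (C * e).
  by move=> h; apply: norm_lincomb_le.
pose E : R := r%:R * K * C.
have E0 : 0 <= E by rewrite !mulr_ge0.
(* [E * sg <= rho / 2] bounds the first Newton step from [w0], where only the free coordinates
   differ from those of the zero [x]. *)
pose sg := Num.min rho (rho / (2 * (E + 1))).
have E10 : 0 < 2 * (E + 1) by rewrite mulr_gt0 // ltr_wpDl.
have sg0 : 0 < sg by rewrite lt_min rhop divr_gt0.
have sgr : sg <= rho by rewrite ge_min lexx.
have sgE : E * sg <= rho / 2.
  have : sg <= rho / (2 * (E + 1)) by rewrite ge_min lexx orbT.
  rewrite ler_pdivlMr //; nra.
have xcube : cube x rho x by move=> i; rewrite subrr normr0 ltW.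
exists rho, sg, (2 * E + 1); split.
- by split => //; [lra|rewrite lerDr mulr_ge0].
- move=> v hv.
  pose Z (w : 'rV[R]_r) (i : 'I_n) : R := if [pick j | g j == i] is Some j then w ord0 j else v i.
  have Zg w j : Z w (g j) = w ord0 j.
    rewrite /Z; case: pickP => [k /eqP /g_inj -> //|/(_ j)]; by rewrite eqxx.
  have Zn w i : (forall j, g j != i) -> Z w i = v i.
    by move=> h; rewrite /Z; case: pickP => // j e; have := h j; rewrite e.
  pose w0 : 'rV[R]_r := \row_j x (g j).
  have Zcube w : cube (pt w0) rho (pt w) -> cube x rho (Z w).
    move=> hw i; have [[j /eqP <-]|no] := pselect (exists j, g j == i).
      by rewrite Zg; have := hw j; rewrite /pt mxE.
    rewrite Zn; first by apply: le_trans (hv i) _.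
    by move=> j; apply/negP => e; apply: no; exists j.
  pose Phi (w : 'rV[R]_r) : 'rV[R]_r :=
    \row_j (w ord0 j - \sum_i mpoly.meval (Z w) (f i) * (invmx B) j i).
  have w0cube : cube (pt w0) rho (pt w0) by move=> i; rewrite subrr normr0 ltW.
  have [||w hw fixw] := @cube_contraction_fixpoint r Phi w0 rho rhop.
  + move=> w w' hw hw'; apply: rV_norm_le; first by rewrite divr_ge0.
    move=> j; rewrite !mxE.
    have := newton (Z w) (Z w') `|w - w'|.
    have -> : w ord0 j - \sum_i mpoly.meval (Z w) (f i) * (invmx B) j i -
        (w' ord0 j - \sum_i mpoly.meval (Z w') (f i) * (invmx B) j i) =
        w ord0 j - w' ord0 j -
        \sum_i (mpoly.meval (Z w) (f i) - mpoly.meval (Z w') (f i)) * (invmx B) j i.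
      under [in RHS]eq_bigr do rewrite mulrBl.
      by rewrite sumrB; ring.
    move=> h; have := h _ _ _ _ _ _ j; rewrite !Zg; apply.
    * by move=> i; apply: le_trans (Zcube w hw i) _.
    * by move=> i; apply: le_trans (Zcube w' hw' i) _.
    * by move=> i hi; rewrite !Zn.
    * by [].
    * by move=> k; rewrite !Zg; have := rV_coord_le (w - w') k; rewrite !mxE.
    * apply: rV_norm_le => [|k]; first by rewrite mulr_ge0 // ltW.
      rewrite !mxE -(subrK (w0 ord0 k) (w ord0 k)) -addrA.
      apply: le_trans (ler_normD _ _) _; rewrite (distrC (w0 ord0 k)).
      by have := hw k; have := hw' k; rewrite /pt; lra.
  + apply: rV_norm_le; first by rewrite divr_ge0 // ltW.
    move=> j; rewrite !mxE addrAC subrr sub0r normrN; apply: le_trans sgE.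
    have hZ i : `|Z w0 i - x i| <= sg.
      have [[k /eqP <-]|no] := pselect (exists j, g j == i).
        by rewrite Zg mxE subrr normr0 ltW.
      rewrite Zn // => k; apply/negP => e; apply: no; by exists k.
    have h1 := lin (Z w0) x sg j _.
    have {h1} := h1 (fun i => hC i x (Z w0) sg xcube hZ _).
    rewrite ltW //= => h1.
    have -> : \sum_i mpoly.meval (Z w0) (f i) * (invmx B) j i =
      \sum_i (mpoly.meval (Z w0) (f i) - mpoly.meval x (f i)) * (invmx B) j i.
      by apply: eq_bigr => i _; rewrite fx subr0.
    rewrite /E -mulrA; apply: h1; lra.
  exists (Z w); split; [exact: Zcube|exact: Zn|].
  have s0 j : \sum_i mpoly.meval (Z w) (f i) * (invmx B) j i = 0.
    have := congr1 (fun u : 'rV[R]_r => u ord0 j) fixw; rewrite mxE => /eqP.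
    by rewrite -subr_eq0 addrAC subrr sub0r oppr_eq0 => /eqP.
  pose fv : 'cV[R]_r := \col_i mpoly.meval (Z w) (f i).
  have fv0 : invmx B *m fv = 0.
    apply/matrixP => j k; rewrite !mxE -[RHS](s0 j); apply: eq_bigr => i _.
    by rewrite [fv _ _]mxE mulrC.
  move=> i; have : fv = 0 by rewrite -(mulKVmx uB fv) fv0 mulmx0.
  by move=> /matrixP /(_ i ord0); rewrite !mxE.
- move=> z z' hz hz' fz fz' e he off.
  have e0 : 0 <= e by case/andP: he.
  (* [mid] takes its [g] coordinates from [z] and the free ones from [z']: the contraction compares
     it with [z'], and it is within [e] of [z], so [f] is small there. *)
  pose mid i : R := if [pick j | g j == i] is Some j then z i else z' i.
  have midg j : mid (g j) = z (g j).
    by rewrite /mid; case: pickP => // /(_ j); rewrite eqxx.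
  have midn i : (forall j, g j != i) -> mid i = z' i.
    by move=> h; rewrite /mid; case: pickP => // j ej; have := h j; rewrite ej.
  have hmid : cube x rho mid.
    by move=> i; rewrite /mid; case: pickP => [? _|_]; [apply: hz|apply: hz'].
  have midz i : `|mid i - z i| <= e.
    rewrite /mid; case: pickP => [? _|no]; first by rewrite subrr normr0.
    by rewrite distrC; apply: off => j; rewrite no.
  pose w : 'rV[R]_r := \row_j (z (g j) - z' (g j)).
  have wE j : `|z (g j) - z' (g j)| <= `|w| by have := rV_coord_le w j; rewrite mxE.
  have w2 : `|w| <= 2 * rN.
    apply: rV_norm_le => [|k]; first by rewrite mulr_ge0 // ltW.
    rewrite mxE -(subrK (x (g k)) (z (g k))) -addrA.
    apply: le_trans (ler_normD _ _) _; rewrite (distrC (x (g k))).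
    by have := hz (g k); have := hz' (g k); lra.
  have key j : `|z (g j) - z' (g j)| <= `|w| / 2 + E * e.
    have h1 := newton mid z' `|w| (fun i => le_trans (hmid i) rhoN)
      (fun i => le_trans (hz' i) rhoN) midn (normr_ge0 _).
    have {h1} h1 : `|z (g j) - z' (g j) -
        \sum_i (mpoly.meval mid (f i) - mpoly.meval z' (f i)) * (invmx B) j i| <= `|w| / 2.
      by rewrite -midg; apply: h1 => // k; rewrite midg.
    have h2 := lin mid z e j (fun i => hC i z mid e hz midz he).
    have e12 : \sum_i (mpoly.meval mid (f i) - mpoly.meval z' (f i)) * (invmx B) j i =
        \sum_i (mpoly.meval mid (f i) - mpoly.meval z (f i)) * (invmx B) j i.
      by apply: eq_bigr => i _; rewrite fz fz'.
    rewrite e12 in h1; move: h1 h2; set S := \sum_i _ => h1 h2.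
    rewrite -(subrK S (z (g j) - z' (g j))); apply: le_trans (ler_normD _ _) _.
    by rewrite lerD // /E -mulrA.
  have wle : `|w| <= `|w| / 2 + E * e.
    apply: rV_norm_le => [|k]; last by rewrite mxE.
    by rewrite addr_ge0 // ?divr_ge0 // mulr_ge0.
  have Ee : 0 <= E * e by rewrite mulr_ge0.
  move=> i; have [[j /eqP <-]|no] := pselect (exists j, g j == i).
    by apply: le_trans (wE j) _; rewrite mulrDl mul1r; lra.
  apply: (@le_trans _ _ e); last by rewrite mulrDl mul1r -mulrA; lra.
  by apply: off => j; apply/negP => ej; apply: no; exists j.
Qed.

End Implicit.

(** * Nonsingular points *)

Lemma expr1D_le_expR (R : realType) (t : R) N : 0 <= t -> (0 < N)%N ->
  (1 + t / N%:R) ^+ N <= expR t.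
Proof.
move=> t0 N0; have N0' : 0 < N%:R :> R by rewrite ltr0n.
have -> : expR t = expR (t / N%:R) ^+ N.
  by rewrite -expRM_natl mulrC divfK // gt_eqF.
rewrite lerXn2r ?nnegrE ?expR_ge0 // ?expR_ge1Dx //.
by rewrite addr_ge0 // divr_ge0 // ltW.
Qed.

Lemma le_invn_eq0 (R : realType) (X K L : R) : 0 <= X ->
  (forall N : nat, (0 < N)%N -> L <= N%:R -> X <= K / N%:R) -> X = 0.
Proof.
move=> X0 h; apply/eqP; rewrite eq_le X0 andbT leNgt; apply/negP => Xp.
pose N := (Num.bound (`|K / X| + `|L|)).+1.
have hN : `|K / X| + `|L| < N%:R.
  apply: (@lt_trans _ _ (Num.bound (`|K / X| + `|L|))%:R); last by rewrite ltr_nat.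
  exact: archi_boundP.
have N0' : 0 < N%:R :> R by rewrite ltr0n.
have l1 := ler_norm L; have l2 := ler_norm (K / X).
have k0 : 0 <= `|K / X| by []. have k1 : 0 <= `|L| by [].
have := h N isT; rewrite ler_pdivlMr // => /(_ _) h1.
have : X * N%:R <= K by apply: h1; lra.
rewrite mulrC -ler_pdivlMr //; lra.
Qed.

Section Nonsingular.
Variables (R : realType) (n : nat) (gs : seq (poly_n n R)) (e : nat) (x : 'rV[R]_n).
Variable O : set 'rV[R]_n.
Hypothesis hP : prime_ideal (ideal_gen gs).
Hypothesis he : is_krull_dim (ideal_gen gs) e.
Hypothesis Vx : zeroset (ideal_gen gs) x.
Hypothesis rk : jacobian_rank gs x = (n - e)%N.
Hypothesis oO : open O.
Hypothesis Ox : O x.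

(* Near [x] the zero set of [n - e] of the generators is a graph over [e] coordinates. The
   other generators vanish on it because along the graph they satisfy a linear differential
   system with zero initial value; this is proved by the Euler estimate [euler_bound]. *)
Lemma nonsingular_manifold :
  exists M : set 'rV[R]_n, M `<=` zeroset (ideal_gen gs) `&` O /\ is_manifold M e.
Proof.
have en : (e <= n)%N.
  by have [e' [[le he'] _ _ _ _]] := prime_dimension hP; rewrite (krull_dim_unique he he').
have [f [g [dl [q [ginj Pf dlx uB [Ph Vh [mu [c rel]]]]]]]] :=
  nonsingular_point_data hP he Vx rk.
pose x0 := pt x.
have fx i : mpoly.meval x0 (f i) = 0 by apply: Vx.
have [s0 s00 sO] := open_cube oO Ox.
pose Rx : R := \sum_i `|x0 i| + 1.
have hx0 i : `|x0 i| <= Rx.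
  by rewrite /Rx (bigD1 i) //= -addrA lerDl addr_ge0 // sumr_ge0.
have [C C0 hC] := meval_lipschitz dl Rx.
pose d0 : R := `|peval x dl| / 2.
have d00 : 0 < d0 by rewrite divr_gt0 // normr_gt0.
have C10 : 0 < C + 1 by rewrite ltr_wpDl.
(* Within this radius points stay in [O], the Lipschitz bound for [dl] applies, and [dl] keeps at
   least half of its absolute value at [x]. *)
pose rho1 := Num.min s0 (Num.min 1 (d0 / (C + 1))).
have rho10 : 0 < rho1 by rewrite !lt_min s00 ltr01 divr_gt0.
have [rho [sg [L [[rho0 rhor sg0 sg1 L1] sol uniq]]]] := implicit_solution ginj uB fx rho10.
have rho_1 : rho <= 1 by apply: le_trans rhor _; rewrite !ge_min lexx !orbT.
have dlz z : cube x0 rho z -> d0 <= `|mpoly.meval z dl|.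
  move=> hz; have := hC x0 (fun i => z i - x0 i) rho hx0 hz; rewrite ltW // rho_1 => /(_ isT).
  have -> : mpoly.meval (fun i => x0 i + (z i - x0 i)) dl = mpoly.meval z dl.
    by apply: mpoly.meval_eq => i; rewrite addrC subrK.
  have : C * rho <= d0.
    have : rho <= d0 / (C + 1) by apply: le_trans rhor _; rewrite !ge_min lexx !orbT.
    rewrite ler_pdivlMr //; nra.
  have : `|mpoly.meval x0 dl| = d0 * 2 by rewrite /d0 divfK.
  have := ler_normD (mpoly.meval x0 dl - mpoly.meval z dl) (mpoly.meval z dl).
  rewrite subrK (distrC (mpoly.meval x0 dl)); lra.
have zO z : cube x0 rho (pt z) -> O z.
  by move=> hz; apply: sO => i; apply: le_trans (hz i) _; apply: le_trans rhor _; rewrite !ge_min lexx.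
have Rz z : cube x0 rho z -> forall i, `|z i| <= Rx.
  move=> hz i; rewrite -(subrK (x0 i) (z i)) addrC; apply: le_trans (ler_normD _ _) _.
  rewrite lerD //; first by rewrite (bigD1 i) //= lerDl; apply: sumr_ge0.
  by apply: le_trans (hz i) _.
pose Cs : {set 'I_n} := finset.setC [set g j | j in [set: 'I_(n - e)]%SET]%SET.
have ec : #|Cs| = e.
  by rewrite cardsCs finset.setCK card_imset // cardsT !card_ord subKn.
pose g' (k : 'I_e) : 'I_n := enum_val (cast_ord (esym ec) k).
have g'inj : injective g' by move=> k k' /enum_val_inj /cast_ord_inj.
have g'g k j : g j != g' k.
  have := enum_valP (cast_ord (esym ec) k); rewrite -/(g' k) inE; apply: contra => /eqP <-.
  by apply: imset_f; rewrite inE.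
have g'surj i : (forall j, g j != i) -> exists k, g' k = i.
  move=> h; have iC : i \in Cs.
    by rewrite inE; apply/imsetP => -[j _ ej]; have := h j; rewrite ej eqxx.
  exists (cast_ord ec (enum_rank_in iC i)); rewrite /g' cast_ordK enum_rankK_in //.
pose v (y : 'rV[R]_e) (i : 'I_n) : R := if [pick k | g' k == i] is Some k then y ord0 k else x0 i.
have vg' y k : v y (g' k) = y ord0 k.
  rewrite /v; case: pickP => [k' /eqP /g'inj -> //|/(_ k)]; by rewrite eqxx.
pose y0 : 'rV[R]_e := \row_k x0 (g' k).
pose V : set 'rV[R]_e := ball y0 sg.
have VP y : V y <-> forall k, `|y ord0 k - y0 ord0 k| < sg.
  rewrite /V; split=> [[_ h] k|h]; first by have := h ord0 k; rewrite /ball /= distrC.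
  by split => // i j; rewrite (ord1 i) /ball /= distrC.
have Vv y : V y -> cube x0 sg (v y).
  move=> /VP Vy i; rewrite /v; case: pickP => [k /eqP <-|_]; last by rewrite subrr normr0 ltW.
  by have := Vy k; rewrite mxE => /ltW.
have /choice [psi hpsi] : forall y : 'rV[R]_e, exists z : 'I_n -> R, V y ->
    [/\ cube x0 rho z, forall k, z (g' k) = y ord0 k & forall i, mpoly.meval z (f i) = 0].
  move=> y; have [Vy|nVy] := pselect (V y); last by exists x0.
  have [z [hz zv fz]] := sol _ (Vv y Vy); exists z => _; split => // k.
  by rewrite zv ?vg' // => j; apply: g'g.
have lip y y' (d : R) : V y -> V y' -> 0 <= d <= 1 ->
    (forall k, `|y ord0 k - y' ord0 k| <= d) -> forall i, `|psi y i - psi y' i| <= L * d.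
  move=> Vy Vy' hd h; have [h1 h2 h3] := hpsi y Vy; have [h1' h2' h3'] := hpsi y' Vy'.
  by apply: uniq => // i /g'surj [k <-]; rewrite h2 h2'.
have Vy0 : V y0 by apply: ballxx.
have psi0 : psi y0 = x0.
  have [h1 h2 h3] := hpsi y0 Vy0.
  have x0c : cube x0 rho x0 by move=> i; rewrite subrr normr0 ltW.
  apply/funext => i; apply/eqP; rewrite -subr_eq0 -normr_le0 -(mulr0 L).
  apply: uniq => //; first by rewrite lexx ler01.
  by move=> l /g'surj [k <-]; rewrite h2 mxE subrr normr0.
have [a [b [a0 b0 eb]]] := euler_bound Rx d00 rel.
have L0 : 0 <= L by apply: le_trans L1.
have van y l : V y -> mpoly.meval (psi y) (q l) = 0.
  move=> Vy; apply/eqP; rewrite -normr_eq0; apply/eqP.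
  apply: (@le_invn_eq0 R _ (b * L ^+ 2 * expR (a * L)) L) => // N N0 LN.
  have N0' : 0 < N%:R :> R by rewrite ltr0n.
  (* The segment from [y0] to [y] in [N] steps. Coordinates move by at most [1 / N] per step because
     [sg <= 1], and [psi] has Lipschitz constant [L], hence [eta = L / N] and a total error of order
     [1 / N]. *)
  pose yt (t : nat) : 'rV[R]_e := \row_k (y0 ord0 k + t%:R / N%:R * (y ord0 k - y0 ord0 k)).
  have Vyt t : (t <= N)%N -> V (yt t).
    move=> tN; apply/VP => k; rewrite mxE addrAC subrr add0r normrM.
    have /VP /(_ k) hk := Vy.
    have tN1 : 0 <= (t%:R / N%:R : R) <= 1.
      by rewrite divr_ge0 ?(ltW N0') //= ler_pdivrMr // mul1r ler_nat.
    case/andP: tN1 => t0 t1; rewrite (ger0_norm t0).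
    by apply: le_lt_trans hk; rewrite ler_piMl.
  pose eta := L / N%:R.
  have eta0 : 0 <= eta by rewrite divr_ge0 // ltW.
  have eta1 : eta <= 1 by rewrite ler_pdivrMr // mul1r.
  have := eb (fun t => psi (yt t)) eta N; rewrite eta0 eta1 => /(_ isT) hb.
  have ytN : yt N = y.
    by apply/rowP => k; rewrite mxE divff ?gt_eqF // mul1r addrC subrK.
  have yt0 : yt 0%N = y0 by apply/rowP => k; rewrite !mxE mul0r mul0r addr0.
  have {}hb := hb _ _ _ l; rewrite ytN in hb.
  have : `|mpoly.meval (psi y) (q l)| <= b * eta ^+ 2 * N%:R * (1 + a * eta) ^+ N.
    apply: hb.
    - move=> t tN; have [h1 h2 h3] := hpsi _ (Vyt t tN); split => //; [exact: Rz|exact: dlz].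
    - move=> t tN i.
      have -> : eta = L * N%:R^-1 by [].
      apply: lip; [exact: Vyt|apply: Vyt; exact: ltnW| |].
        by rewrite invr_ge0 ltW //= invf_le1 // ler1n.
      move=> k; rewrite [yt t.+1 _ _]mxE [yt t _ _]mxE.
      have -> : y0 ord0 k + t.+1%:R / N%:R * (y ord0 k - y0 ord0 k) -
          (y0 ord0 k + t%:R / N%:R * (y ord0 k - y0 ord0 k)) = N%:R^-1 * (y ord0 k - y0 ord0 k).
        by rewrite -(natr1 t); ring.
      rewrite normrM ger0_norm ?invr_ge0 ?(ltW N0') // ler_piMr ?invr_ge0 ?(ltW N0') //.
      by have /VP /(_ k) hk := Vy; apply: ltW; apply: lt_le_trans sg1.
    - by move=> l'; rewrite yt0 psi0; apply: Vx.
  move=> h; apply: le_trans h _.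
  have -> : b * eta ^+ 2 * N%:R * (1 + a * eta) ^+ N =
      b * L ^+ 2 * (1 + a * L / N%:R) ^+ N / N%:R.
    by rewrite -(mulrA a L) -/eta; set w := (1 + _) ^+ N; rewrite /eta; field; rewrite gt_eqF.
  rewrite ler_wpM2r ?invr_ge0 ?(ltW N0') // ler_wpM2l ?mulr_ge0 ?sqr_ge0 //.
  by apply: expr1D_le_expR => //; apply: mulr_ge0.
pose G (y : 'rV[R]_e) : 'rV[R]_n := \row_i psi y i.
have ptG y : pt (G y) = psi y by apply/funext => i; rewrite /pt mxE.
pose pr (z : 'rV[R]_n) : 'rV[R]_e := \row_k z ord0 (g' k).
have prG y : V y -> pr (G y) = y.
  by move=> Vy; apply/rowP => k; rewrite !mxE; case: (hpsi y Vy).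
exists [set G y | y in V]; split.
  move=> _ [y Vy <-]; split; last by apply: zO; rewrite ptG; case: (hpsi y Vy).
  by apply: Vh => l; rewrite /peval ptG; apply: van.
split; first by exists (G y0); exists y0.
move=> p [yp Vyp ep]; exists setT; split; first exact: openT.
split=> //; exists V, pr, G; split; first exact: ball_open.
split.
  apply/within_continuous_rVP => z _ d dd; exists d => // z' _ h k.
  by rewrite !mxE; apply: h.
split.
  apply/within_continuous_rVP => y Vy d dd.
  pose d' := Num.min 1 (d / (2 * L)).
  have L20 : 0 < 2 * L by rewrite mulr_gt0 // (lt_le_trans ltr01).
  have d'0 : 0 < d' by rewrite lt_min ltr01 divr_gt0.
  exists d' => // y' Vy' h i; rewrite !mxE.
  have := lip y' y d' Vy' Vy; rewrite ltW //= ge_min lexx => /(_ isT (fun k => ltW (h k)) i) h1.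
  apply: le_lt_trans h1 _.
  have : d' <= d / (2 * L) by rewrite ge_min lexx orbT.
  rewrite ler_pdivlMr // => h2.
  have : L * d' * 2 <= d by rewrite mulrC mulrA mulrC.
  by lra.
split=> [z [[y Vy <-] _]|y Vy]; first by rewrite prG.
by split; [split => //; exists y|apply: prG].
Qed.

End Nonsingular.

Theorem theorem3p13 (R : realType) (n : nat) (S : set 'rV[R]_n)
  (I : set (poly_n n R)) (k : nat) (gens : 'I_k -> seq (poly_n n R)) :
  semialgebraic S ->
  is_ideal I ->
  (* prime decomposition I = I_1 \cap ... \cap I_k, with I_t = <gens t> *)
  (forall t, prime_ideal (ideal_gen (gens t))) ->
  I = \bigcap_(t in [set: 'I_k]) ideal_gen (gens t) ->
  (forall s : 'I_k, \bigcap_(t in [set t | t != s]) ideal_gen (gens t) <> I) ->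
  (interior S `&` zeroset I) !=set0 ->
  [<-> vanishing_ideal (interior S `&` zeroset I) = I;
       forall t : 'I_k, exists d : nat, is_krull_dim (ideal_gen (gens t)) d /\
         exists x, (zeroset (ideal_gen (gens t)) `&` interior S) x /\
                   jacobian_rank (gens t) x = (n - d)%N;
       forall t : 'I_k, exists d : nat, is_krull_dim (ideal_gen (gens t)) d /\
         is_topdim (zeroset (ideal_gen (gens t)) `&` interior S) d%:Z].
Proof.
move=> _ _ hP IE irr _; set O := interior S.
have oO : open O by apply: open_interior.
have IP p : I p <-> forall t, ideal_gen (gens t) p.
  by rewrite IE; split=> [h t|h t _]; apply: h.
have VI t x : zeroset (ideal_gen (gens t)) x -> zeroset I x by move=> h p /IP /(_ t) /h.
tfae.
- move=> e1 t; have [d [[_ hd] _ _ _ _]] := prime_dimension (hP t); exists d; split=> //.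
  have [q Pq nq] : exists2 q, (forall s, s != t -> ideal_gen (gens s) q) & ~ I q.
    apply: contrapT => h; apply: (irr t); apply/seteqP; split=> [q hq|q /IP hq s _]; last exact: hq.
    by apply: contrapT => nq; apply: h; exists q.
  have [p np hp] := jacobian_rank_ge (hP t) hd.
  have /existsNP [x /not_implyP [Vx /not_implyP [Ox /eqP /hp ge]]] :
      ~ forall x, zeroset (ideal_gen (gens t)) x -> O x -> peval x p = 0.
    move=> h; apply: np; apply: (prime_component_vanishing hP IP Pq nq _ h) => p' hp'.
    by rewrite -e1 => x [Ox Vx]; apply: hp'.
  exists x; split=> //; apply/eqP; rewrite eqn_leq ge andbT.
  exact: jacobian_rank_le (hP t) hd Vx.
- move=> e2 t; have [d [hd [x [[Vx Ox] rk]]]] := e2 t; exists d; split=> //; right; split.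
    have [M [MV hM]] := nonsingular_manifold (hP t) hd Vx rk oO Ox.
    by exists M, d.
  move=> M m MV /manifold_dense_image [F hF]; rewrite lez_nat.
  by apply: (dense_image_dim_le (hP t) hd _ hF) => z /MV [].
- move=> e3; apply/seteqP; split=> [p van|p Ip x [_ Vx]]; last exact: Vx.
  (* The empty case of [is_topdim] would force [d%:Z = -1], so a manifold of dimension [d] is
     available. *)
  apply/IP => t; have [d [hd [[_ //]|[[M [m [MV [hM [dm]]]]] _]]]] := e3 t.
  rewrite -{}dm in hM; have [F hF] := manifold_dense_image hM.
  apply: (dense_image_vanishing (hP t) hd _ hF) => z /MV [] // Vz Oz.
  by apply: van; split=> //; apply: VI Vz.
Qed.
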